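(* Let $F\in\mathbb{Z}[X]$ be a $*$-symmetric polynomial of even degree $2n$ satisfying (Square). Let $m_\pm$ be the multiplicity of $X\mp1$ in $F$, put $F_{12}(X)=F(X)/((X-1)^{m_+}(X+1)^{m_-})$, and let $i_+,i_-\in\mathbb{Z}$ be integers with $$-m_+\le i_+\le m_+,\quad -m_-\le i_-\le m_-,\quad i_+\equiv i_-\equiv m_+\bmod 2,\quad i_++i_-\equiv 1-e(F_{12})\bmod 4 .$$ Assume that (a) $m_+\ne1$ and $m_-\ne1$, or (b) $F$ is a product of cyclotomic polynomials. Then there exists $\mathfrak{j}\in\mathrm{Idx}(n,n;F)$ with $\mathfrak{j}(X-1)\equiv i_+$ and $\mathfrak{j}(X+1)\equiv i_-\bmod 4$ such that an even unimodular lattice over $\mathbb{Z}$ of signature $(n,n)$ admits a semisimple $(F,\mathfrak{j})$-isometry.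
   Context: For a monic polynomial $F$ with $F(0)\ne0$ put $F^*(X)=F(0)^{-1}X^{\deg F}F(X^{-1})$; $F$ is $*$-symmetric if $F^*=F$ (in particular monic). (Square): $|F(1)|$, $|F(-1)|$ and $(-1)^{(\deg F)/2}F(1)F(-1)$ are all squares. For a $*$-symmetric $P\in\mathbb{R}[X]$ with $P(1)P(-1)\neq0$ (which then has even degree), $e(P)\in\{1,-1\}$ denotes the sign of $(-1)^{\deg(P)/2}P(1)P(-1)$. $I(F;\mathbb{R})$ is the set of $*$-symmetric monic irreducible factors of $F$ in $\mathbb{R}[X]$, $I_1(F;\mathbb{R})=I(F;\mathbb{R})\setminus\{X-1,X+1\}$, and $m_f$ is the multiplicity of $f$ in $F$. For $r+s=\deg F$, $\mathrm{Idx}(r,s;F)$ is the set of maps $\mathfrak{i}:I(F;\mathbb{R})\to\mathbb{Z}$ with: $-\deg(f^{m_f})\le\mathfrak{i}(f)\le\deg(f^{m_f})$ and $\mathfrak{i}(f)\equiv\deg(f^{m_f})\bmod2$ for all $f\in I(F;\mathbb{R})$; $(\deg(f^{m_f})\pm\mathfrak{i}(f))/2\equiv0\bmod2$ for all $f\in I_1(F;\mathbb{R})$; and $\sum_f\mathfrak{i}(f)=r-s$. If $X\mp1\nmid F$, put $\mathfrak{i}(X\mp1)=0$. A lattice over $\mathbb{Z}$ is a finitely generated free $\mathbb{Z}$-module with a nondegenerate symmetric bilinear form $b$ with values in $\mathbb{Z}$; it is unimodular if its Gram matrix is invertible over $\mathbb{Z}$, even if $b(x,x)\in2\mathbb{Z}$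 for all $x$. Its signature is that of its scalar extension to $\mathbb{R}$. The index of an isometry $t$ of a lattice (or of a real inner product space) with characteristic polynomial $F$ is the map $f\mapsto r_f-s_f$ on $I(F;\mathbb{R})$, where $(r_f,s_f)$ is the signature of $\{v\in V\mid f(t)^Nv=0\text{ for some }N\ge0\}$ in the real inner product space $V$ (obtained by extending scalars). An $(F,\mathfrak{j})$-isometry is an isometry with characteristic polynomial $F$ and index $\mathfrak{j}$. Semisimple means semisimple as a linear transformation after extending scalars to $\mathbb{Q}$. *)

(* Defs.v *)
From mathcomp Require Import all_boot all_order all_algebra all_field.
From mathcomp Require Import boolp classical_sets fsbigop reals.

Set Implicit Arguments.
Unset Strict Implicit.
Unset Printing Implicit Defensive.

Import Order.TTheory GRing.Theory Num.Theory.

Local Open Scope classical_set_scope.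
Local Open Scope ring_scope.

(* Recall that size P = deg P + 1 for a nonzero polynomial P. *)
Definition deg (K : nzRingType) (P : {poly K}) : nat := (size P).-1.

(* F(0)^-1 X^(deg F) F(X^-1) *)
Definition star (K : fieldType) (F : {poly K}) : {poly K} :=
  (F.[0])^-1 *: \sum_(i < size F) F`_i *: 'X^(deg F - i).

Definition star_symmetric (K : fieldType) (F : {poly K}) : Prop :=
  [/\ F \is monic, F.[0] != 0 & star F = F].

Definition is_square (z : int) : Prop := exists a : int, z = a ^+ 2.

Definition Square (F : {poly int}) : Prop :=
  [/\ is_square `|F.[1]|, is_square `|F.[-1]| &
      is_square ((-1) ^+ (deg F %/ 2) * F.[1] * F.[-1])].

(* The multiplicity of f in F, for F nonzero and f nonconstant: f ^+ k %| F
   then forces k <= deg F. *)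
Definition mult (K : fieldType) (f F : {poly K}) : nat :=
  \max_(k < size F | f ^+ k %| F) k.

Definition F12 (K : fieldType) (F : {poly K}) : {poly K} :=
  F %/ (('X - 1) ^+ mult ('X - 1) F * ('X + 1) ^+ mult ('X + 1) F).

Definition esign (R : realType) (P : {poly R}) : int :=
  sgz ((-1) ^+ (deg P %/ 2) * P.[1] * P.[-1]).

Section Indices.
Variable R : realType.
Implicit Types (F f : {poly R}) (j : {poly R} -> int).

Definition Isym F : set {poly R} :=
  [set f | [/\ f \is monic, irreducible_poly f, star_symmetric f & f %| F]].

Definition Isym1 F : set {poly R} := Isym F `\` [set 'X - 1; 'X + 1].

Definition degm f F : int := (deg (f ^+ mult f F))%:Z.

(* A map I(F;R) -> Z is encoded by its extension by zero to all polynomials,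
   which agrees with the convention j(X -+ 1) = 0 when X -+ 1 does not divide F.
   The set Isym F is finite for F nonzero. *)
Definition Idx (r s : nat) F : set ({poly R} -> int) :=
  [set j | [/\ (forall f, ~ Isym F f -> j f = 0),
      (forall f, Isym F f -> - degm f F <= j f <= degm f F),
      (forall f, Isym F f -> (j f = degm f F %[mod 2])%Z),
      (forall f, Isym1 F f ->
         (((degm f F + j f)%R %/ 2)%Z = 0 %[mod 2])%Z /\
         (((degm f F - j f)%R %/ 2)%Z = 0 %[mod 2])%Z) &
      \sum_(f \in Isym F) j f = r%:Z - s%:Z]].

End Indices.

(* Bilinear forms are given by Gram matrices, and linear maps by matrices
   acting on row vectors from the right. *)
Definition bform (A : pzRingType) (k : nat) (G : 'M[A]_k) (x y : 'rV[A]_k) : A :=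
  (x *m G *m y^T) 0 0.

Definition mxeval (A : pzRingType) (k : nat) (T : 'M[A]_k) (f : seq A) : 'M[A]_k :=
  \sum_(i < size f) f`_i *: T ^+ i.

(* W is a subspace of R^k on which the symmetric form G is nondegenerate of
   signature (r, s): the rows of E form an orthonormal basis of W. *)
Definition signature_on (R : realType) (k : nat) (G : 'M[R]_k)
    (W : set 'rV[R]_k) (r s : nat) : Prop :=
  exists E : 'M[R]_(r + s, k),
    [/\ row_free E, (forall v, W v <-> (v <= E)%MS) &
        E *m G *m E^T = block_mx 1%:M 0 0 (- 1%:M)].

Definition primary_space (R : realType) (k : nat) (T : 'M[R]_k) (f : {poly R}) :
    set 'rV[R]_k :=
  [set v | exists N : nat, v *m mxeval T f ^+ N = 0].

Definition has_index (R : realType) (k : nat) (G T : 'M[R]_k)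
    (j : {poly R} -> int) : Prop :=
  forall f, Isym (char_poly T) f ->
    exists r s : nat,
      signature_on G (primary_space T f) r s /\ j f = r%:Z - s%:Z.

Record lattice := Lattice {
  rank : nat;
  gram : 'M[int]_rank;
  gram_sym : forall x y, bform gram x y = bform gram y x;
  gram_nondeg : forall x, (forall y, bform gram x y = 0) -> x = 0
}.

Definition unimodular (L : lattice) : Prop := gram L \in unitmx.

Definition even (L : lattice) : Prop :=
  forall x, (2 %| bform (gram L) x x)%Z.

Definition has_signature (R : realType) (L : lattice) (r s : nat) : Prop :=
  signature_on (map_mx intr (gram L) : 'M[R]_(rank L)) setT r s.

Definition isometry (L : lattice) (T : 'M[int]_(rank L)) : Prop :=
  T \in unitmx /\
  forall x y, bform (gram L) (x *m T) (y *m T) = bform (gram L) x y.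

Definition Fj_isometry (R : realType) (L : lattice) (F : {poly int})
    (j : {poly R} -> int) (T : 'M[int]_(rank L)) : Prop :=
  [/\ isometry T, char_poly T = F &
      has_index (map_mx intr (gram L)) (map_mx intr T) j].

(* Every invariant subspace has an invariant complement. *)
Definition semisimple (K : fieldType) (k : nat) (T : 'M[K]_k) : Prop :=
  forall U : 'M[K]_k, stablemx U T ->
    exists W : 'M[K]_k,
      [/\ stablemx W T, (U + W :=: 1%:M)%MS & (U :&: W = 0)%MS].

(* Main.v *)
(* Split F over Z as E * prod h h^#, with h irreducible over Q, h^# the star of
   h, and E star-symmetric and separable.  The factor h h^# is realised on a
   module plus its dual.  If P is separable of degree 2k and P(0) = -1, so that
   P is antipalindromic, then on Z[X]/(P) the form for which b(X^i, X^j) is the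
   coefficient of X^(2k-1) in X^(k-1+i-j) mod P is even, unimodular and
   preserved by X, and 1, X, ..., X^(k-1) span a Lagrangian: the signature is
   (k, k).  This settles E(0) = -1.  If E(0) = 1, take P = (X^2-1) E and add the
   hyperbolic plane with the swap: the characteristic polynomial becomes
   (X^2-1)^2 E.  When F(eps) <> 0 for eps = 1 or -1, the first two conditions in
   (Square) give an isotropic eigenvector z with eigenvalue eps in this lattice,
   and z^perp/z has (X-eps)^2 removed; the third condition makes both
   reductions possible at once.

   Over R, every semisimple isometry splits into lines, definite planes and
   hyperbolic pieces; adding these up gives an index in Idx(r,s;F) satisfying
   i_+ + i_- = r - s + 1 - e(F_12) mod 4.  Hence only i_+ has to be arranged,
   by the choice of the signs of the two antipalindromic blocks. *)
Require Import Defs.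
From mathcomp Require Import all_boot all_order all_algebra all_field.
From mathcomp Require Import boolp classical_sets fsbigop reals.
From mathcomp Require Import cardinality complex.
From mathcomp Require Import zify ring lra.

Import Order.TTheory GRing.Theory Num.Theory.
Local Open Scope ring_scope.
Set Implicit Arguments.
Unset Strict Implicit.
Unset Printing Implicit Defensive.

(** * Evaluation of polynomials at matrices, semisimplicity *)

(** What shapes the construction is the constant term. Reversing the recurrence of an
    antipalindromic polynomial changes its sign, so the one relation that the recurrence does not
    give directly, centred at [k], reads S = -S and holds. For a palindromic [E] this argument is
    missing; the factor X^2 - 1 changes the sign of E(0) and costs a surplus (X - 1)^2 (X + 1)^2. If
    F(eps) = 0, then E(eps) <> 0 forces X - eps to be one of the [h], and that [h] is dropped, since
    h h^# = (X - eps)^2. If F(eps) <> 0, the surplus is reduced away: with deg E = 2m, the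
    eigenvectors for eps in the two blocks have norms 2 eps * eps^m E(eps) and 2 eps * dl, where dl
    = 1 or -1 is the sign given to the hyperbolic plane, and a combination is isotropic once eps^m
    E(eps) = -dl c^2. Reducing at both eps requires one common dl. A separable antipalindromic block
    has 1 as a simple root, hence an odd index there, and negating its form exchanges the two odd
    classes modulo 4. Semisimplicity is carried along as a separable polynomial killing the
    isometry, which survives sums, base changes and subquotients. *)

Section MxEval.
Variable A : comNzRingType.

Lemma mxeval_horner n (T : 'M[A]_n.+1) (p : {poly A}) :
  mxeval T p = horner_mx T p.
Proof.
rewrite -[p in RHS]coefK poly_def rmorph_sum /mxeval.
apply: eq_bigr => i _.
by rewrite -mul_polyC rmorphM /= horner_mx_C rmorphXn /= horner_mx_X -mul_scalar_mx.
Qed.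

Lemma mxevalM n (T : 'M[A]_n) (p q : {poly A}) :
  mxeval T (p * q) = mxeval T p *m mxeval T q.
Proof.
case: n T => [|n] T; first by rewrite [LHS]thinmx0 [RHS]thinmx0.
by rewrite !mxeval_horner rmorphM.
Qed.

Lemma mxevalD n (T : 'M[A]_n) (p q : {poly A}) :
  mxeval T (p + q) = mxeval T p + mxeval T q.
Proof.
case: n T => [|n] T; first by rewrite [LHS]thinmx0 [RHS]thinmx0.
by rewrite !mxeval_horner rmorphD.
Qed.

Lemma mxevalC n (T : 'M[A]_n) (c : A) : mxeval T c%:P = c%:M.
Proof.
case: n T => [|n] T; first by rewrite [LHS]thinmx0 [RHS]thinmx0.
by rewrite mxeval_horner horner_mx_C.
Qed.

Lemma mxeval1 n (T : 'M[A]_n) : mxeval T (1 : {poly A}) = 1%:M.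
Proof. exact: mxevalC. Qed.

Lemma mxevalX n (T : 'M[A]_n) : mxeval T ('X : {poly A}) = T.
Proof.
case: n T => [|n] T; first by rewrite [LHS]thinmx0 [RHS]thinmx0.
by rewrite mxeval_horner horner_mx_X.
Qed.

Lemma mxeval_char n (T : 'M[A]_n) : mxeval T (char_poly T) = 0.
Proof.
case: n T => [|n] T; first by rewrite [LHS]thinmx0.
by rewrite mxeval_horner Cayley_Hamilton.
Qed.

(** A rectangular [B] lets one identity serve changes of basis, restrictions to invariant subspaces
    and quotients. *)
Lemma mxeval_intertwine m n (B : 'M[A]_(m, n)) T T' (p : {poly A}) :
  B *m T = T' *m B -> B *m mxeval T p = mxeval T' p *m B.
Proof.
move=> BT; rewrite /mxeval mulmx_sumr mulmx_suml; apply: eq_bigr => i _.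
rewrite -scalemxAr -scalemxAl; congr (_ *: _).
elim: (i : nat) => [|k IHk]; first by rewrite !expr0 -[1]/(1%:M) -[1 in RHS]/(1%:M) mulmx1 mul1mx.
by rewrite !exprSr -[_ * T]/(_ *m _) -[_ * T']/(_ *m _) mulmxA IHk -mulmxA BT mulmxA.
Qed.

Lemma mxeval_block m n (T1 : 'M[A]_m) (T2 : 'M[A]_n) (p : {poly A}) :
  mxeval (block_mx T1 0 0 T2) p = block_mx (mxeval T1 p) 0 0 (mxeval T2 p).
Proof.
set T := block_mx _ _ _ _.
have h1 : row_mx 1%:M 0 *m T = T1 *m row_mx 1%:M 0.
  by rewrite mul_row_block !mul1mx !mul0mx !addr0 mul_mx_row mulmx1 mulmx0.
have h2 : row_mx 0 1%:M *m T = T2 *m row_mx 0 1%:M.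
  by rewrite mul_row_block !mul1mx !mul0mx !add0r mul_mx_row mulmx1 mulmx0.
rewrite -[LHS]mul1mx (scalar_mx_block m n) block_mxEv mul_col_mx.
rewrite (mxeval_intertwine p h1) (mxeval_intertwine p h2).
by rewrite !mul_mx_row !mulmx1 !mulmx0 block_mxEv.
Qed.

End MxEval.

Lemma map_mxeval (A B : comNzRingType) (f : {rmorphism A -> B}) n (T : 'M[A]_n)
    (p : {poly A}) :
  map_mx f (mxeval T p) = mxeval (map_mx f T) (map_poly f p).
Proof.
case: n T => [|n] T; first by rewrite [LHS]thinmx0 [RHS]thinmx0.
by rewrite mxeval_horner map_horner_mx -mxeval_horner.
Qed.

Section Semisimple.
Variable K : fieldType.

Lemma separable_Bezout (p : {poly K}) :
  separable_poly p -> exists u v : {poly K}, u * p + v * p^`() = 1.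
Proof.
by rewrite unlock => /Bezout_eq1_coprimepP[[u v] /= h]; exists u, v.
Qed.

(* Averaging a projection onto U with the separability idempotent of K[X]/p
   gives a projection commuting with T. *)
Lemma semisimple_separable n (T : 'M[K]_n) (p : {poly K}) :
  separable_poly p -> mxeval T p = 0 -> semisimple T.
Proof.
case: n T => [|n] T.
  move=> _ _ U _; exists 0; split; rewrite ?[U]thinmx0 ?cap0mx //.
    by rewrite mul0mx sub0mx.
  by apply/eqmxP; rewrite submx1 /=; apply/submxP; exists 0; rewrite [LHS]flatmx0 [RHS]flatmx0.
move=> /separable_Bezout[u [v uv]] pT U stU.
have [pi [piU pi_sub]] : exists pi : 'M_n.+1,
    (forall m (X : 'M_(m, _)), (X <= U)%MS -> X *m pi = X) /\
    (forall m (X : 'M_(m, _)), (X *m pi <= U)%MS).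
  exists (proj_mx U (U^C)%MS); split=> m X; last exact: proj_mx_sub.
  by apply: proj_mx_id; rewrite capmx_compl.
have stUk k m (X : 'M_(m, _)) : (X <= U)%MS -> (X *m (T ^+ k) <= U)%MS.
  move=> XU; elim: k => [|k IHk]; first by rewrite expr0 mulmx1.
  rewrite exprSr -[_ * T]/(_ *m T) mulmxA.
  by rewrite (submx_trans _ stU) // submxMr.
(* [S k] is the divided difference (x^k - y^k)/(x - y), with [x] acting as [T] on the left of [pi]
   and [y] as [T] on its right; [Q] is the divided difference of [p]. *)
pose S k := \sum_(i < k) (T ^+ i * pi * T ^+ (k.-1 - i)).
pose Q := \sum_(k < size p) p`_k *: S k.
have TS k : T * S k - S k * T = T ^+ k * pi - pi * T ^+ k.
  rewrite /S mulr_sumr mulr_suml -sumrB.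
  case: k => [|k]; first by rewrite big_ord0 !expr0 mul1r mulr1 subrr.
  rewrite (eq_bigr (fun i : 'I_k.+1 => T ^+ i.+1 * pi * T ^+ (k.+1 - i.+1)
     - T ^+ i * pi * T ^+ (k.+1 - i))); last first.
    move=> i _ /=; rewrite !mulrA -exprS subSS; congr (_ - _).
    by rewrite -mulrA -exprSr subSn // -ltnS.
  rewrite -(big_mkord xpredT (fun i => T ^+ i.+1 * pi * T ^+ (k.+1 - i.+1)
     - T ^+ i * pi * T ^+ (k.+1 - i))).
  rewrite (telescope_sumr (fun i => T ^+ i * pi * T ^+ (k.+1 - i))) //.
  by rewrite subnn subn0 !expr0 mulr1 mul1r.
have TQ : T * Q = Q * T.
  apply/eqP; rewrite -subr_eq0 /Q mulr_sumr mulr_suml -sumrB.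
  rewrite (eq_bigr (fun k : 'I_(size p) => (p`_k *: T ^+ k) * pi - pi * (p`_k *: T ^+ k))).
    by rewrite sumrB -mulr_suml -mulr_sumr -/(mxeval T p) pT mul0r mulr0 subrr.
  by move=> k _; rewrite -!scalerAr -!scalerAl -scalerBr TS scalerBr.
have US k : U *m S k.+1 = k.+1%:R *: (U *m T ^+ k).
  rewrite /S mulmx_sumr (eq_bigr (fun _ => U *m T ^+ k)).
    by rewrite sumr_const card_ord scaler_nat.
  move=> i _; rewrite /= -[_ * _ * _]/(T ^+ i *m pi *m T ^+ (k - i)) !mulmxA piU ?stUk //.
  by rewrite -mulmxA -[_ *m T ^+ _]/(_ * _) -exprD subnKC // -ltnS.
(* On [U], where [pi] is the identity, the divided difference of [p] collapses to its derivative,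
   which [v] from the Bezout relation inverts at [T]. *)
have UQ : U *m Q = U *m mxeval T p^`().
  rewrite /Q mulmx_sumr mxeval_horner.
  rewrite [p^`()]/(deriv p) /deriv poly_def rmorph_sum mulmx_sumr.
  case: (size p) => [|s]; first by rewrite !big_ord0.
  rewrite big_ord_recl /= /S big_ord0 scaler0 mulmx0 add0r -/(S _).
  apply: eq_bigr => i _.
  rewrite -scalemxAr /= -/(S i.+1) US -mul_polyC rmorphM /= horner_mx_C rmorphXn /= horner_mx_X.
  by rewrite -[_ * _]/(_ *m _) mul_scalar_mx -scalemxAr scalerA mulr_natr.
have QU m (X : 'M_(m, _)) : (X *m Q <= U)%MS.
  rewrite /Q mulmx_sumr summx_sub // => k _.
  rewrite -scalemxAr scalemx_sub // /S mulmx_sumr summx_sub // => i _.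
  by rewrite -[_ * _ * _]/(_ *m _ *m _) !mulmxA stUk.
have vT : mxeval T p^`() *m mxeval T v = 1%:M.
  by rewrite -mxevalM -(mxeval1 T) -uv mxevalD [mxeval T (u * p)]mxevalM pT mulmx0 add0r mulrC.
pose pi' := Q *m mxeval T v.
have pi'U m (X : 'M_(m, _)) : (X <= U)%MS -> X *m pi' = X.
  by case/submxP => D ->; rewrite /pi' -mulmxA [U *m _]mulmxA UQ -[U *m _ *m _]mulmxA vT mulmx1.
have stv m (X : 'M_(m, _)) : (X <= U)%MS -> (X *m mxeval T v <= U)%MS.
  move=> XU; rewrite /mxeval mulmx_sumr summx_sub // => i _.
  by rewrite -scalemxAr scalemx_sub // stUk.
have pi'_sub m (X : 'M_(m, _)) : (X *m pi' <= U)%MS by rewrite /pi' mulmxA stv.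
have Tv : T *m mxeval T v = mxeval T v *m T by exact: mxeval_intertwine.
have Tpi : T *m pi' = pi' *m T.
  by rewrite /pi' mulmxA [T *m Q]TQ -[Q * T]/(Q *m T) -!mulmxA Tv.
exists (kermx pi'); split.
- by apply/sub_kermxP; rewrite -mulmxA Tpi mulmxA mulmx_ker mul0mx.
- apply/eqmxP; rewrite submx1 /=.
  have piU1 : (pi' <= U)%MS by rewrite -(mul1mx pi') pi'_sub.
  rewrite -[1%:M](subrK pi') addrC addmx_sub_adds //.
  by apply/sub_kermxP; rewrite mulmxBl mul1mx (pi'U _ pi') ?subrr.
- apply/eqP/rowV0P => x; rewrite sub_capmx => /andP[xU /sub_kermxP xk].
  by rewrite -(pi'U _ x).
Qed.

End Semisimple.

(** * Signatures *)

Definition sig_mx (K : pzRingType) r s : 'M[K]_(r + s) :=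
  block_mx 1%:M 0 0 (- 1%:M).

Section Signature.
Variable R : realType.

Lemma gram_col_mx m1 m2 k (G : 'M[R]_k) (P : 'M_(m1, k)) (Q : 'M_(m2, k)) :
  col_mx P Q *m G *m (col_mx P Q)^T =
  block_mx (P *m G *m P^T) (P *m G *m Q^T) (Q *m G *m P^T) (Q *m G *m Q^T).
Proof. by rewrite mul_col_mx tr_col_mx mul_col_row. Qed.

Lemma sig_mx_sqr r s : sig_mx R r s *m sig_mx R r s = 1%:M.
Proof.
rewrite /sig_mx mulmx_block !mulmx0 !mul0mx !addr0 !add0r.
by rewrite mulmxN !mulNmx !mul1mx opprK -scalar_mx_block.
Qed.

Lemma sig_row_free k (G : 'M[R]_k) r s (E : 'M_(r + s, k)) :
  E *m G *m E^T = sig_mx R r s -> row_free E.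
Proof.
move=> EG; apply/row_freeP; exists (G *m E^T *m sig_mx R r s).
by rewrite !mulmxA EG sig_mx_sqr.
Qed.

Lemma signature_on_block k1 k2 (G1 : 'M[R]_k1) (G2 : 'M[R]_k2) W1 W2 r1 s1 r2 s2 :
  signature_on G1 W1 r1 s1 -> signature_on G2 W2 r2 s2 ->
  signature_on (block_mx G1 0 0 G2)
    [set v | W1 (lsubmx v) /\ W2 (rsubmx v)]%classic (r1 + r2) (s1 + s2).
Proof.
move=> [E1 [_ W1E EG1]] [E2 [_ W2E EG2]].
rewrite -[E1]vsubmxK in W1E EG1; rewrite -[E2]vsubmxK in W2E EG2.
move: (usubmx E1) (dsubmx E1) (usubmx E2) (dsubmx E2) W1E EG1 W2E EG2.
move=> P1 N1 P2 N2 W1E; rewrite gram_col_mx => /eq_block_mx[pp1 pn1 np1 nn1].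
move=> W2E; rewrite gram_col_mx => /eq_block_mx[pp2 pn2 np2 nn2].
(* [sig_mx] lists all positive vectors before all negative ones, so the two bases have to be
   regrouped. *)
pose E := col_mx (block_mx P1 0 0 P2) (block_mx N1 0 0 N2).
have EG : E *m block_mx G1 0 0 G2 *m E^T = sig_mx R (r1 + r2) (s1 + s2).
  rewrite gram_col_mx !tr_block_mx !trmx0 !mulmx_block.
  rewrite !(mulmx0, mul0mx, addr0, add0r).
  rewrite pp1 pn1 np1 nn1 pp2 pn2 np2 nn2.
  by rewrite /sig_mx [in RHS](scalar_mx_block r1 r2) [in RHS](scalar_mx_block s1 s2)
    opp_block_mx !oppr0 !block_mx0.
exists E; split=> //; first exact: (sig_row_free EG).
move=> v /=; rewrite W1E W2E; split.
  move=> [/submxP[x1 e1] /submxP[x2 e2]]; apply/submxP.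
  rewrite -[x1]hsubmxK in e1; rewrite -[x2]hsubmxK in e2.
  exists (row_mx (row_mx (lsubmx x1) (lsubmx x2)) (row_mx (rsubmx x1) (rsubmx x2))).
  rewrite mul_row_col !mul_row_block !mulmx0 !addr0 !add0r add_row_mx.
  by rewrite -!mul_row_col -e1 -e2 hsubmxK.
move=> /submxP[x ->]; rewrite -[x]hsubmxK -[lsubmx x]hsubmxK -[rsubmx x]hsubmxK.
rewrite mul_row_col !mul_row_block !mulmx0 !addr0 !add0r add_row_mx.
by rewrite row_mxKl row_mxKr -!mul_row_col; split; apply: submxMl.
Qed.

Lemma signature_on_opp k (G : 'M[R]_k) W r s :
  signature_on G W r s -> signature_on (- G) W s r.
Proof.
move=> [E [_ WE EG]]; rewrite -[E]vsubmxK in WE EG.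
move: (usubmx E) (dsubmx E) WE EG => P N WE.
rewrite gram_col_mx => /eq_block_mx[pp pn np nn].
have EG : col_mx N P *m (- G) *m (col_mx N P)^T = sig_mx R s r.
  by rewrite mulmxN mulNmx gram_col_mx pp pn np nn opp_block_mx !oppr0 opprK.
exists (col_mx N P); split=> //; first exact: (sig_row_free EG).
by move=> v; rewrite WE -!addsmxE addsmxC.
Qed.

Lemma signature_on_iso k k' (G : 'M[R]_k) (G' : 'M[R]_k') (W : set 'rV_k)
    (W' : set 'rV_k') (B : 'M_(k', k)) C r s :
  B *m C = 1%:M -> C *m B = 1%:M -> B *m G *m B^T = G' ->
  (forall v, W' v <-> W (v *m B)) ->
  signature_on G W r s -> signature_on G' W' r s.
Proof.
move=> BC CB BG WW' [E [_ WE EG]].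
have EG' : (E *m C) *m G' *m (E *m C)^T = sig_mx R r s.
  rewrite -BG trmx_mul !mulmxA -[E *m C *m B]mulmxA CB mulmx1.
  by rewrite -[E *m G *m B^T *m C^T]mulmxA -trmx_mul CB trmx1 mulmx1.
exists (E *m C); split=> //; first exact: (sig_row_free EG').
move=> v; rewrite WW' WE; split => /submxP[x e]; apply/submxP; exists x.
  by rewrite mulmxA -e -mulmxA BC mulmx1.
by rewrite e -!mulmxA CB mulmx1.
Qed.

Lemma signature_on_set0 k (G : 'M[R]_k) (W : set 'rV_k) :
  (forall v, W v <-> v = 0) -> signature_on G W 0 0.
Proof.
move=> W0; exists 0; split.
- by rewrite /row_free mxrank0.
- by move=> v; rewrite W0; split=> [->|]; [exact: sub0mx | move=> /submx0null].
- by rewrite [LHS]flatmx0 [RHS]flatmx0.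
Qed.

(** Amounts to [signature_on] for the whole space, with spanning replaced by an equation of
    dimensions; being an equation and not part of the type, it avoids casts between block sizes. *)
Definition tsig N (G : 'M[R]_N) r s :=
  N = (r + s)%N /\ exists B : 'M_(r + s, N), B *m G *m B^T = sig_mx R r s.

Lemma tsig_signature N (G : 'M[R]_N) r s :
  tsig G r s -> signature_on G setT r s.
Proof.
move=> [eN [B BG]]; exists B; have fB := sig_row_free BG; split=> // v; split=> // _.
by apply: submx_full; rewrite /row_full (eqP fB) eN.
Qed.

Lemma tsig_block N1 N2 (G1 : 'M[R]_N1) (G2 : 'M[R]_N2) r1 s1 r2 s2 :
  tsig G1 r1 s1 -> tsig G2 r2 s2 ->
  tsig (block_mx G1 0 0 G2) (r1 + r2) (s1 + s2).
Proof.
move=> g1 g2; split; first by case: g1 g2 => e1 _ [e2 _]; lia.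
have [E [_ _ EG]] := signature_on_block (tsig_signature g1) (tsig_signature g2).
by exists E.
Qed.

Lemma tsig_iso N N' (G : 'M[R]_N) (G' : 'M[R]_N') (B : 'M_(N', N)) C r s :
  B *m C = 1%:M -> C *m B = 1%:M -> B *m G *m B^T = G' ->
  tsig G r s -> tsig G' r s.
Proof.
move=> BC CB BG g; split.
  by have [e _] := g; have := mulmx1_min BC; have := mulmx1_min CB; lia.
have [||E [_ _ EG]] := @signature_on_iso _ _ G G' setT setT B C r s BC CB BG.
- by [].
- exact: tsig_signature.
- by exists E.
Qed.

Lemma tsig_opp N (G : 'M[R]_N) r s : tsig G r s -> tsig (- G) s r.
Proof.
move=> g; split; first by case: g => e _; lia.
by have [E [_ _ EG]] := signature_on_opp (tsig_signature g); exists E.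
Qed.

Lemma tsig_unit N (G : 'M[R]_N) r s : tsig G r s -> G \in unitmx.
Proof.
case=> eN [B BG]; subst N; move: (congr1 determinant BG) (congr1 determinant (sig_mx_sqr r s)).
rewrite !det_mulmx det1 unitmxE => <- h; rewrite unitfE.
by apply: contra_eq_neq h => ->; rewrite mulr0 !mul0r eq_sym oner_eq0.
Qed.

Lemma sqr_rV_ge0 m (x : 'rV[R]_m) : 0 <= (x *m x^T) 0 0.
Proof. by rewrite mxE sumr_ge0 // => i _; rewrite mxE -expr2 sqr_ge0. Qed.

Lemma sqr_rV_eq0 m (x : 'rV[R]_m) : (x *m x^T) 0 0 = 0 -> x = 0.
Proof.
rewrite mxE => /eqP; rewrite psumr_eq0; last by move=> i _; rewrite mxE -expr2 sqr_ge0.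
move=> /allP h; apply/rowP => i; have := h i (mem_index_enum i).
by rewrite /= !mxE -expr2 sqrf_eq0 => /eqP.
Qed.

(** Sylvester's law of inertia: a positive definite space of dimension [r1] and a negative definite
    one of dimension [s2] meet in 0, so r1 + s2 <= N = r2 + s2. *)
Lemma tsig_uniq N (G : 'M[R]_N) r s r' s' :
  tsig G r s -> tsig G r' s' -> r = r' /\ s = s'.
Proof.
have main r1 s1 r2 s2 : tsig G r1 s1 -> tsig G r2 s2 -> (r1 <= r2)%N.
  move=> [e1 [B1 g1]] [e2 [B2 g2]].
  rewrite -[B1]vsubmxK gram_col_mx in g1; rewrite -[B2]vsubmxK gram_col_mx in g2.
  have [pp _ _ _] := eq_block_mx g1; have [_ _ _ nn] := eq_block_mx g2.
  set P := usubmx B1 in pp; set Q := dsubmx B2 in nn.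
  suff: row_free (col_mx P Q).
    by rewrite /row_free => /eqP h; move: (rank_leq_col (col_mx P Q)); rewrite h; lia.
  rewrite -kermx_eq0; apply/eqP/row_matrixP => i; rewrite row0.
  set v := row i _; have : v *m col_mx P Q = 0 by rewrite -row_mul mulmx_ker row0.
  rewrite -[v]hsubmxK mul_row_col; move: (lsubmx v) (rsubmx v) => x y e.
  have xy : x *m P = - y *m Q by apply/eqP; rewrite mulNmx -addr_eq0 e.
  have exy : x *m x^T = - (y *m y^T).
    transitivity ((x *m P) *m G *m (x *m P)^T).
      by rewrite trmx_mul !mulmxA -2!(mulmxA x) pp mulmx1.
    rewrite xy trmx_mul linearN /= !mulmxA -2!(mulmxA (- y)) nn.
    by rewrite !mulmxN !mulNmx mulmx1 ?opprK.
  have /(congr1 (fun M : 'M_1 => M 0 0)) := exy; rewrite [RHS]mxE => exy'.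
  have x0 : (x *m x^T) 0 0 = 0.
    by apply/eqP; rewrite eq_le sqr_rV_ge0 exy' oppr_le0 sqr_rV_ge0.
  have y0 : (y *m y^T) 0 0 = 0 by apply/eqP; rewrite -oppr_eq0 -exy' x0.
  by rewrite (sqr_rV_eq0 x0) (sqr_rV_eq0 y0) row_mx0.
move=> g g'; have e : r = r' by apply/eqP; rewrite eqn_leq (main _ _ _ _ g g') (main _ _ _ _ g' g).
by split=> //; case: g g' => h _ [h' _]; lia.
Qed.

(* If (u, w) are dual bases of two isotropic subspaces, then u +- w/2 are
   orthogonal of norms +-1. *)
Lemma tsig_hyperbolic k (A : 'M[R]_k) :
  A \in unitmx -> tsig (block_mx 0 A A^T 0) k k.
Proof.
move=> uA; split=> //.
pose W := (invmx A)^T.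
have AW : A *m W^T = 1%:M by rewrite trmxK mulmxV.
have WA : W *m A^T = 1%:M by rewrite -trmx_mul mulmxV // trmx1.
exists (block_mx 1%:M (2^-1 *: W) 1%:M (- (2^-1 *: W))).
rewrite tr_block_mx !mulmx_block !trmx1 !mulmx0 !add0r !addr0 !mul1mx.
rewrite ![(- _)^T]linearN /= ![(_ *: W)^T]linearZ /= !mulmx1.
rewrite !mulNmx !mulmxN -!scalemxAl -!scalemxAr WA AW.
rewrite !scalemx1 -!rmorphN -!rmorphD /=; congr block_mx.
- by congr _%:M; lra.
- by rewrite -[0](raddf0 scalar_mx); congr _%:M; lra.
- by rewrite -[0](raddf0 scalar_mx); congr _%:M; lra.
- by rewrite -rmorphN; congr _%:M; lra.
Qed.

End Signature.

(** * Multiplicities and primary spaces *)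

Lemma char_poly_block (A : comNzRingType) m n (T1 : 'M[A]_m) (T2 : 'M[A]_n) :
  char_poly (block_mx T1 0 0 T2) = char_poly T1 * char_poly T2.
Proof. by rewrite /char_poly char_block_diag_mx det_ublock. Qed.

Lemma char_poly_scalar1 (A : comNzRingType) (a : A) :
  char_poly (a%:M : 'M_1) = 'X - a%:P.
Proof. by rewrite /char_poly det_mx11 !mxE eqxx !mulr1n. Qed.

Lemma char_poly_iso (A : comNzRingType) m n (T : 'M[A]_m) (T' : 'M[A]_n) B C :
  B *m C = 1%:M -> C *m B = 1%:M -> B *m T = T' *m B -> char_poly T' = char_poly T.
Proof.
move=> BC CB BT; have e : m = n.
  by apply/eqP; rewrite eqn_leq (mulmx1_min BC) (mulmx1_min CB).
subst n; pose P := map_mx (@polyC A).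
have -> : T' = B *m T *m C by rewrite BT -mulmxA BC mulmx1.
have PBC : P _ _ B *m P _ _ C = 1%:M by rewrite -map_mxM BC map_mx1.
rewrite /char_poly; have -> : char_poly_mx (B *m T *m C) =
    P _ _ B *m char_poly_mx T *m P _ _ C.
  rewrite /char_poly_mx mulmxBr mulmxBl !map_mxM; congr (_ - _).
  by rewrite -scalemx1 -scalemxAr mulmx1 -scalemxAl PBC.
by rewrite !det_mulmx mulrAC -det_mulmx PBC det1 mul1r.
Qed.

Section Mult.
Variable K : fieldType.
Implicit Types f p q F : {poly K}.

Lemma irredp_coprime f p : irreducible_poly f -> ~~ (f %| p) -> coprimep f p.
Proof.
move=> irrf nfp; rewrite /coprimep; apply/eqP; apply: contraNeq nfp => s1.
have := irrf.2 _ s1 (dvdp_gcdl f p); rewrite /eqp => /andP[_ h].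
exact: dvdp_trans h (dvdp_gcdr f p).
Qed.

Lemma irredp_dvdM f p q :
  irreducible_poly f -> (f %| p * q) = (f %| p) || (f %| q).
Proof.
move=> irrf; case: (boolP (f %| p)) => /= [fp|nfp]; first by rewrite dvdp_mulr.
by rewrite Gauss_dvdpr // irredp_coprime.
Qed.

Lemma irredp_monic_eq f g :
  irreducible_poly f -> irreducible_poly g -> f \is monic -> g \is monic ->
  f %| g -> f = g.
Proof.
move=> irrf irrg mf mg fg; apply/eqP; rewrite -eqp_monic //.
by apply: irrg.2 => //; rewrite gtn_eqF // irrf.1.
Qed.

Lemma irredp_monic_coprime f g :
  irreducible_poly f -> irreducible_poly g -> f \is monic -> g \is monic ->
  f != g -> coprimep f g.
Proof.
move=> irrf irrg mf mg fg; apply: irredp_coprime => //.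
by apply: contra_neqN fg; apply: irredp_monic_eq.
Qed.

Lemma dvdp_exp_mult f F k :
  (1 < size f)%N -> F != 0 -> (f ^+ k %| F) = (k <= mult f F)%N.
Proof.
move=> sf F0; have lt m : f ^+ m %| F -> (m < size F)%N.
  move=> /(dvdp_leq F0); apply: leq_trans.
  have f0 : f != 0 by rewrite -size_poly_gt0 ltnW.
  have : (0 < size (f ^+ m))%N by rewrite size_poly_gt0 expf_neq0.
  by have := size_exp f m; move: (size (f ^+ m)) (size f) sf => x y; nia.
apply/idP/idP => [fk|].
  by rewrite /mult; apply: (@leq_bigmax_cond _ (fun i : 'I_(size F) => f ^+ i %| F)
       (fun i => i : nat) (Ordinal (lt _ fk))).
have [i fi ->] : exists2 i : 'I_(size F), f ^+ i %| F & mult f F = i.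
  have /lt h0 : f ^+ 0 %| F by rewrite expr0 dvd1p.
  have [|i] := @eq_bigmax_cond _ [pred i : 'I_(size F) | f ^+ i %| F] (fun i => i : nat).
    by apply/card_gt0P; exists (Ordinal h0); rewrite inE /= expr0 dvd1p.
  by rewrite inE => ? ?; exists i.
by move=> ki; apply: dvdp_trans fi; rewrite dvdp_exp2l.
Qed.

Lemma mult_eq f F q m :
  irreducible_poly f -> F != 0 -> F = f ^+ m * q -> ~~ (f %| q) -> mult f F = m.
Proof.
move=> irrf F0 FE nfq; have sf := irrf.1.
have f0 : f != 0 by exact: irredp_neq0.
apply/eqP; rewrite eqn_leq -(dvdp_exp_mult m sf F0); apply/andP; split.
  rewrite leqNgt -(dvdp_exp_mult _ sf F0); apply: contra nfq.
  by rewrite FE exprSr dvdp_mul2l // expf_neq0.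
by rewrite FE dvdp_mulr.
Qed.

Lemma mult_factor f F :
  irreducible_poly f -> F != 0 -> exists2 q, F = f ^+ mult f F * q & ~~ (f %| q).
Proof.
move=> irrf F0; have sf := irrf.1.
have : f ^+ mult f F %| F by rewrite dvdp_exp_mult.
case/dvdpP => q e; exists q; first by rewrite mulrC.
apply/negP => fq; have : f ^+ (mult f F).+1 %| F by rewrite [F in _ %| F]e exprS dvdp_mul.
by rewrite dvdp_exp_mult // ltnn.
Qed.

Lemma multM f F G : irreducible_poly f -> F != 0 -> G != 0 ->
  mult f (F * G) = (mult f F + mult f G)%N.
Proof.
move=> irrf F0 G0; have [p Fp np] := mult_factor irrf F0.
have [q Gq nq] := mult_factor irrf G0.
apply: (@mult_eq _ _ (p * q)) => //; first by rewrite mulf_neq0.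
  by rewrite [in LHS]Fp [in LHS]Gq mulrACA exprD.
by rewrite irredp_dvdM // negb_or np nq.
Qed.

Lemma mult_eq0 f F : irreducible_poly f -> F != 0 -> ~~ (f %| F) -> mult f F = 0%N.
Proof.
by move=> irrf F0 nf; apply: (@mult_eq _ _ F) => //; rewrite expr0 mul1r.
Qed.

Lemma multXX f : irreducible_poly f -> mult f f = 1%N.
Proof.
move=> irrf; have f0 := irredp_neq0 irrf.
apply: (@mult_eq _ _ 1); rewrite ?expr1 ?mulr1 //.
by rewrite dvdp1 gtn_eqF // irrf.1.
Qed.

Lemma mult_deg_exp f F : deg (f ^+ mult f F) = (mult f F * deg f)%N.
Proof. by rewrite /deg size_exp mulnC. Qed.

End Mult.

Section Primary.
Variable R : realType.

Lemma primary_full N (T : 'M[R]_N) (f : {poly R}) v :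
  mxeval T f = 0 -> primary_space T f v.
Proof. by move=> e; exists 1%N; rewrite expr1 e mulmx0. Qed.

(** Bezout makes [mxeval T f] invertible, so no power of it kills a nonzero vector. *)
Lemma primary_zero N (T : 'M[R]_N) (f p : {poly R}) v :
  mxeval T p = 0 -> coprimep f p -> primary_space T f v <-> v = 0.
Proof.
move=> pT /Bezout_eq1_coprimepP[[u w] /= uw]; split; last first.
  by move=> ->; exists 0%N; rewrite mul0mx.
have inv : mxeval T f *m mxeval T u = 1%:M.
  by rewrite -mxevalM mulrC -(mxeval1 T) -uw mxevalD [mxeval T (w * p)]mxevalM pT mulmx0 addr0.
case=> n; elim: n => [|n IHn]; first by rewrite expr0 mulmx1.
rewrite exprSr -[_ * mxeval T f]/(_ *m mxeval T f) mulmxA.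
by move/(congr1 (mulmx^~ (mxeval T u))); rewrite -mulmxA inv mulmx1 mul0mx.
Qed.

Lemma expmx_block m n (A : 'M[R]_m) (B : 'M[R]_n) k :
  (block_mx A 0 0 B) ^+ k = block_mx (A ^+ k) 0 0 (B ^+ k).
Proof.
have := mxeval_block A B 'X^k.
suff h l (M : 'M[R]_l) : mxeval M 'X^k = M ^+ k by rewrite !h.
elim: k => [|k IHk]; first by rewrite !expr0 mxeval1.
by rewrite !exprSr mxevalM IHk mxevalX.
Qed.

Lemma primary_block N1 N2 (T1 : 'M[R]_N1) (T2 : 'M[R]_N2) (f : {poly R}) v :
  primary_space (block_mx T1 0 0 T2) f v <->
  primary_space T1 f (lsubmx v) /\ primary_space T2 f (rsubmx v).
Proof.
rewrite /primary_space /= mxeval_block -[in X in X <-> _](hsubmxK v).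
have E k : row_mx (lsubmx v) (rsubmx v) *m
    (block_mx (mxeval T1 f) 0 0 (mxeval T2 f)) ^+ k =
    row_mx (lsubmx v *m mxeval T1 f ^+ k) (rsubmx v *m mxeval T2 f ^+ k).
  by rewrite expmx_block mul_row_block !mulmx0 addr0 add0r.
split=> [[k]|[[k1 h1] [k2 h2]]].
  by rewrite E -row_mx0 => /eq_row_mx[h1 h2]; split; exists k.
exists (k1 + k2)%N; rewrite E {1}exprD [(k1 + k2)%N]addnC exprD.
rewrite -[_ * _]/(_ *m _) -[mxeval T2 f ^+ k2 * _]/(_ *m _).
by rewrite !mulmxA h1 h2 !mul0mx row_mx0.
Qed.

Lemma expmx_intertwine m n (B : 'M[R]_(m, n)) T T' k :
  B *m T = T' *m B -> B *m T ^+ k = T' ^+ k *m B.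
Proof.
move=> BT; elim: k => [|k IHk]; first by rewrite !expr0 mulmx1 mul1mx.
by rewrite !exprSr -[_ * T]/(_ *m _) -[_ * T']/(_ *m _) mulmxA IHk -mulmxA BT mulmxA.
Qed.

Lemma primary_iso m n (T : 'M[R]_m) (T' : 'M[R]_n) B C (f : {poly R}) v :
  B *m C = 1%:M -> B *m T = T' *m B ->
  primary_space T' f v <-> primary_space T f (v *m B).
Proof.
move=> BC BT; have E k : v *m B *m mxeval T f ^+ k = v *m mxeval T' f ^+ k *m B.
  rewrite -mulmxA (expmx_intertwine k (T' := mxeval T' f)) ?mulmxA //.
  exact: mxeval_intertwine.
split=> -[k h]; exists k; first by rewrite E h mul0mx.
by rewrite -[LHS]mulmx1 -BC mulmxA -E h mul0mx.
Qed.

End Primary.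

(** * Indices of real isometries *)

Section Index.
Variable R : realType.
Implicit Types (F f : {poly R}) (j : {poly R} -> int).

Definition sym_irr f := [/\ f \is monic, irreducible_poly f & star_symmetric f].

Lemma Isym_sym_irr F f : Isym F f <-> sym_irr f /\ f %| F.
Proof. by split=> [[]|[[]]]. Qed.

Lemma IsymM F1 F2 f : Isym (F1 * F2) f <-> Isym F1 f \/ Isym F2 f.
Proof.
rewrite !Isym_sym_irr; split.
  move=> [sf]; have [_ irrf _] := sf.
  by rewrite irredp_dvdM // => /orP[]; [left|right].
by move=> [[sf]|[sf]] h; split=> //; [exact: dvdp_mulr|exact: dvdp_mull].
Qed.

Lemma degmM F1 F2 f : irreducible_poly f -> F1 != 0 -> F2 != 0 ->
  degm f (F1 * F2) = degm f F1 + degm f F2.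
Proof.
by move=> irrf n1 n2; rewrite /degm !mult_deg_exp multM // mulnDl PoszD.
Qed.

Lemma degm_eq0 F f : irreducible_poly f -> F != 0 -> ~~ (f %| F) -> degm f F = 0.
Proof. by move=> irrf n nf; rewrite /degm mult_deg_exp mult_eq0 // mul0n. Qed.

Lemma degmXX f : irreducible_poly f -> degm f f = (deg f)%:Z.
Proof. by move=> irrf; rewrite /degm mult_deg_exp multXX // mul1n. Qed.

(* Recording the finiteness of Isym F makes the index sums additive. *)
Definition Idxf r s F j := finite_set (Isym F) /\ Idx r s F j.

Lemma IdxM r1 s1 r2 s2 F1 F2 j1 j2 : F1 != 0 -> F2 != 0 ->
  Idxf r1 s1 F1 j1 -> Idxf r2 s2 F2 j2 ->
  Idxf (r1 + r2) (s1 + s2) (F1 * F2) (fun f => j1 f + j2 f).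
Proof.
move=> n1 n2 [fin1 [out1 bd1 par1 m1 sum1]] [fin2 [out2 bd2 par2 m2 sum2]].
have IU : Isym (F1 * F2) = (Isym F1 `|` Isym F2)%classic.
  by apply/seteqP; split=> f /IsymM.
have fin : finite_set (Isym (F1 * F2)) by rewrite IU finite_setU.
(* For a symmetric irreducible [f] that does not divide [F], both [degm f F] and the index are 0.
   The conditions of [Idx] thus hold for all [sym_irr f], and they can be added even where only one
   of the two factors involves [f]. *)
have bd (F : {poly R}) r s j f : F != 0 -> Idxf r s F j -> sym_irr f ->
    - degm f F <= j f <= degm f F /\ (j f = degm f F %[mod 2])%Z.
  move=> n [_ [out b par _ _]] sf; have [fF|nfF] := boolP (f %| F).
    have h : Isym F f by apply/Isym_sym_irr.
    by split; [exact: b | exact: par].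
  have h : ~ Isym F f by move/Isym_sym_irr => [_]; apply/negP.
  by have [_ irrf _] := sf; rewrite out // degm_eq0.
have bd4 (F : {poly R}) r s j f : F != 0 -> Idxf r s F j -> sym_irr f ->
    f <> 'X - 1 -> f <> 'X + 1 -> 
    (((degm f F + j f)%R %/ 2)%Z = 0 %[mod 2])%Z /\
    (((degm f F - j f)%R %/ 2)%Z = 0 %[mod 2])%Z.
  move=> n [_ [out b par m _]] sf f1 f2; have [fF|nfF] := boolP (f %| F).
    have h : Isym F f by apply/Isym_sym_irr.
    by apply: m; split=> // -[].
  have h : ~ Isym F f by move/Isym_sym_irr => [_]; apply/negP.
  by have [_ irrf _] := sf; rewrite out // degm_eq0.
have I1 : Idxf r1 s1 F1 j1 by [].
have I2 : Idxf r2 s2 F2 j2 by [].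
split=> //; split.
- by move=> f; rewrite IU => /not_orP[h1 h2]; rewrite out1 // out2.
- move=> f /Isym_sym_irr[sf _]; have [_ irrf _] := sf; rewrite degmM //.
  by have := bd _ _ _ _ _ n1 I1 sf; have := bd _ _ _ _ _ n2 I2 sf; lia.
- move=> f /Isym_sym_irr[sf _]; have [_ irrf _] := sf; rewrite degmM //.
  by have := bd _ _ _ _ _ n1 I1 sf; have := bd _ _ _ _ _ n2 I2 sf; lia.
- move=> f [/Isym_sym_irr[sf _] /= /not_orP[f1 f2]]; have [_ irrf _] := sf; rewrite degmM //.
  have := bd4 _ _ _ _ _ n1 I1 sf f1 f2; have := bd4 _ _ _ _ _ n2 I2 sf f1 f2.
  by have := bd _ _ _ _ _ n1 I1 sf; have := bd _ _ _ _ _ n2 I2 sf; lia.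
- rewrite (fsbig_split _ _ _ fin) /=.
  rewrite -(fsbig_widen (Isym F1) (Isym (F1 * F2))); last 2 first.
  + by rewrite IU; apply: subsetUl.
  + by move=> f [_ /out1].
  rewrite -(fsbig_widen (Isym F2) (Isym (F1 * F2))); last 2 first.
  + by rewrite IU; apply: subsetUr.
  + by move=> f [_ /out2].
  by rewrite sum1 sum2; lia.
Qed.

Lemma Idx_opp r s F j : Idxf r s F j -> Idxf s r F (fun f => - j f).
Proof.
move=> [fin [out bd par m sum]]; split=> //; split.
- by move=> f /out ->.
- by move=> f /bd; lia.
- by move=> f /par; lia.
- by move=> f /m[h1 h2]; rewrite opprK.
- transitivity (- \sum_(f \in Isym F) j f).
    by rewrite !fsbig_finite //= sumrN.
  by rewrite sum opprB.
Qed.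

Lemma esign_cases F : F.[1] != 0 -> F.[-1] != 0 -> esign F = 1 \/ esign F = -1.
Proof.
move=> h1 h2; rewrite /esign.
have : (-1) ^+ (deg F %/ 2) * F.[1] * F.[-1] != 0.
  by rewrite !mulf_neq0 // expf_neq0 // oppr_eq0 oner_eq0.
by case: sgzP => // _ _; [left|right].
Qed.

Lemma esignM F1 F2 : odd (size F1) -> odd (size F2) ->
  esign (F1 * F2) = esign F1 * esign F2.
Proof.
move=> o1 o2; have n1 : F1 != 0 by rewrite -size_poly_gt0; move: o1; lia.
have n2 : F2 != 0 by rewrite -size_poly_gt0; move: o2; lia.
rewrite /esign -sgzM !hornerM; congr sgz.
have -> : (deg (F1 * F2) %/ 2 = deg F1 %/ 2 + deg F2 %/ 2)%N.
  by rewrite /deg size_mul //; move: (size F1) (size F2) o1 o2 => a b; lia.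
by rewrite exprD; ring.
Qed.

(** The factorization is quantified instead of computed by [F12], so that it multiplies along with
    [F]. The even degree of [F0] makes the exponent deg/2 in [esign] additive. *)
Definition mod4_rel (F : {poly R}) (r s : nat) j : Prop :=
  exists (a b : nat) (F0 : {poly R}),
    [/\ F = ('X - 1) ^+ a * ('X + 1) ^+ b * F0, F0.[1] != 0 /\ F0.[-1] != 0,
        odd (size F0) &
        (j ('X - 1) + j ('X + 1) = r%:Z - s%:Z + 1 - esign F0 %[mod 4])%Z].

(** For signs e and e', the product (1 - e)(1 - e') is 0 or 4, hence 1 - e e' = (1 - e) + (1 - e')
    modulo 4. *)
Lemma mod4_relM F1 F2 r1 s1 r2 s2 j1 j2 :
  mod4_rel F1 r1 s1 j1 -> mod4_rel F2 r2 s2 j2 ->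
  mod4_rel (F1 * F2) (r1 + r2) (s1 + s2) (fun f => j1 f + j2 f).
Proof.
move=> [a1 [b1 [G1 [-> [p1 q1] o1 e1]]]] [a2 [b2 [G2 [-> [p2 q2] o2 e2]]]].
have n1 : G1 != 0 by apply: contraNneq p1 => ->; rewrite horner0.
have n2 : G2 != 0 by apply: contraNneq p2 => ->; rewrite horner0.
exists (a1 + a2)%N, (b1 + b2)%N, (G1 * G2); split.
- by rewrite !exprD; ring.
- by rewrite !hornerM !mulf_neq0.
- by rewrite size_mul //; move: (size G1) (size G2) o1 o2; lia.
- rewrite esignM //.
  by case: (esign_cases p1 q1) e1 => ->; case: (esign_cases p2 q2) e2 => ->; lia.
Qed.

Lemma mod4_rel_opp F r s j : mod4_rel F r s j -> mod4_rel F s r (fun f => - j f).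
Proof.
move=> [a [b [G [-> [p q] o e]]]]; exists a, b, G; split=> //.
by case: (esign_cases p q) e => ->; lia.
Qed.

(** Everything wanted from a real isometry, in a form stable under orthogonal sums, negation and
    base change. The last clause also covers [f] that do not divide the characteristic polynomial,
    since such an [f] may divide that of another summand. *)
Definition has_profile N (G T : 'M[R]_N) r s j : Prop :=
  [/\ tsig G r s, Idxf r s (char_poly T) j, mod4_rel (char_poly T) r s j &
    forall f, sym_irr f -> exists r' s' : nat,
      signature_on G (primary_space T f) r' s' /\ j f = r'%:Z - s'%:Z].

Lemma char_poly_neq0 N (T : 'M[R]_N) : char_poly T != 0.
Proof. by rewrite monic_neq0 // char_poly_monic. Qed.

Lemma profile_block N1 N2 (G1 T1 : 'M[R]_N1) (G2 T2 : 'M[R]_N2) r1 s1 r2 s2 j1 j2 :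
  has_profile G1 T1 r1 s1 j1 -> has_profile G2 T2 r2 s2 j2 ->
  has_profile (block_mx G1 0 0 G2) (block_mx T1 0 0 T2) (r1 + r2) (s1 + s2)
    (fun f => j1 f + j2 f).
Proof.
move=> [g1 i1 q1 h1] [g2 i2 q2 h2]; split.
- exact: tsig_block.
- by rewrite char_poly_block; apply: IdxM; rewrite ?char_poly_neq0.
- by rewrite char_poly_block; apply: mod4_relM.
move=> f sf; have [a1 [b1 [s1f e1]]] := h1 f sf; have [a2 [b2 [s2f e2]]] := h2 f sf.
exists (a1 + a2)%N, (b1 + b2)%N; split; last by rewrite e1 e2; lia.
have [E [fE EW EG]] := signature_on_block s1f s2f.
by exists E; split=> // v; rewrite primary_block -EW.
Qed.

Lemma profile_opp N (G T : 'M[R]_N) r s j :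
  has_profile G T r s j -> has_profile (- G) T s r (fun f => - j f).
Proof.
move=> [g i q h]; split.
- exact: tsig_opp.
- exact: Idx_opp.
- exact: mod4_rel_opp.
move=> f /h[a [b [sf e]]]; exists b, a; split; first exact: signature_on_opp.
by rewrite e opprB.
Qed.

Lemma profile_iso N N' (G T : 'M[R]_N) (G' T' : 'M[R]_N') B C r s j :
  B *m C = 1%:M -> C *m B = 1%:M -> B *m G *m B^T = G' -> B *m T = T' *m B ->
  has_profile G T r s j -> has_profile G' T' r s j.
Proof.
move=> BC CB BG BT [g i q h]; have ec := char_poly_iso BC CB BT.
split; rewrite ?ec //; first exact: tsig_iso BC CB BG g.
move=> f /h[a [b [sf e]]]; exists a, b; split=> //.
by apply: (signature_on_iso BC CB BG) sf => v; apply: primary_iso BC BT.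
Qed.

(** The whole space is primary here. With deg f0 = r + s, the halves (deg + j)/2 and (deg - j)/2
    tested in [Idx] are [r] and [s] themselves, whence the evenness assumption. *)
Lemma profile_sym_irr N (G T : 'M[R]_N) r s f0 :
  sym_irr f0 -> char_poly T = f0 -> tsig G r s ->
  (f0 <> 'X - 1 -> f0 <> 'X + 1 -> ~~ odd r /\ ~~ odd s) ->
  mod4_rel f0 r s (fun f => if f == f0 then r%:Z - s%:Z else 0) ->
  has_profile G T r s (fun f => if f == f0 then r%:Z - s%:Z else 0).
Proof.
move=> sf0 cT g ev q; have [mf0 irrf0 _] := sf0.
have If0 : Isym f0 = [set f0]%classic.
  apply/seteqP; split=> f /=.
    by move=> /Isym_sym_irr[[mf irrf _]]; apply: irredp_monic_eq.
  by move=> ->; apply/Isym_sym_irr.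
have dN : (deg f0 = r + s)%N.
  by rewrite -(g.1) /deg -cT size_char_poly.
split; rewrite ?cT //; first split.
- by rewrite If0; exact: finite_set1.
- rewrite /Idx /Isym1 If0; split.
  + by move=> f /eqP /negPf ->.
  + by move=> f ->; rewrite eqxx degmXX // dN; lia.
  + by move=> f ->; rewrite eqxx degmXX // dN; lia.
  + move=> f [-> /= /not_orP[h1 h2]]; rewrite eqxx degmXX // dN.
    by have [] := ev h1 h2; move: r s {g q ev dN} => r s; lia.
  + by rewrite fsbig_set1 eqxx.
move=> f sf; case: eqP => [->|/eqP ne].
  exists r, s; split=> //; have [E [fE EW EG]] := tsig_signature g.
  by exists E; split=> // v; split=> // _; [exact/EW | apply: primary_full; rewrite -cT mxeval_char].
exists 0%N, 0%N; split=> //; apply: signature_on_set0 => v.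
apply: (primary_zero (p := f0)); first by rewrite -cT mxeval_char.
by have [mf irrf _] := sf; apply: irredp_monic_coprime.
Qed.

Lemma profile_no_sym_irr N (G T : 'M[R]_N) r :
  (forall f, ~ Isym (char_poly T) f) -> tsig G r r ->
  mod4_rel (char_poly T) r r (fun=> 0) ->
  has_profile G T r r (fun=> 0).
Proof.
move=> noI g q; have I0 : Isym (char_poly T) = set0.
  by apply/seteqP; split=> f // /noI.
split=> //; first split.
- by rewrite I0; exact: finite_set0.
- rewrite /Idx /Isym1 I0; split=> //; first by move=> f [].
  by rewrite fsbig_set0; lia.
move=> f sf; exists 0%N, 0%N; split=> //; apply: signature_on_set0 => v.
apply: (primary_zero (p := char_poly T)); first exact: mxeval_char.
have [mf irrf _] := sf; apply: irredp_coprime => //.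
by apply/negP => fT; apply: (noI f); apply/Isym_sym_irr.
Qed.

End Index.

(** The orthogonal complement of the rows of [A], written in a basis [H]; it is a complement because
    the Gram matrix of [A] is invertible. *)
Lemma stable_split (K : fieldType) N m (G T : 'M[K]_N) (A : 'M_(m, N)) (T1 : 'M_m) :
  G^T = G -> T *m G *m T^T = G -> A *m T = T1 *m A -> A *m G *m A^T \in unitmx ->
  exists N' (G' T' : 'M[K]_N') (B : 'M_(m + N', N)) (C : 'M_(N, m + N')),
    [/\ B *m C = 1%:M, C *m B = 1%:M,
        B *m G *m B^T = block_mx (A *m G *m A^T) 0 0 G' &
        B *m T = block_mx T1 0 0 T' *m B].
Proof.
move=> symG isoT AT uG1; have [G1 G1E] : exists G1, G1 = A *m G *m A^T by eexists.
rewrite -G1E in uG1 *.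
pose Kx := kermx (G *m A^T); pose H := row_base Kx.
have HA : H *m G *m A^T = 0.
  apply/sub_kermxP; rewrite -mulmxA; apply/sub_kermxP.
  by rewrite mulmxA -mulmxA; apply/sub_kermxP; rewrite eq_row_base.
have AH : A *m G *m H^T = 0.
  have -> : A *m G *m H^T = (H *m G *m A^T)^T by rewrite !trmx_mul trmxK symG mulmxA.
  by rewrite HA trmx0.
(* [Pr] is the orthogonal projection onto the complement; factoring it through [H] yields the second
   half [D] of the inverse of [B]. *)
pose Pr := 1%:M - G *m A^T *m invmx G1 *m A.
have PrK : (Pr <= H)%MS.
  rewrite eq_row_base; apply/sub_kermxP.
  rewrite mulmxBl mul1mx -!mulmxA (mulmxA A) -G1E mulVmx //.
  by rewrite mulmx1 subrr.
have [D PrE] := submxP PrK.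
have fH : row_free H by exact: row_base_free.
have AD : A *m D = 0.
  apply: (row_free_inj fH); rewrite -mulmxA -PrE mul0mx mulmxBr mulmx1 !mulmxA -G1E.
  by rewrite mulmxV // mul1mx subrr.
have HD : H *m D = 1%:M.
  apply: (row_free_inj fH); rewrite -mulmxA -PrE mul1mx mulmxBr mulmx1 !mulmxA HA.
  by rewrite !mul0mx subr0.
pose B := col_mx A H; pose C := row_mx (G *m A^T *m invmx G1) D.
have BC : B *m C = 1%:M.
  rewrite mul_col_row AD HD !mulmxA -G1E HA mulmxV // mul0mx.
  by rewrite -scalar_mx_block.
have CB : C *m B = 1%:M by rewrite mul_row_col -PrE addrC subrK.
have G1iso : T1 *m G1 *m T1^T = G1.
  by rewrite G1E !mulmxA -AT -[_ *m A^T *m _]mulmxA -trmx_mul -AT trmx_mul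
     -!mulmxA (mulmxA T) (mulmxA (T *m G)) isoT.
have uT1 : T1 \in unitmx.
  have : T1 *m (G1 *m T1^T *m invmx G1) = 1%:M by rewrite !mulmxA G1iso mulmxV.
  by case/mulmx1_unit.
have HT : (H *m T <= H)%MS.
  suff h : (H *m T <= Kx)%MS by apply: (submx_trans h); rewrite eq_row_base.
  apply/sub_kermxP.
  (* As [T1] is invertible, the rows of [A] are combinations of those of [A *m T]; since [T]
     preserves the form, [H *m T] is orthogonal to them whenever [H] is. *)
  have eA : A = invmx T1 *m A *m T by rewrite -mulmxA AT mulmxA mulVmx // mul1mx.
  rewrite [in A^T]eA !trmx_mul -!mulmxA (mulmxA T) (mulmxA (T *m G)) isoT.
  by rewrite !mulmxA HA mul0mx.
have [T' HT'] := submxP HT.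
exists _, (H *m G *m H^T), T', B, C; split=> //.
  by rewrite mul_col_mx tr_col_mx mul_col_row AH HA G1E.
by rewrite [LHS]mul_col_mx AT HT' mul_block_col !mul0mx addr0 add0r.
Qed.

(** * Invariant vectors and adjoints for a real isometry *)

Section Existence.
Variable R : realType.

Lemma mxeval_lin N (T : 'M[R]_N) (a : R) : mxeval T ('X - a%:P) = T - a%:M.
Proof. by rewrite mxevalD mxevalX -polyCN mxevalC raddfN. Qed.

Definition quad (a b : R) : {poly R} := 'X^2 - a%:P * 'X + b%:P.

Lemma mxeval_quad N (T : 'M[R]_N) (a b : R) :
  mxeval T (quad a b) = T *m T - a *: T + b%:M.
Proof.
rewrite /quad !mxevalD mxevalC -mulNr -polyCN; congr (_ + _ + _).
  by rewrite expr2 mxevalM mxevalX.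
by rewrite mxevalM mxevalC mxevalX mul_scalar_mx scaleNr.
Qed.

(** The real and imaginary parts of an eigenvector for p + qi span an invariant space, killed by X^2
    - 2pX + p^2 + q^2; its discriminant is -4q^2. *)
Lemma eigen_or_quad N (T : 'M[R]_N) : (0 < N)%N ->
  (exists (a : R) (x : 'rV_N), x != 0 /\ x *m mxeval T ('X - a%:P) = 0) \/
  (exists (a b : R) (x : 'rV_N),
     [/\ a ^+ 2 < 4 * b, x != 0 & x *m mxeval T (quad a b) = 0]).
Proof.
move=> N0; pose TC := map_mx (real_complex R) T.
have [z rz] : exists z, root (char_poly TC) z.
  by apply/closed_rootP; rewrite size_char_poly; lia.
move: rz; rewrite -eigenvalue_root_char => /eigenvalueP[v vT v0].
pose u := \row_j complex.Re (v 0 j); pose w := \row_j complex.Im (v 0 j).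
have entry j : \sum_k v 0 k * (T k j)%:C%C = z * v 0 j.
  have /rowP/(_ j) := vT; rewrite !mxE => <-; apply: eq_bigr => k _.
  by rewrite mxE.
have uT : u *m T = complex.Re z *: u - complex.Im z *: w.
  apply/rowP => j; rewrite !mxE; have := congr1 (@complex.Re R) (entry j).
  case: z (v 0 j) {vT entry} => [zr zi] [vr vi] /= <-.
  rewrite raddf_sum; apply: eq_bigr => k _; rewrite !mxE.
  by case: (v 0 k) => vkr vki /=; rewrite mulr0 subr0.
have wT : w *m T = complex.Re z *: w + complex.Im z *: u.
  apply/rowP => j; rewrite !mxE; have := congr1 (@complex.Im R) (entry j).
  case: z (v 0 j) {vT entry uT} => [zr zi] [vr vi] /= <-.
  rewrite raddf_sum; apply: eq_bigr => k _; rewrite !mxE.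
  by case: (v 0 k) => vkr vki /=; rewrite mulr0 add0r.
have uw0 : (u != 0) || (w != 0).
  rewrite -negb_and; apply: contra v0 => /andP[/eqP u0 /eqP w0].
  apply/eqP/rowP => j; have /rowP/(_ j) := u0; have /rowP/(_ j) := w0.
  by rewrite !mxE; case: (v 0 j) => ? ? /= -> ->.
move: (complex.Re z) (complex.Im z) uT wT {vT entry} => p q uT wT.
have [q0|q0] := eqVneq q 0.
  left; exists p; rewrite q0 !scale0r subr0 addr0 in uT wT.
  case/orP: uw0 => h; [exists u|exists w]; split=> //;
    by rewrite mxeval_lin mulmxBr ?uT ?wT mul_mx_scalar subrr.
right; exists (2 * p), (p ^+ 2 + q ^+ 2).
have ineq : (2 * p) ^+ 2 < 4 * (p ^+ 2 + q ^+ 2).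
  have : 0 < q ^+ 2 by rewrite exprn_even_gt0.
  by nra.
case/orP: uw0 => h; [exists u|exists w]; split=> //.
  rewrite mxeval_quad mulmxDr mulmxBr mulmxA uT mulmxBl -!scalemxAl -scalemxAr uT wT.
  rewrite mul_mx_scalar; apply/rowP => j; rewrite !mxE; ring.
rewrite mxeval_quad mulmxDr mulmxBr mulmxA wT mulmxDl -!scalemxAl -scalemxAr uT wT.
rewrite mul_mx_scalar; apply/rowP => j; rewrite !mxE; ring.
Qed.

Section Isometry.
Variables (N : nat) (G T : 'M[R]_N) (p : {poly R}).
Hypotheses (symG : G^T = G) (uG : G \in unitmx) (isoT : T *m G *m T^T = G).
Hypotheses (sep_p : separable_poly p) (pT : mxeval T p = 0).

Lemma isometry_unit : T \in unitmx.
Proof.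
have : T *m (G *m T^T *m invmx G) = 1%:M by rewrite !mulmxA isoT mulmxV.
by case/mulmx1_unit.
Qed.

(** [E] projects onto the kernel of f(T): separability makes [f] coprime to p/f, so that no image of
    f(T) is lost. *)
Lemma kernel_complement f : irreducible_poly f ->
  exists A E : 'M_N, 1%:M = A *m mxeval T f + E /\ E *m mxeval T f = 0.
Proof.
move=> irrf; have [/dvdpP[q e]|nfp] := boolP (f %| p).
  have /Bezout_eq1_coprimepP[[u w] /= uw] : coprimep f q.
    by apply: separable_coprime sep_p _; rewrite e mulrC.
  exists (mxeval T u), (mxeval T (w * q)); split.
    by rewrite -mxevalM -mxevalD uw mxeval1.
  by rewrite -mxevalM -mulrA -e mxevalM pT mulmx0.
have /Bezout_eq1_coprimepP[[u w] /= uw] := irredp_coprime irrf nfp.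
exists (mxeval T u), 0; split; last by rewrite mul0mx.
rewrite addr0 -mxevalM -(mxeval1 T) -uw mxevalD [mxeval T (w * p)]mxevalM pT.
by rewrite mulmx0 addr0.
Qed.

(* g plays the role of the star of f, that is, g(T) is up to a unit the
   adjoint of f(T). *)
Definition adjoint_pair f g :=
  forall x : 'rV_N, x *m mxeval T f = 0 -> x *m G *m (mxeval T g)^T = 0.

(** The adjoint of an isometry is its inverse, which is how a polynomial turns into its star
    below. *)
Lemma mulmxT_inv (x : 'rV_N) : x *m G *m T^T = x *m invmx T *m G.
Proof.
have uT := isometry_unit.
by rewrite -[in RHS]isoT !mulmxA mulmxKV.
Qed.

Lemma adjoint_lin a : a != 0 -> adjoint_pair ('X - a%:P) ('X - a^-1%:P).
Proof.
move=> a0 x; rewrite !mxeval_lin mulmxBr mul_mx_scalar => /eqP; rewrite subr_eq0 => /eqP e.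
have uT := isometry_unit.
have e' : x *m invmx T = a^-1 *: x.
  by apply: (can_inj (mulmxK uT)); rewrite mulmxKV // -scalemxAl e scalerA mulVf ?scale1r.
rewrite linearB /= tr_scalar_mx mulmxBr mulmxT_inv e' mul_mx_scalar.
by rewrite -scalemxAl subrr.
Qed.

(** [quad (a / b) b^-1] is the star of [quad a b]: its roots are the inverse roots. *)
Lemma adjoint_quad a b : b != 0 ->
  adjoint_pair (quad a b) (quad (a / b) b^-1).
Proof.
move=> b0 x; rewrite !mxeval_quad => e.
have uT := isometry_unit.
rewrite !linearD /= linearN linearZ /= tr_scalar_mx trmx_mul.
rewrite mulmxN mulmxA -scalemxAr !mulmxT_inv mul_mx_scalar.
have -> : x *m invmx T *m invmx T *m G - (a / b) *: (x *m invmx T *m G) + b^-1 *: (x *m G)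
   = b^-1 *: ((x *m (T *m T - a *: T + b%:M)) *m invmx T *m invmx T *m G).
  rewrite mulmxDr mulmxBr -scalemxAr mul_mx_scalar !mulmxA !mulmxDl !mulNmx -!scalemxAl.
  rewrite !(mulmxK uT) !scalerDr !scalerN !scalerA mulVf // scale1r [a / b]mulrC.
  by rewrite [RHS]addrC addrA [in RHS]addrAC.
by rewrite e !mul0mx scaler0.
Qed.

Lemma form_nondeg (x : 'rV_N) : x != 0 -> exists z : 'rV_N, (x *m G *m z^T) 0 0 != 0.
Proof.
move=> x0; have : x *m G != 0.
  by apply: contra_neq x0 => e; rewrite -[x](mulmxK uG) e mul0mx.
case/rV0Pn => i h; exists (delta_mx 0 i).
by rewrite trmx_delta -colE mxE.
Qed.

Lemma form_sym (x y : 'rV_N) : (x *m G *m y^T) 0 0 = (y *m G *m x^T) 0 0.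
Proof.
have -> : x *m G *m y^T = (y *m G *m x^T)^T by rewrite !trmx_mul trmxK symG mulmxA.
by rewrite [LHS]mxE.
Qed.

(** Nondegeneracy gives some [z] that pairs with [x]. The part of [z] in the image of g(T) is
    orthogonal to [x] by adjointness, so the pairing comes from the part in the kernel. *)
Lemma dual_vector f g (x : 'rV_N) : irreducible_poly g -> adjoint_pair f g ->
  x != 0 -> x *m mxeval T f = 0 ->
  exists2 y : 'rV_N, y *m mxeval T g = 0 & (x *m G *m y^T) 0 0 != 0.
Proof.
move=> irrg adj x0 xf; have [z xz] := form_nondeg x0.
have [A [E [e1 Eg]]] := kernel_complement irrg.
exists (z *m E); first by rewrite -mulmxA Eg mulmx0.
suff -> : x *m G *m (z *m E)^T = x *m G *m z^T by [].
rewrite -[z in RHS]mulmx1 e1 mulmxDr linearD /= mulmxDr mulmxA.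
by rewrite (trmx_mul (z *m A)) (mulmxA (x *m G)) adj // mul0mx add0r.
Qed.

(** Polarization: if [x] and its partner [y] are both isotropic, then [x + y] has norm 2 b(x, y). *)
Lemma anisotropic_vector f (x : 'rV_N) : irreducible_poly f -> adjoint_pair f f ->
  x != 0 -> x *m mxeval T f = 0 ->
  exists2 y : 'rV_N, y *m mxeval T f = 0 & (y *m G *m y^T) 0 0 != 0.
Proof.
move=> irrf adj x0 xf; have [y yf xy] := dual_vector irrf adj x0 xf.
have [ex|] := eqVneq ((x *m G *m x^T) 0 0) 0; last by exists x.
have [ey|] := eqVneq ((y *m G *m y^T) 0 0) 0; last by exists y.
exists (x + y); first by rewrite mulmxDl xf yf addr0.
rewrite linearD /= mulmxDr !mulmxDl !mxE.
move: ex ey xy; rewrite !mxE => -> -> xy; rewrite add0r addr0.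
have := form_sym x y; rewrite !mxE => <-.
by rewrite -mulr2n mulrn_eq0.
Qed.

(** On the kernel of f(T) the operator g(T) is invertible, so [y] lies in its image, which is
    orthogonal to [x]. *)
Lemma isotropic_kernel f g (x y : 'rV_N) : coprimep f g -> adjoint_pair f g ->
  x *m mxeval T f = 0 -> y *m mxeval T f = 0 -> x *m G *m y^T = 0.
Proof.
move=> /Bezout_eq1_coprimepP[[u w] /= uw] adj xf yf.
have -> : y = y *m mxeval T w *m mxeval T g.
  rewrite -[LHS]mulmx1 -(mxeval1 T) -uw mxevalD (mulrC u) !mxevalM mulmxDr.
  by rewrite !mulmxA yf mul0mx add0r.
by rewrite trmx_mul mulmxA adj // mul0mx.
Qed.

End Isometry.
End Existence.

(** * Star-symmetric polynomials of degree 1 and 2, and the building blocks of real isometries *)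

Lemma det_mx2 (A : comNzRingType) (M : 'M[A]_2) :
  \det M = M 0 0 * M 1 1 - M 0 1 * M 1 0.
Proof.
rewrite (expand_det_row _ ord0) !big_ord_recl big_ord0 addr0 /cofactor !det_mx11 !mxE /=.
rewrite !expr1 !expr0 /=.
have -> : lift (0 : 'I_2) 0 = 1 by apply: val_inj.
have -> : lift (1 : 'I_2) 0 = 0 by apply: val_inj.
by ring.
Qed.

(** Truncated subtraction would return the constant term for every [k] above the degree, hence the
    conditional. *)
Lemma coef_star (K : fieldType) (F : {poly K}) k :
  (star F)`_k = F.[0]^-1 * (if (k < size F)%N then F`_(deg F - k) else 0).
Proof.
rewrite /star coefZ coef_sum; congr (_ * _).
case: ltnP => [lt|ge].
  have h : (deg F - k < size F)%N by rewrite /deg; move: (size F) lt => d; lia.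
  rewrite (bigD1 (Ordinal h)) //= big1 ?addr0.
    have -> : (deg F - (deg F - k) = k)%N by rewrite /deg; move: (size F) lt => d; lia.
    by rewrite coefZ coefXn eqxx mulr1.
  move=> i; rewrite -val_eqE /= => ne; rewrite coefZ coefXn.
  case: eqP => [e|]; last by rewrite mulr0.
  by move: ne (ltn_ord i); rewrite e /deg; move: (size F) (i : nat) => d l; lia.
rewrite big1 // => i _; rewrite coefZ coefXn; case: eqP => [e|]; last by rewrite mulr0.
by move: (ltn_ord i) ge e; rewrite /deg; move: (size F) (i : nat) => d l; lia.
Qed.

Lemma star_symmetric_const (K : fieldType) (F : {poly K}) :
  star_symmetric F -> F.[0] ^+ 2 = 1.
Proof.
move=> [mF F0 sF]; have := congr1 (fun p : {poly K} => p`_0) sF.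
have s0 : (0 < size F)%N by rewrite size_poly_gt0 monic_neq0.
rewrite coef_star s0 subn0 -/(lead_coef F) (monicP mF) mulr1 -horner_coef0 => e.
by rewrite expr2 -{1}e mulVf.
Qed.

Lemma star_symmetric_lin (K : fieldType) (a : K) :
  a ^+ 2 = 1 -> star_symmetric ('X - a%:P).
Proof.
move=> a2; have a0 : a != 0 by apply: contra_eq_neq a2 => ->; rewrite expr0n /= eq_sym oner_eq0.
split; first exact: monicXsubC; first by rewrite hornerXsubC sub0r oppr_eq0.
apply/polyP => k; rewrite coef_star /deg size_XsubC hornerXsubC sub0r.
have ai : a^-1 = a by apply: (mulfI a0); rewrite mulfV // -expr2 a2.
case: k => [|[|k]]; rewrite ?subn0 ?subnn !coefB !coefX !coefC /= ?sub0r ?subr0 ?mulr1 ?mulr0 //.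
  by rewrite invrN ai.
  by rewrite mulVf ?oppr_eq0.
by rewrite oppr0.
Qed.

Section Base.
Variable R : realType.

Lemma irredp_lin (a : R) : irreducible_poly ('X - a%:P).
Proof. exact: irredp_XsubC. Qed.

Lemma size_quad (a b : R) : size (quad a b) = 3%N.
Proof.
by rewrite /quad -addrA -mulNr -polyCN size_polyDl size_polyXn // size_MXaddC; case: ifP => // _;
   rewrite size_polyC; case: (_ != 0).
Qed.

Lemma coef_quad (a b : R) :
  [/\ (quad a b)`_0 = b, (quad a b)`_1 = - a, (quad a b)`_2 = 1 &
      forall k, (quad a b)`_k.+3 = 0].
Proof.
split=> [|||k]; rewrite /quad !coefD coefN coefCM !coefXn coefX coefC /=; ring.
Qed.

Lemma horner_quad (a b x : R) : (quad a b).[x] = x ^+ 2 - a * x + b.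
Proof. by rewrite /quad !hornerE. Qed.

Lemma monic_quad (a b : R) : quad a b \is monic.
Proof. by rewrite monicE /lead_coef size_quad; have [_ _ -> _] := coef_quad a b. Qed.

Lemma quad_gt0 (a b x : R) : a ^+ 2 < 4 * b -> 0 < (quad a b).[x].
Proof.
rewrite horner_quad => h; have := sqr_ge0 (2 * x - a); nra.
Qed.

Lemma irredp_quad (a b : R) : a ^+ 2 < 4 * b -> irreducible_poly (quad a b).
Proof.
move=> h; apply: cubic_irreducible; first by rewrite size_quad.
by move=> x; rewrite /root gt_eqF // quad_gt0.
Qed.

Lemma star_symmetric_quad (a : R) : star_symmetric (quad a 1).
Proof.
have h0 : (quad a 1).[0] = 1 by rewrite horner_quad; ring.
split; rewrite ?h0 ?oner_eq0 ?monic_quad //.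
have [c0 c1 c2 c3] := coef_quad a 1.
apply/polyP => k; rewrite coef_star /deg size_quad h0 invr1 mul1r.
by case: k => [|[|[|k]]]; rewrite ?subn0 ?subnn /= ?c0 ?c1 ?c2 ?c3.
Qed.

Lemma char_poly_companion2 (a b : R) :
  char_poly (block_mx 0 1%:M (- b%:M) a%:M : 'M[R]_(1 + 1)) = quad a b.
Proof.
have e00 : (block_mx 0 1%:M (- b%:M) a%:M : 'M[R]_(1 + 1)) 0 0 = 0.
  have -> : 0 = lshift 1 (0 : 'I_1) by apply: val_inj.
  by rewrite block_mxEul mxE.
have e01 : (block_mx 0 1%:M (- b%:M) a%:M : 'M[R]_(1 + 1)) 0 1 = 1.
  have -> : 0 = lshift 1 (0 : 'I_1) by apply: val_inj.
  have -> : 1 = rshift 1 (0 : 'I_1) by apply: val_inj.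
  by rewrite block_mxEur mxE.
have e10 : (block_mx 0 1%:M (- b%:M) a%:M : 'M[R]_(1 + 1)) 1 0 = - b.
  have -> : 0 = lshift 1 (0 : 'I_1) by apply: val_inj.
  have -> : 1 = rshift 1 (0 : 'I_1) by apply: val_inj.
  by rewrite block_mxEdl !mxE eqxx mulr1n.
have e11 : (block_mx 0 1%:M (- b%:M) a%:M : 'M[R]_(1 + 1)) 1 1 = a.
  have -> : 1 = rshift 1 (0 : 'I_1) by apply: val_inj.
  by rewrite block_mxEdr mxE eqxx mulr1n.
move: (block_mx 0 1%:M (- b%:M) a%:M : 'M[R]_(1 + 1)) e00 e01 e10 e11 => M e00 e01 e10 e11.
rewrite /char_poly det_mx2 /char_poly_mx !mxE e00 e01 e10 e11 /= /quad.
rewrite mulr1n !mulr0n polyC0 polyC1 polyCN; ring.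
Qed.

Lemma tsig_scalar_pos (a : R) : 0 < a -> tsig (a%:M : 'M[R]_1) 1 0.
Proof.
move=> a0; split=> //; exists ((Num.sqrt a)^-1%:M : 'M_1).
rewrite tr_scalar_mx -!scalar_mxM /sig_mx.
have -> : (Num.sqrt a)^-1 * a * (Num.sqrt a)^-1 = 1.
  by rewrite mulrAC -invfM -expr2 sqr_sqrtr ?ltW // mulVf // gt_eqF.
apply/matrixP => i j.
case: (split_ordP i) => i' ->; last by case: i'.
case: (split_ordP j) => j' ->; last by case: j'.
by rewrite block_mxEul !mxE.
Qed.

(** The two comparisons are booleans read as 0 or 1, which treats both signs of [a] together. *)
Lemma tsig_scalar (a : R) : a != 0 -> tsig (a%:M : 'M[R]_1) (0 < a)%R (a < 0)%R.
Proof.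
move=> a0; have [lt|gt|e] := ltgtP 0 a; first exact: tsig_scalar_pos.
  by rewrite -[a]opprK raddfN /=; apply/tsig_opp/tsig_scalar_pos; rewrite oppr_gt0.
by rewrite -e eqxx in a0.
Qed.

Lemma profile_exists_lin (eta a : R) : eta ^+ 2 = 1 -> a != 0 ->
  exists r s j, has_profile (a%:M : 'M[R]_1) (eta%:M) r s j.
Proof.
move=> eta2 a0; exists (0 < a)%R, (a < 0)%R; eexists.
have eta1 : eta = 1 \/ eta = -1.
  have : (eta - 1) * (eta + 1) = 0 by rewrite -(subrr 1) -{3}eta2; ring.
  move/eqP; rewrite mulf_eq0 subr_eq0 addr_eq0 => /orP[]/eqP; by [left|right].
have X1 : 'X - 1%:P = 'X - 1 :> {poly R} by rewrite polyC1.
have XN1 : 'X - (-1)%:P = 'X + 1 :> {poly R} by rewrite polyCN polyC1 opprK.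
have ne : ('X - 1 : {poly R}) == 'X + 1 = false.
  apply/negbTE/eqP => /(congr1 (fun p : {poly R} => p.[1])).
  by rewrite !hornerE => /eqP; rewrite subrr eq_sym (pnatr_eq0 R 2).
apply: (@profile_sym_irr _ _ _ _ _ _ ('X - eta%:P)).
- by split; [exact: monicXsubC | exact: irredp_lin | exact: star_symmetric_lin].
- exact: char_poly_scalar1.
- exact: tsig_scalar.
- by case: eta1 => ->; rewrite ?X1 ?XN1.
have e1 : esign (1 : {poly R}) = 1.
  by rewrite /esign /deg size_poly1 /= div0n expr0 !hornerC !mulr1 sgz1.
case: eta1 => ->; rewrite ?X1 ?XN1.
  exists 1%N, 0%N, 1; split; rewrite ?hornerC ?oner_eq0 ?size_poly1 //.
    by rewrite expr1 expr0 !mulr1.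
  by rewrite eqxx eq_sym ne e1; case: ltgtP a0.
exists 0%N, 1%N, 1; split; rewrite ?hornerC ?oner_eq0 ?size_poly1 //.
  by rewrite expr1 expr0 mulr1 mul1r.
by rewrite eqxx ne e1; case: ltgtP a0.
Qed.

(** Invariance forces the entry a c / 2 once the norm [c] is known. The determinant c^2 (1 - a^2/4)
    is positive, so the plane is definite with the sign of [c]. *)
Lemma profile_exists_quad (a c : R) : a ^+ 2 < 4 -> c != 0 ->
  exists r s j, has_profile
    (block_mx c%:M (a * c / 2)%:M (a * c / 2)%:M c%:M : 'M[R]_(1 + 1))
    (block_mx 0 1%:M (- 1%:M) a%:M) r s j.
Proof.
move=> a4 c0; pose d := c * (1 - a ^+ 2 / 4).
have f0 : 0 < 1 - a ^+ 2 / 4 by lra.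
have d0 : d != 0 by rewrite mulf_neq0 // gt_eqF.
have dc : (0 < d) = (0 < c) by rewrite pmulr_lgt0.
have dc' : (d < 0) = (c < 0) by rewrite pmulr_llt0.
exists ((0 < c)%R + (0 < c)%R)%N, ((c < 0)%R + (c < 0)%R)%N; eexists.
apply: (@profile_sym_irr _ _ _ _ _ _ (quad a 1)).
- by split; [exact: monic_quad | apply: irredp_quad; lra | exact: star_symmetric_quad].
- exact: char_poly_companion2.
- have h : tsig (block_mx c%:M 0 0 d%:M : 'M[R]_(1 + 1)) ((0 < c)%R + (0 < c)%R) ((c < 0)%R + (c < 0)%R).
    by apply: tsig_block; rewrite -?dc -?dc'; [rewrite dc dc'|]; exact: tsig_scalar.
  have mul1 (x y z w x' y' z' w' : R) :
      (block_mx x%:M y%:M z%:M w%:M : 'M[R]_(1 + 1)) *m block_mx x'%:M y'%:M z'%:M w'%:M =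
      block_mx (x * x' + y * z')%:M (x * y' + y * w')%:M (z * x' + w * z')%:M (z * y' + w * w')%:M.
    by rewrite mulmx_block -!scalar_mxM -!raddfD.
  have id1 : (1%:M : 'M[R]_(1 + 1)) = block_mx 1%:M 0%:M 0%:M 1%:M.
    by rewrite scalar_mx_block !raddf0.
  apply: (@tsig_iso _ _ _ _ _ (block_mx 1%:M 0%:M (a / 2)%:M 1%:M)
     (block_mx 1%:M 0%:M (- (a / 2))%:M 1%:M) _ _ _ _ _ h).
  + by rewrite mul1 id1; congr block_mx; congr _%:M; ring.
  + by rewrite mul1 id1; congr block_mx; congr _%:M; ring.
  + rewrite -(raddf0 (scalar_mx)) tr_block_mx !tr_scalar_mx !mul1 /d.
    by congr block_mx; congr _%:M; field.
- by move=> _ _; rewrite !addnn !odd_double.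
exists 0%N, 0%N, (quad a 1).
have p1 : 0 < (quad a 1).[1] by apply: quad_gt0; lra.
have p2 : 0 < (quad a 1).[-1] by apply: quad_gt0; lra.
split; rewrite ?size_quad //; first by rewrite !expr0 !mul1r.
  by rewrite !gt_eqF.
(* The values at 1 and -1 are positive and the degree is 2, so the sign is -1; this compensates r -
   s = 2 or -2. *)
have -> : esign (quad a 1) = -1.
  rewrite /esign /deg size_quad /= divnn /= expr1 mulN1r mulNr sgzN.
  by rewrite gtr0_sgz // mulr_gt0.
have nq (e : R) : ('X - e%:P == quad a 1) = false.
  by apply/negP => /eqP/(congr1 (fun p : {poly R} => size p)); rewrite size_XsubC size_quad.
have := nq 1; have := nq (-1); rewrite polyCN polyC1 opprK => -> ->.
by case: ltgtP c0.
Qed.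

(** A monic star-symmetric irreducible factor would be [f] or [g], but its constant term is 1 or
    -1. *)
Lemma no_Isym_pair (f g h : {poly R}) :
  irreducible_poly f -> irreducible_poly g -> f \is monic -> g \is monic ->
  f.[0] ^+ 2 != 1 -> g.[0] ^+ 2 != 1 -> ~ Isym (f * g) h.
Proof.
move=> irf irg mf mg f0 g0 /Isym_sym_irr[[mh irh sh]].
have h0 := star_symmetric_const sh.
rewrite irredp_dvdM // => /orP[] d.
  by rewrite -(irredp_monic_eq irh irf mh mf d) h0 eqxx in f0.
by rewrite -(irredp_monic_eq irh irg mh mg d) h0 eqxx in g0.
Qed.

Lemma mod4_rel_hyperbolic (F : {poly R}) r :
  odd (size F) -> 0 < (-1) ^+ (deg F %/ 2) * F.[1] * F.[-1] ->
  mod4_rel F r r (fun=> 0).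
Proof.
move=> o p; exists 0%N, 0%N, F; split=> //; first by rewrite !expr0 !mul1r.
  by move: p; rewrite lt0r !mulf_eq0 !negb_or -!andbA => /and4P[].
by rewrite /esign gtr0_sgz //; lia.
Qed.

Lemma profile_exists_hyp_lin (a c : R) : a != 0 -> a ^+ 2 != 1 -> c != 0 ->
  exists r s j, has_profile (block_mx 0 c%:M c%:M 0 : 'M[R]_(1 + 1))
    (block_mx a%:M 0 0 a^-1%:M) r s j.
Proof.
move=> a0 a1 c0; exists 1%N, 1%N, (fun=> 0).
have cT : char_poly (block_mx a%:M 0 0 a^-1%:M : 'M[R]_(1 + 1)) =
    ('X - a%:P) * ('X - a^-1%:P) by rewrite char_poly_block !char_poly_scalar1.
apply: profile_no_sym_irr.
- move=> f; rewrite cT; apply: no_Isym_pair; rewrite ?monicXsubC ?hornerXsubC ?sub0r ?sqrrN //.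
  + exact: irredp_lin.
  + exact: irredp_lin.
  + by rewrite exprVn invr_eq1.
- by rewrite -{2}(tr_scalar_mx 1 c); apply: tsig_hyperbolic; rewrite unitmxE det_scalar unitfE expf_neq0.
rewrite cT; apply: mod4_rel_hyperbolic.
  by rewrite size_mul ?polyXsubC_eq0 // !size_XsubC.
rewrite /deg size_mul ?polyXsubC_eq0 // !size_XsubC /= divnn /= expr1 !hornerM !hornerXsubC.
have -> : -1 * ((1 - a) * (1 - a^-1)) * ((-1 - a) * (-1 - a^-1)) = ((a ^+ 2 - 1) / a) ^+ 2.
  by field.
by rewrite exprn_even_gt0 //= mulf_neq0 ?invr_eq0 // subr_eq0.
Qed.

Lemma profile_exists_hyp_quad (a b : R) (M : 'M[R]_(1 + 1)) :
  a ^+ 2 < 4 * b -> b != 1 -> M \in unitmx ->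
  exists r s j, has_profile (block_mx 0 M M^T 0)
    (block_mx (block_mx 0 1%:M (- b%:M) a%:M) 0 0
              (block_mx 0 1%:M (- b^-1%:M) (a / b)%:M)) r s j.
Proof.
move=> h b1 uM; exists 2%N, 2%N, (fun=> 0).
have b0 : 0 < b by have := sqr_ge0 a; lra.
have h' : (a / b) ^+ 2 < 4 * b^-1.
  rewrite expr_div_n ltr_pdivrMr ?exprn_gt0 // expr2 mulrA -(mulrA 4) mulVf ?gt_eqF //; lra.
have cT : char_poly (block_mx (block_mx 0 1%:M (- b%:M) a%:M) 0 0
              (block_mx 0 1%:M (- b^-1%:M) (a / b)%:M) : 'M[R]_((1 + 1) + (1 + 1))) =
    quad a b * quad (a / b) b^-1 by rewrite char_poly_block !char_poly_companion2.
have b2 : b ^+ 2 != 1.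
  by rewrite sqrf_eq1 negb_or b1 /= gt_eqF //; lra.
have q0 (x y : R) : quad x y != 0 by apply: monic_neq0; apply: monic_quad.
apply: profile_no_sym_irr.
- move=> f; rewrite cT; apply: no_Isym_pair; rewrite ?monic_quad ?horner_quad //.
  + exact: irredp_quad.
  + exact: irredp_quad.
  + by rewrite expr0n /= mulr0 subr0 add0r.
  + by rewrite expr0n /= mulr0 subr0 add0r exprVn invr_eq1.
- exact: tsig_hyperbolic.
rewrite cT; apply: mod4_rel_hyperbolic; first by rewrite size_mul // !size_quad.
rewrite /deg size_mul // !size_quad /= expr2 mulrNN mulr1 mul1r !hornerM.
by rewrite !mulr_gt0 // quad_gt0.
Qed.

End Base.

(** * Every real isometry killed by a separable polynomial has a profile *)

Section ProfileExists.
Variable R : realType.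

Definition profile_ex N (G T : 'M[R]_N) := exists r s j, has_profile G T r s j.

(** Induction step: once an invariant subspace has a profile, its Gram matrix is invertible and the
    complement is left to the hypothesis [IH]. *)
Lemma profile_split N m (G T : 'M[R]_N) (A : 'M_(m, N)) (T1 : 'M_m) (p : {poly R}) :
  (forall N' (G' T' : 'M[R]_N'), (N' < N)%N -> G'^T = G' -> G' \in unitmx ->
     T' *m G' *m T'^T = G' -> mxeval T' p = 0 -> profile_ex G' T') ->
  G^T = G -> G \in unitmx -> T *m G *m T^T = G -> mxeval T p = 0 ->
  (0 < m)%N -> A *m T = T1 *m A -> profile_ex (A *m G *m A^T) T1 -> profile_ex G T.
Proof.
move=> IH symG uG isoT pT m0 AT [r1 [s1 [j1 P1]]].
have uG1 : A *m G *m A^T \in unitmx by case: P1 => /tsig_unit.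
have [N' [G' [T' [B [C [BC CB BG BT]]]]]] := stable_split symG isoT AT uG1.
move: (A *m G *m A^T) P1 uG1 BG => G1 P1 uG1 BG.
have eBT : block_mx T1 0 0 T' = B *m T *m C by rewrite BT -mulmxA BC mulmx1.
have symG' : G'^T = G'.
  have : (B *m G *m B^T)^T = B *m G *m B^T by rewrite !trmx_mul trmxK symG mulmxA.
  by rewrite BG tr_block_mx => /eq_block_mx[].
have isoT' : T' *m G' *m T'^T = G'.
  have : B *m G *m B^T = block_mx T1 0 0 T' *m (B *m G *m B^T) *m (block_mx T1 0 0 T')^T.
    transitivity (B *m T *m G *m (B *m T)^T); last by rewrite BT trmx_mul !mulmxA.
    by rewrite trmx_mul -!mulmxA (mulmxA T) (mulmxA (T *m G)) isoT.
  rewrite BG tr_block_mx !trmx0 !mulmx_block !(mulmx0, mul0mx, addr0, add0r).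
  by case/eq_block_mx => _ _ _ <-.
have uG' : G' \in unitmx.
  have : block_mx G1 0 0 G' *m (C^T *m invmx G *m C) = 1%:M.
    by rewrite -BG !mulmxA -[_ *m B^T *m C^T]mulmxA -trmx_mul CB trmx1 mulmx1 mulmxK.
  by case/mulmx1_unit; rewrite !unitmxE det_ublock unitrM => /andP[].
have pT' : mxeval T' p = 0.
  have : mxeval (block_mx T1 0 0 T') p = 0.
    by rewrite -[LHS]mulmx1 -BC mulmxA -(mxeval_intertwine p BT) pT mulmx0 mul0mx.
  by rewrite mxeval_block => /(congr1 drsubmx); rewrite block_mxKdr => ->; apply/matrixP => i k; rewrite !mxE.
have lt : (N' < N)%N by have := mulmx1_min BC; lia.
have [r2 [s2 [j2 P2]]] := IH _ G' T' lt symG' uG' isoT' pT'.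
exists (r1 + r2)%N, (s1 + s2)%N; eexists.
apply: (@profile_iso _ _ _ _ _ _ _ C B) (profile_block P1 P2) => //.
  by rewrite -BG !mulmxA CB mul1mx -mulmxA -trmx_mul CB trmx1 mulmx1.
by rewrite eBT !mulmxA CB mul1mx.
Qed.

Lemma mx11_row (N : nat) (G : 'M[R]_N) (x y : 'rV_N) :
  x *m G *m y^T = ((x *m G *m y^T) 0 0)%:M.
Proof. exact: mx11_scalar. Qed.

(** Four kinds of pieces split off: a line for an eigenvalue 1 or -1, a hyperbolic plane for a real
    pair a, 1/a, a definite plane for a complex pair on the unit circle (b = 1), and a hyperbolic
    space of dimension 4 for complex pairs off the circle. *)
Theorem profile_exists N (G T : 'M[R]_N) (p : {poly R}) :
  separable_poly p -> G^T = G -> G \in unitmx -> T *m G *m T^T = G ->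
  mxeval T p = 0 -> profile_ex G T.
Proof.
move=> sep_p; have [n] := ubnP N; elim: n => // n IHn in N G T *.
rewrite ltnS => leN symG uG isoT pT.
have IH N' (G' T' : 'M[R]_N') : (N' < N)%N -> G'^T = G' -> G' \in unitmx ->
    T' *m G' *m T'^T = G' -> mxeval T' p = 0 -> profile_ex G' T'.
  by move=> lt; apply: IHn; apply: leq_trans lt leN.
have split m A T1 := @profile_split N m G T A T1 p IH symG uG isoT pT.
have [N0|N0] := posnP N.
  subst N; exists 0%N, 0%N, (fun=> 0); have c1 : char_poly T = 1 by rewrite /char_poly det_mx00.
  apply: profile_no_sym_irr.
  - move=> f; rewrite c1 => /Isym_sym_irr[[_ irf _]].
    by rewrite dvdp1; have := irf.1; case: eqP => // ->.
  - by split=> //; exists 0; rewrite [LHS]flatmx0 [RHS]flatmx0.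
  rewrite c1; apply: mod4_rel_hyperbolic; first by rewrite size_poly1.
  by rewrite /deg size_poly1 /= div0n expr0 !hornerC !mul1r.
have uT := isometry_unit uG isoT.
have fs := form_sym symG.
have fT (x y : 'rV_N) : x *m T *m G *m (y *m T)^T = x *m G *m y^T.
  by rewrite trmx_mul !mulmxA -!(mulmxA x) isoT.
have [[a [x [x0 xf]]]|[a [b [x [ab x0 xf]]]]] := eigen_or_quad T N0.
  have a0 : a != 0.
    apply: contraNneq x0 => a0; move: xf; rewrite a0 mxeval_lin raddf0 subr0 => e.
    by rewrite -[x](mulmxK uT) e mul0mx.
  have adj := adjoint_lin uG isoT a0.
  have xE (y : 'rV_N) c : y *m mxeval T ('X - c%:P) = 0 -> y *m T = c%:M *m y.
    by rewrite mxeval_lin mulmxBr mul_mx_scalar mul_scalar_mx => /eqP; rewrite subr_eq0 => /eqP.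
  have [a1|a1] := eqVneq (a ^+ 2) 1.
    have ai : a^-1 = a by apply: (mulfI a0); rewrite mulfV // -expr2 a1.
    rewrite ai in adj.
    have [y yf yy] := anisotropic_vector symG uG sep_p pT (irredp_lin a) adj x0 xf.
    apply: (split _ y a%:M) => //; first exact: xE.
    by rewrite mx11_row; apply: profile_exists_lin.
  have [y yf xy] := dual_vector uG sep_p pT (irredp_lin a^-1) adj x0 xf.
  have ane : a != a^-1.
    by apply: contra a1 => /eqP e; rewrite expr2 {1}e mulVf.
  have adj' := adjoint_lin uG isoT (a := a^-1); rewrite invr_eq0 invrK in adj'.
  have co c : c != c^-1 -> coprimep ('X - c%:P : {poly R}) ('X - c^-1%:P).
    by move=> h; rewrite coprimep_XsubC root_XsubC eq_sym.
  have xx : x *m G *m x^T = 0 := isotropic_kernel (co _ ane) adj xf xf.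
  have yy : y *m G *m y^T = 0.
    apply: (isotropic_kernel _ (adj' a0) yf yf).
    by have := co a^-1; rewrite invrK; apply; rewrite eq_sym.
  pose c := (x *m G *m y^T) 0 0.
  have xyE : x *m G *m y^T = c%:M by exact: mx11_row.
  have yxE : y *m G *m x^T = c%:M by rewrite mx11_row fs.
  apply: (split _ (col_mx x y) (block_mx a%:M 0 0 a^-1%:M)) => //.
    by rewrite mul_col_mx mul_block_col !mul0mx addr0 add0r (xE _ _ xf) (xE _ _ yf).
  rewrite gram_col_mx xx yy xyE yxE.
  exact: profile_exists_hyp_lin.
have b0 : 0 < b by have := sqr_ge0 a; lra.
have bn0 : b != 0 by rewrite gt_eqF.
have adj := adjoint_quad uG isoT (a := a) bn0.
have yE (y : 'rV_N) c d : y *m mxeval T (quad c d) = 0 -> y *m T *m T = c *: (y *m T) - d *: y.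
  rewrite mxeval_quad mulmxDr mulmxBr mulmxA -scalemxAr mul_mx_scalar => /eqP.
  by rewrite -addrA addr_eq0 => /eqP ->; rewrite opprD opprK.
have colT (y : 'rV_N) c d : y *m mxeval T (quad c d) = 0 ->
    col_mx y (y *m T) *m T = block_mx 0 1%:M (- d%:M) c%:M *m col_mx y (y *m T).
  move=> /yE e; rewrite mul_col_mx mul_block_col mul0mx mul1mx add0r e.
  by rewrite mulNmx !mul_scalar_mx addrC.
have [b1|b1] := eqVneq b 1.
  rewrite b1 in ab xf adj; rewrite divr1 invr1 in adj.
  have ab' : a ^+ 2 < 4 * 1 by [].
  have [y yf yy] := anisotropic_vector symG uG sep_p pT (irredp_quad ab') adj x0 xf.
  apply: (split _ (col_mx y (y *m T)) (block_mx 0 1%:M (- 1%:M) a%:M)) => //.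
    exact: colT.
  pose c := (y *m G *m y^T) 0 0.
  have e00 : y *m G *m y^T = c%:M by exact: mx11_row.
  have e11 : y *m T *m G *m (y *m T)^T = c%:M by rewrite fT.
  (* From T^2 = a T - 1 on [y] and invariance, e = b(y, yT) = b(yT, yT^2) satisfies e = a c - e. *)
  have e01 : (y *m G *m (y *m T)^T) 0 0 = a * c / 2.
    have : (y *m T *m G *m (y *m T *m T)^T) 0 0 = (y *m G *m (y *m T)^T) 0 0.
      by rewrite fT.
    rewrite (yE _ _ _ yf) scale1r linearB /= mulmxBr linearZ /= -scalemxAr e11.
    rewrite [LHS]mxE [in X in X + _]mxE [in X in _ + X]mxE fs mxE eqxx mulr1n => h.
    by lra.
  rewrite gram_col_mx e00 e11 (mx11_row G y) (mx11_row G (y *m T)) (fs (y *m T)) e01.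
  by apply: profile_exists_quad => //; lra.
have [y yf xy] : exists2 y : 'rV_N, y *m mxeval T (quad (a / b) b^-1) = 0 & (x *m G *m y^T) 0 0 != 0.
  apply: (dual_vector uG sep_p pT _ adj x0 xf); apply: irredp_quad.
  rewrite expr_div_n ltr_pdivrMr ?exprn_gt0 // expr2 mulrA -(mulrA 4) mulVf //; lra.
have adj' := adjoint_quad uG isoT (a := a / b) (b := b^-1).
rewrite invr_eq0 invrK mulfVK // in adj'.
have ab' : (a / b) ^+ 2 < 4 * b^-1.
  rewrite expr_div_n ltr_pdivrMr ?exprn_gt0 // expr2 mulrA -(mulrA 4) mulVf //; lra.
have ne : quad a b != quad (a / b) b^-1.
  apply: contra b1 => /eqP/(congr1 (fun q : {poly R} => q.[0])).
  rewrite !horner_quad expr0n /= !mulr0 subr0 !add0r => e.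
  have : b ^+ 2 = 1 by rewrite expr2 {1}e mulVf.
  by move/eqP; rewrite sqrf_eq1 => /orP[] // /eqP h; move: b0; rewrite h oppr_gt0 ltr10.
have co : coprimep (quad a b) (quad (a / b) b^-1).
  by apply: irredp_monic_coprime => //; [exact: irredp_quad|exact: irredp_quad|exact: monic_quad|exact: monic_quad].
have kerT (z : 'rV_N) (q : {poly R}) : z *m mxeval T q = 0 -> z *m T *m mxeval T q = 0.
  have cT : T *m mxeval T q = mxeval T q *m T by exact: mxeval_intertwine.
  by move=> e; rewrite -mulmxA cT mulmxA e mul0mx.
have isox (z w : 'rV_N) : z *m mxeval T (quad a b) = 0 -> w *m mxeval T (quad a b) = 0 ->
    z *m G *m w^T = 0 by apply: isotropic_kernel co adj.
have isoy (z w : 'rV_N) : z *m mxeval T (quad (a / b) b^-1) = 0 -> w *m mxeval T (quad (a / b) b^-1) = 0 ->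
    z *m G *m w^T = 0.
  by apply: isotropic_kernel (adj' bn0); rewrite coprimep_sym.
pose A1 := col_mx x (x *m T); pose A2 := col_mx y (y *m T).
pose M := A1 *m G *m A2^T.
pose c := (x *m G *m y^T) 0 0; pose d := (x *m T *m G *m y^T) 0 0.
have m00 : x *m G *m y^T = c%:M by exact: mx11_row.
have m10 : x *m T *m G *m y^T = d%:M by exact: mx11_row.
have m11 : x *m T *m G *m (y *m T)^T = c%:M by rewrite fT.
(* The quadratic relation, solved for [x], shifts the pairing with [y *m T] back to the known values
   [c] and [d]. *)
have m01 : x *m G *m (y *m T)^T = ((a * c - d) / b)%:M.
  have e : x = b^-1 *: (a *: (x *m T) - x *m T *m T).
    by rewrite (yE _ _ _ xf) opprB addrC subrK scalerA mulVf ?scale1r.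
  rewrite {1}e -!scalemxAl !mulmxBl -!scalemxAl !fT m00 m10.
  by rewrite -!mul_scalar_mx -!scalar_mxM -raddfB -scalar_mxM mulrC.
have ME : M = block_mx c%:M ((a * c - d) / b)%:M d%:M c%:M.
  by rewrite /M /A1 /A2 mul_col_mx tr_col_mx mul_col_row m00 m01 m10 m11.
have uM : M \in unitmx.
  have mul1 (p1 p2 p3 p4 q1 q2 q3 q4 : R) :
      (block_mx p1%:M p2%:M p3%:M p4%:M : 'M[R]_(1 + 1)) *m block_mx q1%:M q2%:M q3%:M q4%:M =
      block_mx (p1 * q1 + p2 * q3)%:M (p1 * q2 + p2 * q4)%:M
               (p3 * q1 + p4 * q3)%:M (p3 * q2 + p4 * q4)%:M.
    by rewrite mulmx_block -!scalar_mxM -!raddfD.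
  pose D := c ^+ 2 - (a * c - d) / b * d.
  have MD : M *m block_mx c%:M (- ((a * c - d) / b))%:M (- d)%:M c%:M = D%:M.
    rewrite ME mul1 scalar_mx_block -(raddf0 scalar_mx).
    by congr block_mx; congr _%:M; rewrite /D; ring.
  (* Up to the factor [b], D is d^2 - a c d + b c^2, a form of negative discriminant by [ab]; it is
     positive because c <> 0. *)
  have D0 : D != 0.
    have c2 : 0 < c ^+ 2 by rewrite exprn_even_gt0.
    have alg (c' d' : R) : c' ^+ 2 - (a * c' - d') / b * d' =
        ((d' - a * c' / 2) ^+ 2 + (4 * b - a ^+ 2) / 4 * c' ^+ 2) / b by field.
    have -> : D = ((d - a * c / 2) ^+ 2 + (4 * b - a ^+ 2) / 4 * c ^+ 2) / b := alg c d.
    rewrite gt_eqF // divr_gt0 // ltr_wpDl ?sqr_ge0 // mulr_gt0 //; lra.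
  have : M *m (D^-1 *: block_mx c%:M (- ((a * c - d) / b))%:M (- d)%:M c%:M) = 1%:M.
    by rewrite -scalemxAr MD scale_scalar_mx mulVf.
  by case/mulmx1_unit.
have symM : A2 *m G *m A1^T = M^T by rewrite /M !trmx_mul trmxK symG mulmxA.
have z1 : A1 *m G *m A1^T = 0.
  by rewrite /A1 gram_col_mx !isox ?kerT // block_mx0.
have z2 : A2 *m G *m A2^T = 0.
  by rewrite /A2 gram_col_mx !isoy ?kerT // block_mx0.
apply: (split _ (col_mx A1 A2) (block_mx (block_mx 0 1%:M (- b%:M) a%:M) 0 0
   (block_mx 0 1%:M (- b^-1%:M) (a / b)%:M))) => //.
  by rewrite mul_col_mx [RHS]mul_block_col !mul0mx addr0 add0r /A1 /A2 (colT _ _ _ xf) (colT _ _ _ yf).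
rewrite gram_col_mx z1 z2 symM -/M; exact: profile_exists_hyp_quad.
Qed.

End ProfileExists.

(** * Even unimodular lattices with isometry *)

(** The least common multiple p * (q / gcd). It supplies a separable annihilator for an orthogonal
    sum even when the summands share factors. *)
Lemma separable_common_multiple (K : fieldType) (p q : {poly K}) :
  separable_poly p -> separable_poly q ->
  exists r, [/\ separable_poly r, p %| r & q %| r].
Proof.
move=> sp sq; pose g := gcdp p q; pose q' := q %/ g.
have qE : q' * g = q by rewrite divpK // dvdp_gcdr.
have sq' : separable_poly q' by apply: dvdp_separable sq; rewrite -qE dvdp_mulr.
have co : coprimep p q'.
  have dd : gcdp p q' * gcdp p q' %| q.
    rewrite -qE dvdp_mul ?dvdp_gcdr // dvdp_gcd dvdp_gcdl /=.
    by rewrite (dvdp_trans (dvdp_gcdr _ _)) // -qE dvdp_mulr.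
  by have := separable_coprime sq dd; rewrite /coprimep gcdpp.
exists (p * q'); split; first by rewrite separable_mul sp sq' co.
  exact: dvdp_mulr.
by rewrite -qE mulrC dvdp_mul // dvdp_gcdl.
Qed.

Lemma mxeval_dvd (K : fieldType) N (T : 'M[K]_N) (p q : {poly K}) :
  p %| q -> mxeval T p = 0 -> mxeval T q = 0.
Proof. by case/dvdpP => r -> e; rewrite mxevalM e mulmx0. Qed.

Section EvenIsometry.
Variable R : realType.

(* G = M + M^T says at once that G is symmetric and even. *)
Record even_isometry N (G T : 'M[int]_N) (k : nat) (F : {poly int}) : Prop :=
  EvenIsometry {
    ei_even : exists M, G = M + M^T;
    ei_unit : G \in unitmx;
    ei_iso : T *m G *m T^T = G;
    ei_char : char_poly T = F;
    ei_sep : exists2 p : {poly rat}, separable_poly p & mxeval (map_mx intr T) p = 0;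
    ei_sig : tsig (map_mx intr G : 'M[R]_N) k k
  }.

Lemma ei_sym N (G T : 'M_N) k F : even_isometry G T k F -> G^T = G.
Proof. by case=> [[M ->]] *; rewrite linearD /= trmxK addrC. Qed.

Lemma map_intr_unit (K : numFieldType) N (G : 'M[int]_N) :
  G \in unitmx -> (map_mx intr G : 'M[K]_N) \in unitmx.
Proof. by rewrite !unitmxE det_map_mx; apply: rmorph_unit. Qed.

Lemma intr_ratr (m n : nat) (A : 'M[int]_(m, n)) :
  map_mx ratr (map_mx intr A : 'M[rat]_(m, n)) = map_mx intr A :> 'M[R]_(m, n).
Proof. by apply/matrixP => i j; rewrite !mxE ratr_int. Qed.

Lemma ei_profile N (G T : 'M_N) k F : even_isometry G T k F ->
  exists j, has_profile (map_mx intr G : 'M[R]_N) (map_mx intr T) k k j.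
Proof.
move=> h; have [_ uG iso _ [p sp pT] sig] := h.
have [|||||r [s [j P]]] := @profile_exists R N (map_mx intr G) (map_mx intr T) (map_poly ratr p).
- by rewrite separable_map.
- by rewrite map_trmx (ei_sym h).
- exact: map_intr_unit.
- by rewrite map_trmx -!map_mxM iso.
- by rewrite -intr_ratr -map_mxeval pT map_mx0.
(* Inertia identifies the signature found by [profile_exists] with the known (k, k). *)
have [sig' _ _ _] := P; have [e1 e2] := tsig_uniq sig sig'.
by exists j; move: P; rewrite -e1 -e2.
Qed.

Lemma ei_opp N (G T : 'M_N) k F : even_isometry G T k F -> even_isometry (- G) T k F.
Proof.
case=> [[M ->]] u iso c s sig; split=> //.
- by exists (- M); rewrite opprD linearN.
- by rewrite -scaleN1r unitmxZ.
- by rewrite mulmxN mulNmx iso.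
- by rewrite map_mxN; apply: tsig_opp.
Qed.

Lemma ei_block N1 N2 (G1 T1 : 'M_N1) (G2 T2 : 'M_N2) k1 k2 F1 F2 :
  even_isometry G1 T1 k1 F1 -> even_isometry G2 T2 k2 F2 ->
  even_isometry (block_mx G1 0 0 G2) (block_mx T1 0 0 T2) (k1 + k2) (F1 * F2).
Proof.
case=> [[M1 e1]] u1 i1 c1 [p1 s1 z1] g1; case=> [[M2 e2]] u2 i2 c2 [p2 s2 z2] g2.
split.
- exists (block_mx M1 0 0 M2); rewrite tr_block_mx !trmx0 add_block_mx !addr0.
  by rewrite -e1 -e2.
- by move: u1 u2; rewrite !unitmxE det_ublock => u1 u2; rewrite unitrM u1.
- rewrite tr_block_mx !trmx0 !mulmx_block !(mulmx0, mul0mx, addr0, add0r).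
  by rewrite i1 i2.
- by rewrite char_poly_block c1 c2.
- have [r [sr d1 d2]] := separable_common_multiple s1 s2; exists r => //.
  rewrite map_block_mx !map_mx0 mxeval_block.
  by rewrite (mxeval_dvd d1 z1) (mxeval_dvd d2 z2) block_mx0.
- by rewrite map_block_mx !map_mx0; apply: tsig_block.
Qed.

(** Only the class of the index at X - 1 is recorded; the class at X + 1 follows from it by
    [mod4_rel]. *)
Definition has_lattice (F : {poly int}) (k : nat) (i : int) :=
  exists N (G T : 'M[int]_N), even_isometry G T k F /\
    exists2 j, has_profile (map_mx intr G : 'M[R]_N) (map_mx intr T) k k j &
      (j ('X - 1) = i %[mod 4])%Z.

Lemma has_latticeM F1 F2 k1 k2 i1 i2 : has_lattice F1 k1 i1 -> has_lattice F2 k2 i2 ->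
  has_lattice (F1 * F2) (k1 + k2) (i1 + i2).
Proof.
move=> [N1 [G1 [T1 [h1 [j1 p1 e1]]]]] [N2 [G2 [T2 [h2 [j2 p2 e2]]]]].
exists (N1 + N2)%N, (block_mx G1 0 0 G2), (block_mx T1 0 0 T2); split; first exact: ei_block.
exists (fun f => j1 f + j2 f); last by rewrite -modzDm e1 e2 modzDm.
by rewrite !map_block_mx !map_mx0; apply: profile_block.
Qed.

(** Negating the form reverses the index, and the signature (k, k) is its own reverse. *)
Lemma has_latticeN F k i : has_lattice F k i -> has_lattice F k (- i).
Proof.
move=> [N [G [T [h [j p e]]]]]; exists N, (- G), T; split; first exact: ei_opp.
exists (fun f => - j f); first by rewrite map_mxN; apply: profile_opp.
by lia.
Qed.

Lemma ei_has_lattice N (G T : 'M_N) k F : even_isometry G T k F -> exists i, has_lattice F k i.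
Proof.
move=> h; have [j p] := ei_profile h.
by exists (j ('X - 1)), N, G, T; split=> //; exists j.
Qed.

End EvenIsometry.

(** * The Toeplitz lattice of an antipalindromic polynomial *)

Lemma linear_recurrence (A : pzRingType) (c init : nat -> A) N :
  exists b : nat -> A, (forall m, (m < N.+1)%N -> b m = init m) /\
    forall n, b (n + N.+1)%N = \sum_(l < N.+1) c l * b (n + l)%N.
Proof.
(* [st n] is the window of terms from [n] to [n + N]; its entries beyond [N] carry no meaning. *)
pose st := fix st n : nat -> A := if n is n'.+1 then
  (fun i => if (i < N)%N then st n' i.+1 else \sum_(l < N.+1) c l * st n' l) else init.
have sh i n : (i <= N)%N -> st n i = st (n + i)%N 0%N.
  elim: i n => [|i IHi] n lt; first by rewrite addn0.
  by rewrite addnS -addSn -IHi ?(ltnW lt) //= lt.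
exists (fun n => st n 0%N); split=> [m lt|n]; first by rewrite -[m]add0n -sh.
by rewrite addnS -addSn -sh //= ltnn; apply: eq_bigr => l _; rewrite sh // -ltnS.
Qed.

(** The distance |i - j|: one of the two truncated differences is 0. *)
Definition dist (i j : nat) : nat := (i - j) + (j - i).

Lemma int_self_opp (S : int) : S = - S -> S = 0.
Proof. by lia. Qed.

Section Toeplitz.
Variables (P : {poly int}) (k' : nat).
Local Notation k := k'.+1.
Hypotheses (mP : P \is monic) (sP : size P = (k + k).+1).
Hypothesis antiP : forall i, (i <= k + k)%N -> P`_(k + k - i) = - P`_i.

(** [a m] will be the form on X^i and X^j with |i - j| = m. The point is that the symmetric
    extension of [a] to negative arguments still satisfies the recurrence on every window that the
    Gram matrix uses. *)
Lemma toeplitz_sequence : exists a : nat -> int,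
  [/\ forall m, (m < k)%N -> a m = 0, a k = 1 &
      forall j, (j <= k + k)%N -> \sum_(l < (k + k).+1) P`_l * a (dist l j) = 0].
Proof.
have [b [b0 brec]] := linear_recurrence (fun l => - P`_l)
   (fun m => (m == (k + k).-1)%:R) (k + k).-1.
have kk : (k + k).-1.+1 = (k + k)%N by [].
rewrite kk in b0 brec.
have P2k : P`_(k + k) = 1 by rewrite -[RHS](monicP mP) /lead_coef sP.
have rec n : \sum_(l < (k + k).+1) P`_l * b (n + l)%N = 0.
  rewrite big_ord_recr /= P2k mul1r brec -big_split big1 //= => l _.
  by rewrite mulNr subrr.
(* [b n] is the coefficient of X^(2k-1) in X^n modulo [P]; the shift by k - 1 moves its first
   nonzero term to [k]. *)
pose a m := b (k' + m)%N; exists a.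
have a0 m : (m < k)%N -> a m = 0.
  move=> lt; rewrite /a b0; last by lia.
  by case: eqP => // e; lia.
(* For [l < j] the distance is below [k] and the recurrence is read below 2k - 1, so both sequences
   are 0 there. *)
have S j : (j < k)%N -> \sum_(l < (k + k).+1) P`_l * a (dist l j) = 0.
  move=> lt; rewrite -[RHS](rec (k' - j)%N); apply: eq_bigr => l _; congr (_ * _).
  have [le|gt] := leqP j l; first by rewrite /a /dist; congr b; lia.
  rewrite a0; last by rewrite /dist; lia.
  rewrite b0; last by lia.
  by case: eqP => // e; lia.
(* Reversing the summation turns the window at [j] into the one at 2k - j, with the minus sign of
   [antiP]. *)
have refl j : (j <= k + k)%N -> \sum_(l < (k + k).+1) P`_l * a (dist l j) =
     - \sum_(l < (k + k).+1) P`_l * a (dist l (k + k - j)).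
  move=> le; rewrite (reindex_inj rev_ord_inj) /= -sumrN; apply: eq_bigr => l _.
  have ltl := ltn_ord l.
  rewrite subSS antiP; last by rewrite -ltnS.
  by rewrite mulNr; congr (- (_ * a _)); rewrite /dist; lia.
split=> //.
  by rewrite /a b0; [rewrite (_ : k' + k = (k + k).-1)%N ?eqxx | lia].
move=> j le; have [lt|gt|e] := ltngtP j k; first exact: S.
  by rewrite refl // S ?oppr0 //; lia.
(* The middle window is its own mirror image, so the sum is its own negative; here the sign in
   [antiP] is decisive. *)
apply: int_self_opp; rewrite {1}refl //; congr (- _).
by apply: eq_bigr => l _; congr (_ * a (dist _ _)); lia.
Qed.

(** Moves the companion matrix from the dimension [(size P).-1] to [k + k]. *)
Lemma companion_exists : exists C : 'M[int]_(k + k), char_poly C = P /\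
  forall i j : 'I_(k + k), C i j = if (i == (k + k).-1 :> nat) then - P`_j else (i.+1 == j)%:R.
Proof.
have e : (k + k)%N = (size P).-1 by rewrite sP.
move: (k + k)%N e => n ->; exists (companionmx P); split; first exact: companionmxK.
by move=> i j; rewrite mxE.
Qed.

End Toeplitz.

Lemma distC i j : dist i j = dist j i.
Proof. by rewrite /dist addnC. Qed.

(** In the last clause v = P/(X - eta) is an eigenvector of multiplication by X, because (X - eta) v
    vanishes modulo [P]; its norm will decide whether it can be completed to an isotropic vector. *)
Lemma toeplitz_block (R : realType) (P : {poly int}) (k' : nat) (k := k'.+1) :
  P \is monic -> size P = (k + k).+1 ->
  (forall i, (i <= k + k)%N -> P`_(k + k - i) = - P`_i) ->
  separable_poly (map_poly intr P : {poly rat}) ->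
  exists G C : 'M[int]_(k + k), even_isometry R G C k P /\
    forall (eta : int) v, eta ^+ 2 = 1 -> P = ('X - eta%:P) * v ->
      let vv := \row_(j < k + k) v`_j in
      vv *m C = eta *: vv /\ vv *m G *m vv^T = (eta ^+ k' * v.[eta])%:M.
Proof.
move=> mP sP antiP sepP.
have [a [a0 ak rec]] := toeplitz_sequence mP sP antiP.
have [C [cC CE]] := companion_exists mP sP.
have P2k : P`_(k + k) = 1 by rewrite -[RHS](monicP mP) /lead_coef sP.
pose G := \matrix_(i < k + k, j < k + k) a (dist i j); exists G, C.
(* [C] shifts every sequence annihilated by [P]. Used for the rows and then for the columns of [G],
   this is invariance of the form. *)
have csum (g : nat -> int) : \sum_(l < (k + k).+1) P`_l * g l = 0 ->
    forall j : 'I_(k + k), \sum_m C j m * g m = g j.+1.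
  move=> g0 j; have [e|ne] := eqVneq (j : nat) (k + k).-1.
    transitivity (- \sum_(l < k + k) P`_l * g l).
      by rewrite -sumrN; apply: eq_bigr => m _; rewrite CE e eqxx mulNr.
    have -> : j.+1 = (k + k)%N by rewrite e.
    move: g0; rewrite big_ord_recr /= P2k mul1r => /eqP; rewrite addrC addr_eq0.
    by move=> /eqP ->.
  have lt : (j.+1 < k + k)%N by have := ltn_ord j; move: ne; rewrite /k; lia.
  rewrite (bigD1 (Ordinal lt)) //= CE (negbTE ne) eqxx mul1r big1 ?addr0 // => m.
  rewrite -val_eqE /= => nm; rewrite CE (negbTE ne) eq_sym (negbTE nm) mul0r //.
have CG i j : (C *m G) i j = a (dist i.+1 j).
  rewrite mxE -(csum (fun l => a (dist l j))); last by rewrite rec // ltnW.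
  by apply: eq_bigr => m _; rewrite mxE.
have iso : C *m G *m C^T = G.
  apply/matrixP => i j; rewrite mxE.
  rewrite (eq_bigr (fun m => C j m * a (dist m i.+1))).
    rewrite (csum (fun l => a (dist l i.+1))) ?rec //.
    by rewrite mxE /dist !subSS addnC.
  by move=> m _; rewrite CG !mxE distC mulrC.
pose A := \matrix_(i < k, j < k) a (dist i (k + j)).
(* Two indices in the same half differ by less than [k], where [a] vanishes: both halves are
   isotropic. *)
have GE : G = block_mx 0 A A^T 0.
  apply/matrixP => i j; rewrite mxE.
  case: (split_ordP i) => i' ->; case: (split_ordP j) => j' ->.
  - rewrite block_mxEul mxE a0 //; have := ltn_ord i'; have := ltn_ord j'.
    by rewrite /dist /=; lia.
  - by rewrite block_mxEur mxE.
  - by rewrite block_mxEdl !mxE distC.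
  - rewrite block_mxEdr mxE a0 //; have := ltn_ord i'; have := ltn_ord j'.
    by rewrite /dist /=; lia.
(* For j < i the distance k + j - i is below [k], so [A] is upper triangular, with a k = 1 on the
   diagonal. *)
have dA : \det A = 1.
  rewrite -det_tr det_trig.
    rewrite big1 // => i _; rewrite !mxE.
    by rewrite (_ : dist _ _ = k) // /dist; lia.
  by apply/is_trig_mxP => i j lt; rewrite !mxE a0 // /dist; have := ltn_ord j; lia.
have uA : A \in unitmx by rewrite unitmxE dA unitr1.
have uG : G \in unitmx.
  have : G *m block_mx 0 (invmx A^T) (invmx A) 0 = 1%:M.
    rewrite GE mulmx_block !mul0mx !mulmx0 !addr0 !add0r mulmxV // mulmxV ?unitmx_tr //.
    by rewrite -scalar_mx_block.
  by case/mulmx1_unit.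
split.
  split=> //.
  - exists (block_mx 0 A 0 0).
    by rewrite tr_block_mx !trmx0 add_block_mx !addr0 add0r GE.
  - exists (map_poly intr P) => //.
    by rewrite -map_mxeval -cC mxeval_char map_mx0.
  - rewrite GE map_block_mx !map_mx0 -map_trmx.
    by apply: tsig_hyperbolic; apply: map_intr_unit.
move=> eta v eta2 PE vv.
have mv : v \is monic by move: mP; rewrite PE monicMl // monicXsubC.
have sv : size v = (k + k)%N.
  by move: sP; rewrite PE size_monicM ?monicXsubC ?monic_neq0 // size_XsubC => -[].
have v2k : v`_(k + k).-1 = 1 by rewrite -[RHS](monicP mv) /lead_coef sv.
have vout l : (k + k <= l)%N -> v`_l = 0 by move=> le; rewrite nth_default // sv.
have Pj j : P`_j.+1 = v`_j - eta * v`_j.+1.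
  by rewrite PE mulrBl coefB coefXM coefCM.
have P0 : P`_0 = - (eta * v`_0) by rewrite PE mulrBl coefB coefXM coefCM /= sub0r.
split.
  apply/rowP => j; rewrite !mxE.
  pose last := Ordinal (ltnSn (k + k).-1).
  rewrite (bigD1 last) //= mxE v2k mul1r CE /= eqxx.
  case: j => [[|j] ltj] /=.
    rewrite big1 ?addr0 ?P0 ?opprK // => i; rewrite -val_eqE /= => ne.
    by rewrite !mxE CE (negbTE ne) /= mulr0.
  have ltj' : (j < k + k)%N by rewrite ltnW.
  rewrite (bigD1 (Ordinal ltj')) /=; last by rewrite -val_eqE /=; lia.
  rewrite !mxE CE /= big1 ?addr0.
    have -> : (j == (k + k).-1) = false by apply/negbTE; move: ltj; rewrite /k; lia.
    by rewrite eqxx mulr1 Pj; ring.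
  move=> i /andP[]; rewrite -!val_eqE /= => n1 n2.
  by rewrite !mxE CE (negbTE n1) /= eqSS (negbTE n2) mulr0.
(* [S j] is the pairing of [v] with X^j. Since [v] is an eigenvector and eta^2 = 1, it is a
   geometric sequence of ratio [eta]. *)
pose S j := \sum_(l < k + k) v`_l * a (dist l j).
have Srec j : (j.+1 <= k + k)%N -> S j.+1 = eta * S j.
  move=> le; suff -> : S j = eta * S j.+1 by rewrite mulrA -expr2 eta2 mul1r.
  apply/eqP; rewrite -subr_eq0 -(rec _ le) big_ord_recl P0.
  have -> : S j.+1 = \sum_(l < (k + k).+1) v`_l * a (dist l j.+1).
    by rewrite big_ord_recr /= vout // mul0r addr0.
  rewrite big_ord_recl mulrDr opprD.
  rewrite addrCA mulNr mulrA; apply/eqP; congr (_ + _).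
  rewrite mulr_sumr -sumrB; apply: eq_bigr => l _.
  have d1 : dist (lift ord0 l) j.+1 = dist l j by rewrite /dist lift0 !subSS.
  by rewrite d1 lift0 Pj; ring.
have SE j : (j < k + k)%N -> S j = eta ^+ j * S 0.
  elim: j => [|j IHj] lt; first by rewrite mul1r.
  by rewrite Srec ?IHj 1?ltnW // exprS mulrA.
(* At [k'] only the leading coefficient of [v] has an index at distance [k]; all others are closer,
   where [a] is 0. This fixes the scale of [S]. *)
have Sk : S k' = 1.
  rewrite /S; pose last := Ordinal (ltnSn (k + k).-1).
  rewrite (bigD1 last) //= v2k mul1r (_ : dist _ _ = k) ?ak; last by rewrite /dist /k; lia.
  rewrite big1 ?addr0 // => i; rewrite -val_eqE /= => ne.
  rewrite a0 ?mulr0 // /dist; have := ltn_ord i; move: ne; rewrite /k.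
  by move: (nat_of_ord i) => l; lia.
have S0 : S 0 = eta ^+ k'.
  have := SE k'; rewrite Sk => e; have lt : (k' < k + k)%N by rewrite /k; lia.
  rewrite -[LHS]mul1r -(expr1n _ k') -eta2 exprAC expr2 -mulrA -(e lt) mulr1 //.
apply/matrixP => i j; rewrite !ord1 !mxE /= mulr1n.
transitivity (\sum_(l < k + k) S l * v`_l).
  apply: eq_bigr => l _; rewrite !mxE; congr (_ * _).
  by apply: eq_bigr => m _; rewrite !mxE.
rewrite horner_coef sv mulr_sumr; apply: eq_bigr => l _.
by rewrite SE // S0; ring.
Qed.

(** * Reduction along an isotropic eigenvector *)

Lemma char_poly_lblock (A : comNzRingType) m n (T1 : 'M[A]_m) (T2 : 'M[A]_n) C :
  char_poly (block_mx T1 0 C T2) = char_poly T1 * char_poly T2.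
Proof.
rewrite /char_poly /char_poly_mx map_block_mx map_mx0 scalar_mx_block opp_block_mx.
by rewrite add_block_mx oppr0 addr0 add0r det_lblock.
Qed.

Lemma char_poly_ublock (A : comNzRingType) m n (T1 : 'M[A]_m) (T2 : 'M[A]_n) C :
  char_poly (block_mx T1 C 0 T2) = char_poly T1 * char_poly T2.
Proof.
rewrite /char_poly /char_poly_mx map_block_mx map_mx0 scalar_mx_block opp_block_mx.
by rewrite add_block_mx oppr0 addr0 add0r det_ublock.
Qed.

Lemma scaler_int_inj m n (g : int) (A B : 'M[int]_(m, n)) :
  g != 0 -> g *: A = g *: B -> A = B.
Proof.
move=> g0 /matrixP e; apply/matrixP => i j; have := e i j.
by rewrite !mxE => /(mulfI g0).
Qed.

(** The Smith form of a single row: a content [g] and an integral basis that starts with the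
    primitive vector. *)
Lemma primitive_row n (z : 'rV[int]_n.+1) :
  exists (Q : 'M[int]_n.+1) (g : int), Q \in unitmx /\ z = g *: row 0 Q.
Proof.
have [L _ [Q uQ [d _ zE]]] := int_Smith_normal_form z.
exists Q, (L 0 0 * d`_0); split=> //; rewrite {1}zE.
apply/rowP => j; rewrite !mxE (bigD1 ord0) //= big1 ?addr0.
  by rewrite !mxE big_ord1 !mxE eqxx mulr1n.
move=> i ni; rewrite !mxE big_ord1 !mxE.
by rewrite (_ : (_ == _) = false) ?mulr0n ?mulr0 ?mul0r //; apply/negbTE; rewrite eq_sym.
Qed.

Section Reduction.
Variable R : realType.

(** Unlike [tsig_iso] it asks for no inverse of [B]; it transports the signature of the target back
    to the source. *)
Lemma tsig_congr N N' (G : 'M[R]_N) (G' : 'M[R]_N') (B : 'M_(N', N)) r s :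
  N = N' -> B *m G *m B^T = G' -> tsig G' r s -> tsig G r s.
Proof.
move=> eN BG [e [E EG]]; split; first by rewrite eN.
exists (E *m B).
by rewrite trmx_mul -EG -BG !mulmxA.
Qed.

Lemma ei_conj N (G T B : 'M[int]_N) k F : B \in unitmx ->
  even_isometry R G T k F ->
  even_isometry R (B *m G *m B^T) (B *m T *m invmx B) k F.
Proof.
move=> uB [[M GE] u iso c [p sp pT] sig].
have BV := mulmxV uB; have VB := mulVmx uB.
have BT : B *m T = B *m T *m invmx B *m B by rewrite mulmxKV.
split.
- exists (B *m M *m B^T).
  by rewrite GE mulmxDr mulmxDl !trmx_mul trmxK mulmxA.
- by rewrite !unitmx_mul unitmx_tr uB u.
- rewrite -[X in _ = X](_ : B *m T *m G *m (B *m T)^T = _).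
    by rewrite [in RHS]BT !trmx_mul !mulmxA mulmxKV // mulmxKV.
  by rewrite trmx_mul -!mulmxA (mulmxA T) (mulmxA (T *m G)) iso.
- by rewrite (char_poly_iso BV VB BT).
- exists p => //; have BTQ : map_mx intr B *m map_mx intr T =
      map_mx intr (B *m T *m invmx B) *m map_mx intr B :> 'M[rat]_N.
    by rewrite -!map_mxM -BT.
  have BVQ : map_mx intr B *m map_mx intr (invmx B) = 1%:M :> 'M[rat]_N.
    by rewrite -map_mxM BV map_mx1.
  by rewrite -[LHS]mulmx1 -BVQ mulmxA -(mxeval_intertwine p BTQ) pT mulmx0 mul0mx.
- apply: (@tsig_iso _ _ _ _ _ (map_mx intr B) (map_mx intr (invmx B))) sig.
  + by rewrite -map_mxM BV map_mx1.
  + by rewrite -map_mxM VB map_mx1.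
  + by rewrite map_trmx -!map_mxM.
Qed.

(* The last clause carries isotropic eigenvectors for another eigenvalue over
   to the reduced lattice, so that it can be reduced again. *)
Definition reducible_at N (G T : 'M[int]_N) k F (eta : int) (z : 'rV_N) :=
  exists N' (G' T' : 'M[int]_N') k' F',
    [/\ k = k'.+1, F = ('X - eta%:P) ^+ 2 * F', even_isometry R G' T' k' F' &
      forall (eta' : int) (y : 'rV_N), eta' != eta -> y != 0 -> y *m T = eta' *: y ->
        y *m G *m z^T = 0 -> y *m G *m y^T = 0 ->
        exists y' : 'rV[int]_N', [/\ y' != 0, y' *m T' = eta' *: y' & y' *m G' *m y'^T = 0]].

Lemma reducible_scale N (G T : 'M[int]_N) k F eta (z : 'rV_N) g : g != 0 ->
  reducible_at G T k F eta z -> reducible_at G T k F eta (g *: z).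
Proof.
move=> g0 [N' [G' [T' [k' [F' [e1 e2 e3 h]]]]]].
exists N', G', T', k', F'; split=> // eta' y ne y0 yT yz yy.
apply: h ne y0 yT _ yy; apply: (scaler_int_inj g0).
by rewrite scalemxAr -linearZ /= yz scaler0.
Qed.

Lemma reducible_conj N (G T B : 'M[int]_N) k F eta (z : 'rV_N) : B \in unitmx ->
  reducible_at (B *m G *m B^T) (B *m T *m invmx B) k F eta z ->
  reducible_at G T k F eta (z *m B).
Proof.
move=> uB [N' [G' [T' [k' [F' [e1 e2 e3 h]]]]]].
exists N', G', T', k', F'; split=> // eta' y ne y0 yT yz yy.
apply: (h eta' (y *m invmx B)) => //.
- by apply: contra_neq y0 => e; rewrite -[y](mulmxKV uB) e mul0mx.
- by rewrite !mulmxA mulmxKV // yT scalemxAl.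
- by rewrite !mulmxA mulmxKV // -mulmxA -trmx_mul.
- rewrite !mulmxA mulmxKV // trmx_mul mulmxA -[_ *m B^T *m _]mulmxA -trmx_mul.
  by rewrite mulVmx // trmx1 mulmx1.
Qed.

(** In the basis e, f, J below, [e] pairs with [f] alone. Hence the orthogonal complement of [e] is
    spanned by [e] and [J], and the quotient by [e] is read off on [J]: the form is [M], the
    isometry [T']. *)
Lemma reduction_core n (G T : 'M[int]_(1 + (1 + n))) k F gam eta
    (e := row_mx 1%:M 0 : 'rV[int]_(1 + (1 + n))) :
  even_isometry R G T k F -> eta ^+ 2 = 1 -> gam != 0 ->
  e *m T = eta *: e -> e *m G = row_mx 0 (row_mx gam%:M 0) ->
  reducible_at G T k F eta e.
Proof.
move=> h eta2 gam0 eT eG; have symG := ei_sym h.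
have [[E0 GE] uG iso cT [p sp pT] sig] := h.
pose f : 'rV[int]_(1 + (1 + n)) := row_mx 0 (row_mx 1%:M 0).
pose J : 'M[int]_(n, 1 + (1 + n)) := row_mx 0 (row_mx 0 1%:M).
have ee : e *m G *m e^T = 0.
  by rewrite eG /e tr_row_mx mul_row_col trmx0 mulmx0 addr0 mul0mx.
have ef : e *m G *m f^T = gam%:M.
  by rewrite eG /f !tr_row_mx !trmx0 trmx1 !mul_row_col !mulmx0 add0r addr0 mulmx1.
have eJ : e *m G *m J^T = 0.
  by rewrite eG /J !tr_row_mx !trmx0 trmx1 !mul_row_col !mulmx0 mul0mx !addr0.
have symb m1 m2 (X : 'M_(m1, _)) (Y : 'M_(m2, _)) : X *m G *m Y^T = (Y *m G *m X^T)^T.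
  by rewrite !trmx_mul trmxK symG mulmxA.
have fe : f *m G *m e^T = gam%:M by rewrite symb ef tr_scalar_mx.
have Je : J *m G *m e^T = 0 by rewrite symb eJ trmx0.
have decomp m (X : 'M_(m, 1 + (1 + n))) : exists x y Z, X = x *m e + y *m f + Z *m J.
  exists (lsubmx X), (lsubmx (rsubmx X)), (rsubmx (rsubmx X)).
  rewrite /e /f /J !mul_mx_row !mulmx0 !mulmx1 !add_row_mx !addr0 !add0r.
  by rewrite add_row_mx addr0 add0r !hsubmxK.
(* As [eta] is its own inverse, pairing with [e] turns [T] into [eta]. This removes the [f]
   component of [J *m T] and makes that of [f *m T] equal to [eta]. *)
have adjE m (X : 'M_(m, _)) : X *m T *m G *m e^T = eta *: (X *m G *m e^T).
  have eTt : e^T = eta *: (e *m T)^T.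
    by rewrite eT linearZ /= scalerA -expr2 eta2 scale1r.
  have isoX : X *m T *m G *m T^T = X *m G by rewrite -2!(mulmxA X) iso.
  by rewrite [in LHS]eTt -scalemxAr trmx_mul !mulmxA isoX.
have [u [w [T' JT]]] := decomp _ (J *m T).
have w0 : w = 0.
  have := adjE _ J; rewrite Je scaler0 JT !mulmxDl -!mulmxA !(mulmxA _ G) ee fe Je !mulmx0 add0r addr0.
  by rewrite mul_mx_scalar => e0; apply: (scaler_int_inj gam0); rewrite e0 scaler0.
rewrite w0 mul0mx addr0 in JT.
have [a [b [t fT]]] := decomp _ (f *m T).
have bE : b = eta%:M.
  have := adjE _ f; rewrite fe fT !mulmxDl -!mulmxA !(mulmxA _ G) ee fe Je !mulmx0 add0r addr0.
  rewrite mul_mx_scalar => e0; apply: (scaler_int_inj gam0); rewrite e0.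
  by rewrite !scale_scalar_mx mulrC.
have TE : T = block_mx eta%:M 0 (col_mx a u) (block_mx eta%:M t 0 T').
  have I1 : col_mx e (col_mx f J) = 1%:M.
    have -> : col_mx f J = row_mx 0 1%:M.
      rewrite /f /J -block_mxEv block_mxEh col_mx0; congr row_mx.
      by rewrite -block_mxEv -scalar_mx_block.
    by rewrite /e -block_mxEv -scalar_mx_block.
  rewrite -[LHS]mul1mx -I1 !mul_col_mx eT fT JT bE /e /f /J.
  rewrite !mul_mx_row !mulmx0 !mulmx1 !add_row_mx !addr0 !add0r scale_row_mx scaler0 scalemx1.
  rewrite [RHS]block_mxEv; congr col_mx; rewrite add_row_mx addr0 add0r.
  by rewrite -block_mxEv block_mxEh.
pose M := J *m G *m J^T.
have e_e : e *m e^T = 1%:M.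
  by rewrite /e tr_row_mx mul_row_col trmx0 mulmx0 addr0 trmx1 mulmx1.
have f_e : f *m e^T = 0.
  by rewrite /e /f tr_row_mx mul_row_col trmx0 mulmx0 mul0mx addr0.
have J_e : J *m e^T = 0.
  by rewrite /e /J tr_row_mx mul_row_col trmx0 mulmx0 mul0mx addr0.
have e_J : e *m J^T = 0.
  have -> : e *m J^T = (J *m e^T)^T by rewrite trmx_mul trmxK.
  by rewrite J_e trmx0.
have f_J : f *m J^T = 0.
  by rewrite /f /J !tr_row_mx !mul_row_col !trmx0 !(mulmx0, mul0mx) !addr0.
have J_J : J *m J^T = 1%:M.
  by rewrite /J !tr_row_mx !mul_row_col !trmx0 trmx1 !(mulmx0, mul0mx) !add0r mulmx1.
have symM : M^T = M by rewrite /M !trmx_mul trmxK symG mulmxA.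
(* The [J] block of the inverse of [G] inverts [M]: since e G = gam f, the row f G^-1 is
   proportional to [e] and has no [J] part. *)
have uM : M \in unitmx.
  have [x [y [Z JG]]] := decomp _ (J *m G).
  have x0 : x = 0.
    by have := Je; rewrite JG !mulmxDl -!mulmxA e_e f_e J_e !mulmx0 !addr0 mulmx1.
  have ZM : Z = M.
    by rewrite /M JG !mulmxDl -!mulmxA e_J f_J J_J !mulmx0 !add0r mulmx1.
  rewrite x0 mul0mx add0r ZM in JG.
  have fX : f *m invmx G *m J^T = 0.
    apply: (scaler_int_inj gam0); rewrite scaler0 -e_J -[in RHS](mulmxK uG e) eG.
    by rewrite !scalemxAl /f !scale_row_mx !scaler0 scalemx1.
  have : M *m (J *m invmx G *m J^T) = 1%:M.
    have := congr1 (fun Y => Y *m invmx G *m J^T) JG.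
    rewrite /= mulmxK // J_J => ->; rewrite !mulmxDl -!mulmxA.
    by rewrite [in X in _ = y *m X + _]mulmxA fX mulmx0 add0r.
  by case/mulmx1_unit.
have expand m1 m2 (x : 'M_(m1, 1)) Z (y : 'M_(m2, 1)) W :
    (x *m e + Z *m J) *m G *m (y *m e + W *m J)^T = Z *m M *m W^T.
  have h1 : (x *m e + Z *m J) *m G *m e^T = 0.
    by rewrite !mulmxDl -!mulmxA !(mulmxA _ G) ee Je !mulmx0 addr0.
  have h2 : (x *m e + Z *m J) *m G *m J^T = Z *m M.
    by rewrite !mulmxDl -!mulmxA !(mulmxA _ G) eJ mulmx0 add0r.
  rewrite [(_ + _)^T]linearD /= (trmx_mul y) (trmx_mul W) mulmxDr.
  by rewrite (mulmxA _ e^T) (mulmxA _ J^T) h1 h2 mul0mx add0r.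
have isoM : T' *m M *m T'^T = M.
  by rewrite -(expand _ _ u T' u T') -JT trmx_mul !mulmxA -2!(mulmxA J) iso.
(* The annihilator passes to the quotient by [e] through [J1], then to the invariant subspace
   spanned by [J] through [K2]. *)
have pT' : mxeval (map_mx intr T') p = 0.
  have h1 : mxeval (map_mx intr (block_mx eta%:M t 0 T')) p = 0.
    pose J1 : 'M[rat]_(1 + (1 + n), 1 + n) := col_mx 0 1%:M.
    have J1T : J1 *m map_mx intr (block_mx eta%:M t 0 T') = map_mx intr T *m J1.
      rewrite TE [in RHS]map_block_mx /J1 mul_block_col !map_mx0 mul_col_mx.
      by rewrite !(mulmx0, mul0mx) add0r mul1mx mulmx1 add0r.
    have := mxeval_intertwine p J1T; rewrite pT mul0mx /J1 mul_col_mx mul0mx mul1mx.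
    by move/(congr1 dsubmx); rewrite col_mxKd => ->; apply/matrixP => i j; rewrite !mxE.
  pose K2 : 'M[rat]_(n, 1 + n) := row_mx 0 1%:M.
  have K2T : K2 *m map_mx intr (block_mx eta%:M t 0 T') = map_mx intr T' *m K2.
    rewrite map_block_mx map_mx0 /K2 mul_row_block mul_mx_row.
    by rewrite !(mulmx0, mul0mx) !add0r mul1mx mulmx1.
  have := mxeval_intertwine p K2T; rewrite h1 mulmx0 /K2 mul_mx_row mulmx0 mulmx1.
  by move/(congr1 rsubmx); rewrite row_mxKr => <-; apply/matrixP => i j; rewrite !mxE.
have charF : F = ('X - eta%:P) ^+ 2 * char_poly T'.
  by rewrite -cT TE char_poly_lblock char_poly_ublock !char_poly_scalar1 mulrA expr2.
(* Here [profile_exists] serves to diagonalize [M] over the reals; the signature is then found by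
   comparison with [G]. *)
have [r [s [j [sigM _ _ _]]]] : profile_ex (map_mx intr M : 'M[R]_n) (map_mx intr T').
  apply: (@profile_exists R n _ _ (map_poly ratr p)).
  - by rewrite separable_map.
  - by rewrite map_trmx symM.
  - exact: map_intr_unit.
  - by rewrite map_trmx -!map_mxM isoM.
  - by rewrite -intr_ratr -map_mxeval pT' map_mx0.
pose g : R := gam%:~R; have g0 : g != 0 by rewrite intr_eq0.
have sigH : tsig (block_mx 0 g%:M g%:M 0 : 'M[R]_(1 + 1)) 1 1.
  rewrite -{2}(tr_scalar_mx 1 g); apply: tsig_hyperbolic.
  by rewrite unitmxE det_scalar unitfE expf_neq0.
pose im m1 m2 (X : 'M[int]_(m1, m2)) : 'M[R]_(m1, m2) := map_mx intr X.
have imM m1 m2 m3 (X : 'M_(m1, m2)) (Y : 'M_(m2, m3)) : im _ _ (X *m Y) = im _ _ X *m im _ _ Y.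
  exact: map_mxM.
have form m1 m2 (X : 'M_(m1, _)) (Y : 'M_(m2, _)) :
    im _ _ X *m im _ _ G *m (im _ _ Y)^T = im _ _ (X *m G *m Y^T).
  by rewrite !imM; congr (_ *m _); rewrite /im map_trmx.
have rgam : im 1 1 (gam%:M) = (g%:M : 'M[R]_1).
  by apply/matrixP => i1 j1; rewrite !mxE; case: eqP; rewrite ?mulr1n ?mulr0n.
(* Over the reals a multiple of [e] makes [f] isotropic, and another one makes [J] orthogonal to it.
   This exhibits [G] as a hyperbolic plane plus [M], so the signature drops by (1, 1). *)
pose c : R := (im _ _ (f *m G *m f^T)) 0 0 / (2 * g).
have ffE : im _ _ (f *m G *m f^T) = (2 * g * c)%:M.
  by rewrite [LHS]mx11_scalar; congr _%:M; rewrite /c; field.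
pose f' := im _ _ f - c *: im _ _ e.
pose V := g^-1 *: im _ _ (J *m G *m f^T).
pose J' := im _ _ J - V *m im _ _ e.
have fE : f' *m im _ _ G *m (im _ _ e)^T = g%:M.
  rewrite /f' !mulmxBl -!scalemxAl !form ee fe rgam.
  by rewrite (_ : im _ _ 0 = 0) ?scaler0 ?subr0 // /im map_mx0.
have im0 m1 m2 : im m1 m2 0 = 0 by rewrite /im map_mx0.
have eF : im _ _ e *m im _ _ G *m f'^T = g%:M.
  rewrite /f' linearB linearZ /= mulmxBr -scalemxAr !form ee ef rgam.
  by rewrite im0 scaler0 subr0.
have eeR : im _ _ e *m im _ _ G *m (im _ _ e)^T = 0 by rewrite form ee im0.
have eJR : im _ _ e *m im _ _ G *m J'^T = 0.
  by rewrite /J' linearB /= (trmx_mul V) mulmxBr (mulmxA _ (im _ _ e)^T) eeR mul0mx form eJ im0 subr0.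
have JeR : J' *m im _ _ G *m (im _ _ e)^T = 0.
  by rewrite /J' !mulmxBl -!(mulmxA V) eeR mulmx0 form Je im0 subr0.
have ffR : f' *m im _ _ G *m f'^T = 0.
  rewrite {1}/f' !mulmxBl -!scalemxAl eF {1}/f' linearB linearZ /= mulmxBr -scalemxAr !form ffE fe rgam.
  rewrite !scale_scalar_mx -!raddfB /=; rewrite -[0](raddf0 scalar_mx); congr _%:M; ring.
have JfR : J' *m im _ _ G *m f'^T = 0.
  rewrite /J' !mulmxBl -!(mulmxA V) eF.
  rewrite /f' linearB linearZ /= mulmxBr -scalemxAr !form Je im0 scaler0 subr0.
  by rewrite mul_mx_scalar /V scalerA mulfV // scale1r subrr.
have fJR : f' *m im _ _ G *m J'^T = 0.
  have symGR : (im _ _ G)^T = im _ _ G by rewrite /im map_trmx symG.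
  have -> : f' *m im _ _ G *m J'^T = (J' *m im _ _ G *m f'^T)^T.
    by rewrite !trmx_mul trmxK symGR mulmxA.
  by rewrite JfR trmx0.
have JJR : J' *m im _ _ G *m J'^T = im _ _ M.
  rewrite {1}/J' !mulmxBl -!(mulmxA V) eJR mulmx0 subr0.
  by rewrite /J' linearB /= (trmx_mul V) mulmxBr (mulmxA _ (im _ _ e)^T) !form Je im0 mul0mx subr0.
have sigG : tsig (map_mx intr G : 'M[R]_(1 + (1 + n))) (1 + r) (1 + s).
  apply: (@tsig_congr _ _ _ (block_mx (block_mx 0 g%:M g%:M 0) 0 0 (im _ _ M))
            (col_mx (col_mx (im _ _ e) f') J')).
  - by rewrite addnA.
  - rewrite -/(im _ _ G) gram_col_mx gram_col_mx eeR eF fE ffR JJR.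
    by rewrite !mul_col_mx eJR fJR col_mx0 tr_col_mx mul_mx_row JeR JfR row_mx0.
  - exact: tsig_block.
have [kr ks] := tsig_uniq sig sigG.
exists n, M, T', r, (char_poly T'); split=> //.
  have rs : s = r by move: kr ks; lia.
  rewrite rs in sigM; split=> //.
    exists (J *m E0 *m J^T).
    by rewrite /M GE mulmxDr mulmxDl !trmx_mul trmxK mulmxA.
  by exists p.
move=> eta' y ne y0 yT ye yy.
have [al [be [ze yE]]] := decomp _ y.
have be0 : be = 0.
  have := ye; rewrite yE !mulmxDl -!mulmxA !(mulmxA _ G) ee fe Je !mulmx0 add0r addr0.
  by rewrite mul_mx_scalar => e0; apply: (scaler_int_inj gam0); rewrite e0 scaler0.
rewrite be0 mul0mx addr0 in yE.
have yT2 : eta' *: y = (eta *: al + ze *m u) *m e + ze *m T' *m J.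
  rewrite -yT yE mulmxDl -(mulmxA al) eT -(mulmxA ze) JT mulmxDr !mulmxA.
  by rewrite -scalemxAr mulmxDl -scalemxAl addrA.
exists ze; split.
(* If the class of [y] vanished, [y] would be a multiple of [e], hence an eigenvector for [eta] and
   not for [eta']. *)
- apply: contra_neq y0 => ze0; rewrite yE ze0 mul0mx addr0.
  have := congr1 (mulmx^~ e^T) yT2; rewrite /= yE ze0 !mul0mx !addr0 -!scalemxAl -mulmxA e_e mulmx1 => h0.
  have : (eta' - eta) *: al = (eta' - eta) *: 0 by rewrite scalerBl h0 scaler0 subrr.
  by move/(scaler_int_inj _) => ->; rewrite ?mul0mx // subr_eq0.
- have := congr1 (mulmx^~ J^T) yT2; rewrite /= yE mulmxDl -!mulmxA e_J J_J mulmx0 mulmx1 add0r.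
  rewrite -scalemxAl mulmxDl -!mulmxA e_J J_J mulmx0 mulmx1 add0r => <- //.
- by rewrite -(expand _ _ al ze al ze) -yE.
Qed.

End Reduction.

(** Two integral base changes reach the normal form of [reduction_core]: one makes the primitive
    vector along [z] the first basis vector, the other clears its row of the Gram matrix. In rank 0
    and 1 there is no nonzero isotropic vector. *)
Lemma isotropic_reduction (R : realType) N (G T : 'M[int]_N) k F eta (z : 'rV_N) :
  even_isometry R G T k F -> eta ^+ 2 = 1 -> z != 0 -> z *m T = eta *: z ->
  z *m G *m z^T = 0 -> reducible_at R G T k F eta z.
Proof.
case: N G T z => [|[|n]] G T z h eta2 z0 zT zz; first by rewrite [z]thinmx0 eqxx in z0.
  case/negP: z0; have /matrixP/(_ 0 0) := zz; rewrite !mxE big_ord1 !mxE big_ord1 => /eqP.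
  rewrite !mulf_eq0 orbAC orbb => /orP[/eqP e|/eqP e].
    by apply/eqP/rowP => i; rewrite ord1 e mxE.
  by have := ei_unit h; rewrite unitmxE det_mx11 e unitr0.
have [Q [g [uQ zE]]] := primitive_row z.
have g0 : g != 0 by apply: contraNneq z0 => g0; rewrite zE g0 scale0r.
pose e : 'rV[int]_(1 + (1 + n)) := row_mx 1%:M 0.
have eQ : row 0 Q = e *m Q.
  rewrite rowE; congr (_ *m _); apply/rowP => j; rewrite !mxE /=.
  case: split_ordP => j' ->; rewrite ?ord1 !mxE -val_eqE //=.
have eQT : e *m Q *m T = eta *: (e *m Q).
  by apply: (scaler_int_inj g0); rewrite scalemxAl -eQ -zE zT zE scalerA mulrC -scalerA.
have eQe : e *m Q *m G *m (e *m Q)^T = 0.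
  apply: (scaler_int_inj g0); apply: (scaler_int_inj g0).
  by have := zz; rewrite zE eQ linearZ /= -scalemxAr -!scalemxAl => ->; rewrite !scaler0.
rewrite zE eQ; apply: reducible_scale => //; apply: (reducible_conj uQ).
have h1 := ei_conj uQ h; move: h1.
have : e *m (Q *m T *m invmx Q) = eta *: e.
  by rewrite !mulmxA eQT -scalemxAl mulmxK.
have : e *m (Q *m G *m Q^T) *m e^T = 0.
  by rewrite -eQe trmx_mul !mulmxA.
move: (Q *m G *m Q^T) (Q *m T *m invmx Q) => G1 T1 ee eT h1.
have uG1 := ei_unit h1.
have [l [rho eG1]] : exists (l : 'rV[int]_1) (rho : 'rV[int]_n.+1),
    e *m G1 = (row_mx l rho : 'rV[int]_(1 + n.+1)).
  exists (lsubmx (e *m G1 : 'rV[int]_(1 + n.+1))), (rsubmx (e *m G1 : 'rV[int]_(1 + n.+1))).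
  by rewrite hsubmxK.
have l0 : l = 0.
  have : row_mx l rho *m (row_mx 1%:M 0 : 'rV[int]_(1 + n.+1))^T = 0 by rewrite -eG1.
  by rewrite tr_row_mx mul_row_col trmx0 mulmx0 addr0 trmx1 mulmx1.
rewrite l0 in eG1.
have [Q' [gam [uQ' rhoE]]] := primitive_row rho.
have gam0 : gam != 0.
  apply/eqP => gam0; have : e = 0.
    by rewrite -(mulmxK uG1 e) eG1 rhoE gam0 scale0r row_mx0 mul0mx.
  move/rowP/(_ 0); rewrite !mxE /=; case: split_ordP => j' //.
  by move=> _; rewrite ord1 !mxE.
(* [B] fixes [e] and multiplies [rho] by the inverse of [Q'], leaving [gam] times the first unit
   row. *)
pose B : 'M[int]_(1 + (1 + n)) := block_mx 1%:M 0 0 (invmx Q')^T.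
have uB : B \in unitmx.
  by rewrite unitmxE det_ublock det1 mul1r -unitmxE unitmx_tr unitmx_inv.
have eB : e *m B = e.
  by rewrite /e /B mul_row_block mulmx1 !mulmx0 mul0mx !addr0.
have eB' : e *m invmx B = e by rewrite -{1}eB mulmxK.
rewrite -eB; apply: (reducible_conj uB).
apply: (@reduction_core _ _ _ _ _ _ gam) => //.
- exact: ei_conj.
- by rewrite !mulmxA eB eT -scalemxAl eB'.
rewrite !mulmxA eB eG1 /B tr_block_mx !trmx0 trmx1 trmxK mul_row_block.
rewrite !mulmx0 !mul0mx !add0r ?addr0 rhoE -scalemxAl -row_mul mulmxV //; congr row_mx.
apply/rowP => j; rewrite !mxE; case: split_ordP => j' ->; rewrite ?ord1 !mxE -!val_eqE //= ?mulr1 ?mulr0 //.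
Qed.

(** * The star operation and separability in characteristic zero *)

Section Star.
Variable K : numFieldType.
Implicit Types f g p q : {poly K}.

(** The points 1, 2, 3, ... are distinct and nonzero in characteristic zero. Identities between
    stars can thus be checked on values, where x^-1 makes sense. *)
Lemma poly_eq_nonzero p q : (forall x, x != 0 -> p.[x] = q.[x]) -> p = q.
Proof.
move=> h; apply/eqP; rewrite -subr_eq0; apply/negPn/negP => ne.
pose rs : seq K := [seq i.+1%:R | i <- iota 0 (size (p - q))].
have urs : uniq rs.
  by rewrite map_inj_uniq ?iota_uniq // => i j /eqP; rewrite eqr_nat => /eqP[].
have ars : all (root (p - q)) rs.
  apply/allP => x /mapP[i _ ->]; rewrite /root !hornerE h ?subrr //.
  by rewrite pnatr_eq0.
by have := max_poly_roots ne ars urs; rewrite size_map size_iota ltnn.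
Qed.

Lemma horner_star f x : x != 0 -> (star f).[x] = f.[0]^-1 * (x ^+ deg f * f.[x^-1]).
Proof.
move=> x0; rewrite /star hornerZ; congr (_ * _).
rewrite horner_sum [f.[_]]horner_coef mulr_sumr; apply: eq_bigr => i _.
rewrite hornerZ hornerXn exprVn mulrCA; congr (_ * _).
have le : (i <= deg f)%N by have := ltn_ord i; rewrite /deg; move: (size f) (i : nat) => d l; lia.
by rewrite -{2}(subnK le) exprD mulfK // expf_neq0.
Qed.

Lemma degM f g : f != 0 -> g != 0 -> deg (f * g) = (deg f + deg g)%N.
Proof.
move=> f0 g0; rewrite /deg size_mul //; move: f0 g0; rewrite -!size_poly_gt0.
by move: (size f) (size g) => a b; lia.
Qed.

Lemma starM f g : f != 0 -> g != 0 -> star (f * g) = star f * star g.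
Proof.
move=> f0 g0; apply: poly_eq_nonzero => x x0.
rewrite hornerM !horner_star // degM // !hornerM exprD invfM; ring.
Qed.

Lemma horner_neq0 f x : f.[x] != 0 -> f != 0.
Proof. by apply: contraNneq => ->; rewrite horner0. Qed.

Lemma coef_star_le f i : (i <= deg f)%N -> f != 0 -> (star f)`_i = f.[0]^-1 * f`_(deg f - i).
Proof.
move=> le f0; rewrite coef_star ifT //.
by move: f0; rewrite -size_poly_gt0 /deg in le *; move: (size f) le => d; lia.
Qed.

Lemma size_star f : f.[0] != 0 -> size (star f) = size f.
Proof.
move=> f0; have fn0 := horner_neq0 f0; have s0 : (0 < size f)%N by rewrite size_poly_gt0.
apply/eqP; rewrite eqn_leq; apply/andP; split.
  by apply/leq_sizeP => i le; rewrite coef_star ltnNge le /= mulr0.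
rewrite leqNgt; apply/negP => lt.
have : (star f)`_(deg f) = 0 by rewrite nth_default // /deg; move: lt s0; move: (size f) (size (star f)) => a b; lia.
rewrite coef_star_le // subnn -horner_coef0 mulVf // => /eqP.
by rewrite oner_eq0.
Qed.

Lemma monic_star f : f.[0] != 0 -> star f \is monic.
Proof.
move=> f0; have fn0 := horner_neq0 f0.
by rewrite monicE /lead_coef size_star // coef_star_le // subnn -horner_coef0 mulVf.
Qed.

Lemma star0 f : f \is monic -> (star f).[0] = f.[0]^-1.
Proof.
move=> mf; rewrite horner_coef0 coef_star_le ?monic_neq0 // subn0.
by rewrite (_ : f`_(deg f) = 1) ?mulr1 // -[RHS](monicP mf).
Qed.

Lemma starK f : f \is monic -> f.[0] != 0 -> star (star f) = f.
Proof.
move=> mf f0; have fn0 := horner_neq0 f0; apply: poly_eq_nonzero => x x0.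
rewrite horner_star // star0 // invrK horner_star ?invr_eq0 // /deg size_star // invrK exprVn.
have xd : x ^+ (size f).-1 != 0 by rewrite expf_neq0.
by field; rewrite f0 xd.
Qed.

Lemma char0_deriv_neq0 f : (1 < size f)%N -> f^`() != 0.
Proof.
move=> s; apply/eqP => /(congr1 (fun q : {poly K} => q`_(size f).-2)) /eqP.
have e : (size f).-2.+1 = (size f).-1 by move: s; move: (size f) => d; lia.
rewrite coef_deriv coef0 e mulrn_eq0 -e /= e lead_coef_eq0 => /eqP f0.
by rewrite f0 size_poly0 in s.
Qed.

Lemma irreducible_factor f : (1 < size f)%N ->
  exists g, [/\ g \is monic, irreducible_poly g & g %| f].
Proof.
have [n] := ubnP (size f); elim: n f => // n IHn f; rewrite ltnS => le s.
have [irr|nirr] := pselect (irreducible_poly f).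
  have f0 := irredp_neq0 irr; exists ((lead_coef f)^-1 *: f).
  have lf : (lead_coef f)^-1 != 0 by rewrite invr_eq0 lead_coef_eq0.
  split; last by rewrite dvdpZl.
    by rewrite monicE lead_coefZ mulVf // lead_coef_eq0.
  split; first by rewrite size_scale.
  move=> q sq; rewrite dvdpZr // => /(irr.2 _ sq) e.
  by apply: (eqp_trans e); rewrite eqp_sym eqp_scale.
have [q [sq qf nq]] : exists q, [/\ size q != 1%N, q %| f & ~~ (q %= f)].
  apply: contrapT => h; apply: nirr; split=> // q sq qf.
  by apply: contrapT => /negP nq; apply: h; exists q.
have f0 : f != 0 by rewrite -size_poly_gt0 ltnW.
have q0 : q != 0 by apply: contraTneq qf => ->; rewrite dvd0p.
have lt : (size q < size f)%N.
  by rewrite ltn_neqAle dvdp_leq // andbT dvdp_size_eqp.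
have [|g [mg ig gq]] := IHn q (leq_trans lt le).
  by move: sq q0; rewrite -size_poly_gt0; move: (size q) => d; lia.
by exists g; split=> //; apply: dvdp_trans gq qf.
Qed.

(** An irreducible common factor [f] of p = q f and its derivative divides q f'; by degree it does
    not divide f', so it divides [q]. *)
Lemma nonseparable_square p : p != 0 -> ~~ separable_poly p ->
  exists f, [/\ f \is monic, irreducible_poly f & f ^+ 2 %| p].
Proof.
move=> p0; rewrite unlock /coprimep => ns.
have g0 : gcdp p p^`() != 0 by rewrite gcdp_eq0 negb_and p0.
have [|f [mf irf fg]] := @irreducible_factor (gcdp p p^`()).
  by move: ns g0; rewrite -size_poly_gt0; move: (size _) => d; lia.
exists f; split=> //; have /dvdpP[q pE] := dvdp_trans fg (dvdp_gcdl _ _).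
have := dvdp_trans fg (dvdp_gcdr _ _).
rewrite [in X in _ %| X]pE derivM dvdp_addr ?dvdp_mulIr // irredp_dvdM //.
case/orP=> [fq|ff]; first by rewrite pE expr2 dvdp_mul.
have := dvdp_leq (char0_deriv_neq0 irf.1) ff.
by rewrite leqNgt lt_size_deriv // irredp_neq0.
Qed.

Lemma irredp_separable f : irreducible_poly f -> separable_poly f.
Proof.
move=> irf; have f0 := irredp_neq0 irf; apply/negPn/negP => /(nonseparable_square f0)[g [mg irg g2]].
have gf : g %| f by apply: dvdp_trans g2; rewrite expr2 dvdp_mulr.
have e : g %= f by apply: irf.2 => //; rewrite gtn_eqF // irg.1.
have := dvdp_leq f0 g2; rewrite expr2 size_mul ?irredp_neq0 //.
have s := irg.1; rewrite -(eqp_size e); move: (size g) s => d; lia.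
Qed.

Lemma separable_star f : f \is monic -> f.[0] != 0 -> separable_poly f -> separable_poly (star f).
Proof.
move=> mf f0 sf; apply/negPn/negP => /nonseparable_square[].
  by rewrite monic_neq0 // monic_star.
move=> g [mg irg /dvdpP[q qE]].
have g0 : g != 0 by exact: monic_neq0.
have gn0 : g.[0] != 0.
  apply: contraTneq (f0 : f.[0] != 0) => e; have := star0 mf.
  rewrite qE hornerM horner_exp e expr0n mulr0 => /esym/eqP.
  by rewrite invr_eq0 => /eqP ->; rewrite eqxx.
have q0 : q != 0.
  by apply: contraTneq (monic_star f0) => e; rewrite qE e mul0r monicE lead_coef0 eq_sym oner_eq0.
have : (star g) ^+ 2 %| f.
  rewrite -(starK mf f0) qE starM ?expf_neq0 // expr2 starM // -expr2.
  exact: dvdp_mull.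
rewrite (separable_nosquare sf) // size_star //.
by rewrite gtn_eqF // irg.1.
Qed.

Lemma horner_char_poly n (A : 'M[K]_n) x : (char_poly A).[x] = \det (x%:M - A).
Proof.
rewrite /char_poly -[_.[x]]/(horner_eval x _) -det_map_mx; congr (\det _).
apply/matrixP => i j; rewrite !mxE.
transitivity (('X *+ (i == j) - (A i j)%:P).[x]) => //.
by rewrite hornerD hornerN hornerC hornerMn hornerX.
Qed.

Lemma char_poly_inv n (A : 'M[K]_n) : A \in unitmx ->
  char_poly (invmx A) = star (char_poly A).
Proof.
move=> uA; apply: poly_eq_nonzero => x x0.
rewrite horner_star // !horner_char_poly /deg size_char_poly /=.
have -> : x%:M - invmx A = (- x) *: (invmx A *m (x^-1%:M - A)).
  rewrite mulmxBr mulVmx // mul_mx_scalar scaleNr scalerBr scalerA mulfV // scale1r.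
  by rewrite scalemx1 opprB.
rewrite detZ det_mulmx det_inv raddf0 sub0r -scaleN1r detZ invfM.
have si : ((-1) ^+ n)^-1 = (-1) ^+ n :> K by rewrite -signr_odd invr_sign.
by rewrite exprNn si; ring.
Qed.

End Star.

(** * Factorization and hyperbolic blocks *)

Section F12.
Variable K : numFieldType.
Implicit Types F : {poly K}.

Lemma irredp_X1 : irreducible_poly ('X - 1 : {poly K}).
Proof. by rewrite -polyC1; exact: irredp_XsubC. Qed.

Lemma irredp_XN1 : irreducible_poly ('X + 1 : {poly K}).
Proof. by rewrite -polyC1; exact: irredp_XaddC. Qed.

Lemma dvdp_X1 F : ('X - 1 %| F) = (F.[1] == 0).
Proof. by rewrite -polyC1 dvdp_XsubCl. Qed.

Lemma dvdp_XN1 F : ('X + 1 %| F) = (F.[-1] == 0).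
Proof.
have -> : 'X + 1 = 'X - (-1)%:P :> {poly K} by rewrite polyCN polyC1 opprK.
by rewrite dvdp_XsubCl.
Qed.

Lemma mult_X1_XN1 a b F F0 : F = ('X - 1) ^+ a * ('X + 1) ^+ b * F0 ->
  F0.[1] != 0 -> F0.[-1] != 0 -> mult ('X - 1) F = a /\ mult ('X + 1) F = b.
Proof.
move=> FE h1 h2; have F0n : F0 != 0 by exact: horner_neq0 h1.
have X1n := irredp_neq0 irredp_X1; have XN1n := irredp_neq0 irredp_XN1.
have Fn : F != 0 by rewrite FE !mulf_neq0 ?expf_neq0.
have n2 : 1 + 1 != 0 :> K by rewrite (pnatr_eq0 K 2).
split.
  apply: (@mult_eq _ _ _ (('X + 1) ^+ b * F0)) => //; first exact: irredp_X1.
    by rewrite FE mulrA.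
  by rewrite dvdp_X1 hornerM horner_exp !hornerE mulf_neq0 ?expf_neq0.
apply: (@mult_eq _ _ _ (('X - 1) ^+ a * F0)) => //; first exact: irredp_XN1.
  by rewrite FE mulrA [X in X * F0]mulrC.
rewrite dvdp_XN1 hornerM horner_exp !hornerE mulf_neq0 ?expf_neq0 //.
by rewrite -opprD oppr_eq0.
Qed.

Lemma F12_eq a b F F0 : F = ('X - 1) ^+ a * ('X + 1) ^+ b * F0 ->
  F0.[1] != 0 -> F0.[-1] != 0 -> F12 F = F0.
Proof.
move=> FE h1 h2; have [e1 e2] := mult_X1_XN1 FE h1 h2.
rewrite /F12 e1 e2 FE mulrC mulpK // mulf_neq0 ?expf_neq0 //.
  exact: irredp_neq0 irredp_X1.
exact: irredp_neq0 irredp_XN1.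
Qed.

End F12.

Lemma mult_map (K L : fieldType) (f : {rmorphism K -> L}) (p F : {poly K}) :
  mult (map_poly f p) (map_poly f F) = mult p F.
Proof.
rewrite /mult size_map_poly; apply: eq_bigl => k.
by rewrite -rmorphXn dvdp_map.
Qed.

Lemma mod4_rel_F12 (R : realType) (F : {poly R}) r s j : mod4_rel F r s j ->
  (j ('X - 1) + j ('X + 1) = r%:Z - s%:Z + 1 - esign (F12 F) %[mod 4])%Z.
Proof.
by move=> [a [b [F0 [FE [h1 h2] _ e]]]]; rewrite (F12_eq FE h1 h2).
Qed.

Lemma int_mul_eq1 (z w : int) : z * w = 1 -> z ^+ 2 = 1.
Proof.
move=> e; have : (`|z| * `|w| = 1)%N by rewrite -abszM e.
move/eqP; rewrite muln_eq1 => /andP[/eqP h _].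
have [->|->] : z = 1 \/ z = -1 by lia.
  by rewrite expr1n.
by rewrite sqrrN expr1n.
Qed.

Lemma map_intr_inj (K : numFieldType) : injective (map_poly intr : {poly int} -> {poly K}).
Proof. by apply: map_inj_poly => //; exact: intr_inj. Qed.

Lemma map_intr_monic (K : numFieldType) (F : {poly int}) :
  ((map_poly intr F : {poly K}) \is monic) = (F \is monic).
Proof.
rewrite !monicE lead_coef_map_inj //; last exact: intr_inj.
by rewrite (eqr_int K _ 1).
Qed.

Lemma size_map_intr (K : numFieldType) (F : {poly int}) :
  size (map_poly intr F : {poly K}) = size F.
Proof. by apply: size_map_inj_poly => //; exact: intr_inj. Qed.

Lemma horner_map_intr (K : numFieldType) (F : {poly int}) x :
  (map_poly intr F : {poly K}).[x%:~R] = F.[x]%:~R.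
Proof. by rewrite horner_map. Qed.

Lemma horner0_map_intr (K : numFieldType) (F : {poly int}) :
  (map_poly intr F : {poly K}).[0] = F.[0]%:~R.
Proof. by rewrite -horner_map_intr. Qed.

Lemma horner1_map_intr (K : numFieldType) (F : {poly int}) :
  (map_poly intr F : {poly K}).[1] = F.[1]%:~R.
Proof. by rewrite -horner_map_intr. Qed.

Lemma hornerN1_map_intr (K : numFieldType) (F : {poly int}) :
  (map_poly intr F : {poly K}).[-1] = F.[-1]%:~R.
Proof. by rewrite -horner_map_intr. Qed.

Local Notation pZtoQ := (map_poly (intr : int -> rat)).

(** Gauss's lemma gives an integral multiple [p1] of [f] dividing [F]. Its leading coefficient
    divides 1, and rescaling by that sign makes it monic. *)
Lemma monic_divisor_int (F : {poly int}) (f : {poly rat}) :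
  F \is monic -> f \is monic -> f %| pZtoQ F -> exists h r, f = pZtoQ h /\ F = h * r.
Proof.
move=> mF mf /dvdpP_rat_int[p1 [a a0 fE] [r FE]].
have e : lead_coef p1 * lead_coef r = 1 by rewrite -lead_coefM -FE (monicP mF).
set u := lead_coef p1 in e; have u2 := int_mul_eq1 e.
exists (u *: p1), (u *: r); split; last first.
  by rewrite -scalerAl -scalerAr scalerA -expr2 u2 scale1r.
have au : a * u%:~R = 1.
  have := monicP mf; rewrite fE lead_coefZ lead_coef_map_inj //; exact: intr_inj.
have uu : u%:~R * u%:~R = 1 :> rat by rewrite -intrM -expr2 u2.
have u0 : u%:~R != 0 :> rat by apply: contra_eq_neq au => ->; rewrite mulr0 eq_sym oner_eq0.
rewrite fE map_polyZ /=; congr (_ *: _).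
by apply: (mulIf u0); rewrite au uu.
Qed.

(** The star over the integers, for h(0) = 1 or -1: then h(0) is its own inverse. *)
Definition istar (h : {poly int}) : {poly int} :=
  h.[0] *: \sum_(i < size h) h`_i *: 'X^(deg h - i).

Lemma map_istar (h : {poly int}) : h.[0] ^+ 2 = 1 -> pZtoQ (istar h) = star (pZtoQ h).
Proof.
move=> h2; have h2' : (h.[0])%:~R * (h.[0])%:~R = 1 :> rat by rewrite -intrM -expr2 h2.
have h0 : (h.[0])%:~R != 0 :> rat by apply: contra_eq_neq h2' => ->; rewrite mul0r eq_sym oner_eq0.
rewrite /istar /star map_polyZ /= rmorph_sum /= size_map_intr; congr (_ *: _).
  rewrite horner0_map_intr.
  by apply: (mulfI h0); rewrite h2' mulfV.
apply: eq_bigr => i _; rewrite map_polyZ /= map_polyXn coef_map /=.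
by rewrite /deg size_map_intr.
Qed.

Lemma horner_istar (h : {poly int}) (x : int) : h.[0] ^+ 2 = 1 -> x ^+ 2 = 1 ->
  (istar h).[x] = h.[0] * x ^+ deg h * h.[x].
Proof.
move=> h2 x2; have x2' : x%:~R * x%:~R = 1 :> rat by rewrite -intrM -expr2 x2.
have x0 : x%:~R != 0 :> rat by apply: contra_eq_neq x2' => ->; rewrite mul0r eq_sym oner_eq0.
apply: (@intr_inj rat); rewrite -horner_map_intr map_istar // horner_star //.
have xi : x%:~R^-1 = x%:~R :> rat by apply: (mulfI x0); rewrite x2' mulfV.
have h2' : (h.[0])%:~R * (h.[0])%:~R = 1 :> rat by rewrite -intrM -expr2 h2.
have h0 : (h.[0])%:~R != 0 :> rat by apply: contra_eq_neq h2' => ->; rewrite mul0r eq_sym oner_eq0.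
rewrite xi horner_map_intr horner0_map_intr /deg size_map_intr.
rewrite !intrM rmorphXn /= mulrA; congr (_ * _ * _).
by apply: (mulfI h0); rewrite h2' mulfV.
Qed.

Definition hyp_factor (h : {poly int}) : Prop :=
  [/\ h \is monic, h.[0] ^+ 2 = 1 & irreducible_poly (pZtoQ h)].

Lemma hyp_factor_root (h : {poly int}) (eta : int) :
  hyp_factor h -> h.[eta] = 0 -> h = 'X - eta%:P.
Proof.
move=> [mh h2 irh] e; apply: (@map_intr_inj rat); apply/esym.
rewrite rmorphB /= map_polyX map_polyC /=.
apply: irredp_monic_eq; rewrite ?monicXsubC ?map_intr_monic //; first exact: irredp_XsubC.
by rewrite dvdp_XsubCl /root horner_map_intr e.
Qed.

Lemma istar_lin (eta : int) : eta ^+ 2 = 1 -> istar ('X - eta%:P) = 'X - eta%:P.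
Proof.
move=> eta2; apply: (@map_intr_inj rat).
rewrite map_istar; last by rewrite hornerXsubC sub0r sqrrN.
rewrite rmorphB /= map_polyX map_polyC /=.
have e2 : (eta%:~R : rat) ^+ 2 = 1 by rewrite -rmorphXn /= eta2.
by have [] := star_symmetric_lin e2.
Qed.

Lemma char_poly_tr (A : comNzRingType) n (M : 'M[A]_n) : char_poly M^T = char_poly M.
Proof.
rewrite /char_poly -[RHS]det_tr; congr (\det _).
by apply/matrixP => i j; rewrite !mxE eq_sym.
Qed.

(** The index at X - 1 is trivial unless h(1) = 0. Then h = X - 1, so X + 1 does not occur and the
    relation modulo 4 with r = s and trivial [F12] again gives 0. *)
Lemma hyperbolic_lattice (R : realType) (h : {poly int}) : hyp_factor h ->
  has_lattice R (h * istar h) (deg h) 0.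
Proof.
move=> [mh h2 irh]; pose d := deg h; pose C : 'M[int]_d := companionmx h.
have cC : char_poly C = h by exact: companionmxK.
have uC : C \in unitmx.
  have := char_poly_det C; rewrite cC -horner_coef0 => e.
  rewrite unitmxE; have : \det C * \det C = 1.
    by have := h2; rewrite e exprMn sqrr_sign mul1r expr2.
  by move=> h1; apply/unitrP; exists (\det C).
have h0Q : (pZtoQ h).[0] != 0.
  rewrite horner0_map_intr intr_eq0.
  by apply: contra_eq_neq h2 => ->; rewrite expr0n.
have mhQ : pZtoQ h \is monic by rewrite map_intr_monic.
have cCi : char_poly (invmx C)^T = istar h.
  apply: (@map_intr_inj rat); rewrite map_istar // char_poly_tr map_char_poly -cC map_char_poly.
  have VC : map_mx intr (invmx C) *m map_mx intr C = 1%:M :> 'M[rat]_d.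
    by rewrite -map_mxM mulVmx // map_mx1.
  have uCQ : map_mx intr C \in @unitmx rat d by case/mulmx1_unit: VC.
  rewrite -char_poly_inv //; congr char_poly.
  by rewrite -[LHS]mulmx1 -(mulmxV uCQ) mulmxA VC mul1mx.
pose G : 'M[int]_(d + d) := block_mx 0 1%:M 1%:M 0.
pose T : 'M[int]_(d + d) := block_mx C 0 0 (invmx C)^T.
have cT : char_poly T = h * istar h by rewrite /T char_poly_block cC cCi.
have hei : even_isometry R G T d (h * istar h).
  split=> //.
  - by exists (block_mx 0 1%:M 0 0); rewrite tr_block_mx !trmx0 trmx1 add_block_mx !addr0 add0r.
  - have : G *m G = 1%:M.
      by rewrite mulmx_block !(mul0mx, mulmx0, mul1mx) !(addr0, add0r) -scalar_mx_block.
    by case/mulmx1_unit.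
  - rewrite /T /G tr_block_mx !trmx0 trmxK !mulmx_block.
    rewrite !(mul0mx, mulmx0, mulmx1, mul1mx, addr0, add0r) mulmxV //.
    by rewrite -trmx_mul mulmxV // trmx1.
  - have [r [sr d1 d2]] := separable_common_multiple (irredp_separable irh)
      (separable_star mhQ h0Q (irredp_separable irh)).
    exists r => //; rewrite /T map_block_mx !map_mx0 mxeval_block.
    rewrite (mxeval_dvd d1) ?(mxeval_dvd d2) ?block_mx0 //.
      by rewrite -map_istar // -cCi -map_mxeval mxeval_char map_mx0.
    by have := mxeval_char C; rewrite cC -map_mxeval => ->; rewrite map_mx0.
  - rewrite /G map_block_mx !map_mx0 map_mx1 -{2}trmx1.
    by apply: tsig_hyperbolic; rewrite unitmx1.
have [j p] := ei_profile hei; exists (d + d)%N, G, T; split=> //; exists j => //.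
have [_ [_ [out _ _ _ _]] q _] := p.
rewrite -map_char_poly cT in out q.
have out0 (eta : int) : (h * istar h).[eta] != 0 -> forall f : {poly R}, root f eta%:~R -> j f = 0.
  move=> n f rf; apply: out => -[_ _ _ fd].
  have : root (map_poly intr (h * istar h)) (eta%:~R : R).
    by have /dvdpP[q' ->] := fd; rewrite rootM rf orbT.
  by rewrite /root horner_map_intr intr_eq0 (negbTE n).
have r1 : root ('X - 1 : {poly R}) 1%:~R by rewrite -polyC1 root_XsubC.
have rN1 : root ('X + 1 : {poly R}) (-1)%:~R by rewrite /root !hornerE /= addNr.
have [e1|n1] := eqVneq (h.[1]) 0; last first.
  by rewrite (out0 1) // hornerM horner_istar // !mulf_neq0 ?expf_neq0 //;
     apply: contra_eq_neq h2 => ->; rewrite expr0n.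
have hX : h = 'X - 1 by rewrite -polyC1; apply: hyp_factor_root.
have iX : istar ('X - 1) = 'X - 1 by rewrite -polyC1 istar_lin.
have jN : j ('X + 1) = 0.
  by rewrite (out0 (-1)) // hornerM hX iX !hornerE.
have := mod4_rel_F12 q; rewrite jN addr0.
rewrite (@F12_eq _ 2 0 _ 1) ?hornerC ?oner_eq0 //; last first.
  by rewrite hX iX rmorphM rmorphB /= map_polyX rmorph1 expr2 expr0 !mulr1.
rewrite /esign /deg size_poly1 /= div0n expr0 !hornerC !mulr1 sgz1.
by move=> ->; lia.
Qed.

(** A nonseparable [F] contains some f^2. Either [f] is its own star, or [f] and its star are
    coprime and both divide [F]; in both cases f * star f splits off and leaves a star-symmetric
    cofactor. *)
Lemma star_factorization (F : {poly int}) : star_symmetric (pZtoQ F) ->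
  exists (E : {poly int}) (hs : seq {poly int}),
    [/\ F = E * \prod_(h <- hs) (h * istar h), star_symmetric (pZtoQ E),
        separable_poly (pZtoQ E) & forall h, h \in hs -> hyp_factor h].
Proof.
have [n] := ubnP (size F); elim: n F => // n IHn F; rewrite ltnS => le symF.
have [sF|nsF] := boolP (separable_poly (pZtoQ F)).
  by exists F, [::]; rewrite big_nil mulr1.
have [mFQ F0Q FsQ] := symF; have mF : F \is monic by rewrite -(map_intr_monic rat).
have [f [mf irf f2]] := nonseparable_square (monic_neq0 mFQ) nsF.
have fF : f %| pZtoQ F by apply: dvdp_trans f2; rewrite expr2 dvdp_mulr.
have [h [r1 [fE FE1]]] := monic_divisor_int mF mf fF.
have mh : h \is monic by rewrite -(map_intr_monic rat) -fE.
have h2 : h.[0] ^+ 2 = 1.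
  have : F.[0] ^+ 2 = 1.
    apply: (@intr_inj rat); rewrite rmorphXn /= -horner0_map_intr.
    by have := star_symmetric_const symF.
  rewrite FE1 hornerM exprMn => e.
  by apply: (@int_mul_eq1 _ (h.[0] * r1.[0] ^+ 2)); rewrite mulrA -expr2.
have f0 : f.[0] != 0.
  by apply: contraNneq F0Q => e; have /dvdpP[q ->] := fF; rewrite hornerM e mulr0.
have hf : hyp_factor h by split=> //; rewrite -fE.
have fsF : f * star f %| pZtoQ F.
  have [e|ne] := eqVneq f (star f); first by rewrite -e -expr2.
  have sfF : star f %| pZtoQ F.
    have /dvdpP[q qE] := fF.
    have q0 : q != 0.
      by apply: contraNneq F0Q => q0; rewrite qE q0 mul0r horner0.
    by rewrite -FsQ qE starM ?(monic_neq0 mf) // dvdp_mull.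
  rewrite Gauss_dvdp ?fF ?sfF // irredp_coprime //.
  apply: contra ne => fs; rewrite -eqp_monic ?monic_star //.
  by rewrite -dvdp_size_eqp // size_star.
have mff : f * star f \is monic by rewrite monicMl // monic_star.
have [H [r [HE FE]]] := monic_divisor_int mF mff fsF.
have HhE : H = h * istar h.
  by apply: (@map_intr_inj rat); rewrite -HE rmorphM /= map_istar // -fE.
have mH : H \is monic by rewrite -(map_intr_monic rat) -HE.
have mr : r \is monic by move: mF; rewrite FE monicMl.
have fs0 : f * star f != 0 by exact: monic_neq0.
have ffs : star (f * star f) = f * star f.
  by rewrite starM ?monic_neq0 ?monic_star // starK // mulrC.
have rQ0 : pZtoQ r != 0 by rewrite monic_neq0 // map_intr_monic.
have symr : star_symmetric (pZtoQ r).
  split; first by rewrite map_intr_monic.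
    by apply: contraNneq F0Q => e; rewrite FE rmorphM hornerM e mulr0.
  have : star (pZtoQ F) = pZtoQ H * star (pZtoQ r).
    by rewrite FE rmorphM /= -HE starM // ffs.
  rewrite FsQ [in LHS]FE rmorphM /= -HE => e.
  by apply: (mulfI fs0); rewrite -e.
have szr : (size r < n)%N.
  apply: leq_trans le; rewrite FE size_monicM ?monic_neq0 //.
  have : (1 < size H)%N.
    rewrite -(size_map_intr rat) -HE size_mul ?monic_neq0 ?monic_star // size_star //.
    by case: (size f) irf.1 => [|[|d]] // _; rewrite !addSn !addnS.
  have : (0 < size r)%N by rewrite size_poly_gt0 monic_neq0.
  by case: (size r) => // a _; case: (size H) => [|[|b]] // _; rewrite /= addSn /= ltnS leq_addl.
have [E [hs [rE symE sepE hsP]]] := IHn r szr symr.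
exists E, (h :: hs); split=> //.
  by rewrite FE HhE rE big_cons mulrCA.
by move=> g; rewrite inE => /orP[/eqP ->|/hsP].
Qed.

(** * The theorem *)

Section Consequences.
Variable R : realType.

Lemma has_lattice_deg F k i : has_lattice R F k i -> F \is monic /\ deg F = (k + k)%N.
Proof.
move=> [N [G [T [[_ _ _ cT _ [eN _]] _]]]].
by rewrite -cT char_poly_monic /deg size_char_poly.
Qed.

Lemma has_lattice_mod2 F k i : has_lattice R F k i ->
  (i = (mult ('X - 1) (pZtoQ F))%:Z %[mod 2])%Z.
Proof.
move=> h; have [mF _] := has_lattice_deg h.
move: h => [N [G [T [[_ _ _ cT _ _] [j [_ [_ [out _ par _ _]] _ _] e]]]]].
rewrite -map_char_poly cT in out par.
have -> : mult ('X - 1) (pZtoQ F) = mult ('X - 1) (map_poly intr F : {poly R}).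
  have m1 (K : fieldType) : ('X - 1 : {poly K}) = map_poly intr ('X - 1 : {poly int}).
    by rewrite rmorphB /= map_polyX rmorph1.
  rewrite -(@mult_map rat R ratr) rmorphB /= map_polyX rmorph1; congr mult.
  by rewrite -map_poly_comp; apply: eq_map_poly => x /=; rewrite ratr_int.
have irX := irredp_X1 R; have FR0 : (map_poly intr F : {poly R}) != 0.
  by rewrite monic_neq0 // map_intr_monic.
have degX : deg ('X - 1 : {poly R}) = 1%N by rewrite /deg -polyC1 size_XsubC.
have [d|nd] := boolP ('X - 1 %| (map_poly intr F : {poly R})).
  have := par ('X - 1); rewrite /degm mult_deg_exp degX muln1 => e2.
  have I : Isym (map_poly intr F : {poly R}) ('X - 1).
    apply/Isym_sym_irr; split=> //; rewrite -polyC1.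
    by split; [exact: monicXsubC | exact: irredp_XsubC | apply: star_symmetric_lin; rewrite expr1n].
  by have := e2 I; lia.
rewrite mult_eq0 //; have : j ('X - 1) = 0.
  by apply: out => /Isym_sym_irr[_]; apply/negP.
by lia.
Qed.

Lemma has_lattice_mod4_root1 F k i : has_lattice R F k i -> F.[1] != 0 ->
  (i = 0 %[mod 4])%Z.
Proof.
move=> [N [G [T [[_ _ _ cT _ _] [j [_ [_ [out _ _ _ _]] _ _] e]]]]] F1.
rewrite -map_char_poly cT in out.
have j0 : j ('X - 1) = 0.
  apply: out => /Isym_sym_irr[_]; rewrite dvdp_X1 horner1_map_intr intr_eq0.
  by rewrite (negbTE F1).
by rewrite -e j0.
Qed.

(** The index at X + 1 vanishes, so the relation modulo 4 determines the one at X - 1. *)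
Lemma has_lattice_mod4_rootN1 F k i : has_lattice R F k i -> F.[-1] != 0 ->
  (i = 1 - esign (F12 (map_poly intr F : {poly R})) %[mod 4])%Z.
Proof.
move=> [N [G [T [[_ _ _ cT _ _] [j [_ [_ [out _ _ _ _]] q _] e]]]]] F1.
rewrite -map_char_poly cT in out q.
have j0 : j ('X + 1) = 0.
  apply: out => /Isym_sym_irr[_]; rewrite dvdp_XN1 hornerN1_map_intr intr_eq0.
  by rewrite (negbTE F1).
have := mod4_rel_F12 q; rewrite j0 addr0 -e => ->.
by rewrite subrr add0r.
Qed.

Lemma has_lattice_main n (F : {poly int}) (ip im i : int) k :
  has_lattice R F k i -> deg F = (2 * n)%N -> (i = ip %[mod 4])%Z ->
  (ip + im = 1 - esign (F12 (map_poly intr F : {poly R})) %[mod 4])%Z ->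
  exists j : {poly R} -> int,
    [/\ Idx n n (map_poly intr F) j,
        (j ('X - 1) = ip %[mod 4])%Z,
        (j ('X + 1) = im %[mod 4])%Z &
        exists (L : lattice) (T : 'M[int]_(rank L)),
          [/\ even L, unimodular L, has_signature R L n n,
              Fj_isometry F j T &
              semisimple (map_mx intr T : 'M[rat]_(rank L))]].
Proof.
move=> h dF ei e4; have [_ dF'] := has_lattice_deg h.
have kn : k = n by move: dF; rewrite dF' => {}dF; clear -dF; lia.
move: h => [N [G [T [hei [j [sig [fin idx] q hidx] e]]]]].
rewrite -map_char_poly (ei_char hei) in idx q; rewrite {}kn in hei sig idx q.
have symG := ei_sym hei; have [[M GE] uG iso cT [p sp pT] _] := hei.
have gs (x y : 'rV[int]_N) : bform G x y = bform G y x.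
  rewrite /bform; have -> : x *m G *m y^T = (y *m G *m x^T)^T.
    by rewrite !trmx_mul trmxK symG mulmxA.
  by rewrite mxE.
have gn (x : 'rV[int]_N) : (forall y, bform G x y = 0) -> x = 0.
  move=> h0; have xG : x *m G = 0.
    apply/rowP => i0; have := h0 (delta_mx 0 i0).
    by rewrite /bform trmx_delta -colE !mxE.
  by rewrite -(mulmxK uG x) xG mul0mx.
exists j; split=> //; first by rewrite e.
  (* Both pairs of residues have the same sum modulo 4, so agreement at X - 1 gives agreement at X +
     1. *)
  move: e ei e4 (mod4_rel_F12 q); rewrite subrr add0r.
  by move: (esign _) (j ('X - 1)) (j ('X + 1)) => s x y; clear; lia.
exists (Lattice gs gn), T; split=> //=.
- move=> x; rewrite /bform /= GE mulmxDr mulmxDl mxE.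
  have -> : x *m M^T *m x^T = (x *m M *m x^T)^T by rewrite !trmx_mul trmxK mulmxA.
  by rewrite [X in _ + X]mxE; apply/dvdzP; exists ((x *m M *m x^T) 0 0); ring.
- exact: tsig_signature.
- split=> //; first split.
  + have : T *m (G *m T^T *m invmx G) = 1%:M by rewrite !mulmxA iso mulmxV.
    by case/mulmx1_unit.
  + by move=> x y; rewrite /bform /= trmx_mul !mulmxA -2!(mulmxA x) iso.
  + move=> f /Isym_sym_irr[sf _]; exact: hidx.
- exact: semisimple_separable sp pT.
Qed.

Lemma has_lattice_one : has_lattice R 1 0 0.
Proof.
have h : even_isometry R (0 : 'M[int]_0) 0 0 1.
  split.
  - by exists 0; rewrite [RHS]thinmx0.
  - by rewrite unitmxE det_mx00 unitr1.
  - by rewrite [LHS]thinmx0.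
  - by rewrite /char_poly det_mx00.
  - exists 1; last by rewrite [LHS]thinmx0.
    by rewrite unlock /separable_poly coprime1p.
  - by split=> //; exists 0; rewrite [LHS]thinmx0 [RHS]thinmx0.
have [i hi] := ei_has_lattice h.
have := has_lattice_mod4_root1 hi; rewrite hornerC => /(_ (oner_neq0 _)) e.
move: hi => [N [G [T [hei [j pj ej]]]]]; exists N, G, T; split=> //; exists j => //.
by rewrite ej e.
Qed.

Lemma has_lattice_prod (hs : seq {poly int}) : (forall h, h \in hs -> hyp_factor h) ->
  has_lattice R (\prod_(h <- hs) (h * istar h)) (\sum_(h <- hs) deg h) 0.
Proof.
elim: hs => [|h hs IHhs] hP; first by rewrite !big_nil; exact: has_lattice_one.
rewrite !big_cons -[0]addr0; apply: has_latticeM.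
  by apply: hyperbolic_lattice; apply: hP; rewrite mem_head.
by apply: IHhs => g gs; apply: hP; rewrite in_cons gs orbT.
Qed.

End Consequences.

(** At x = 1 or -1 the product h h^# takes the value h(0) x^(deg h) h(x)^2. The product [s] of the
    h(0) occurs at both points, so it cancels in F(1) F(-1). *)
Lemma prod_hyp_values (hs : seq {poly int}) : (forall h, h \in hs -> hyp_factor h) ->
  exists s A B : int, [/\ s ^+ 2 = 1,
    (\prod_(h <- hs) (h * istar h)).[1] = s * A ^+ 2 &
    (\prod_(h <- hs) (h * istar h)).[-1] = s * (-1) ^+ (\sum_(h <- hs) deg h) * B ^+ 2].
Proof.
elim: hs => [|h hs IHhs] hP.
  by exists 1, 1, 1; rewrite !big_nil !hornerC expr0 !expr1n !mulr1.
have [mh h2 _] : hyp_factor h by apply: hP; rewrite mem_head.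
have [|s [A [B [s2 eA eB]]]] := IHhs; first by move=> g gs; apply: hP; rewrite in_cons gs orbT.
exists (h.[0] * s), (h.[1] * A), (h.[-1] * B); rewrite !big_cons !hornerM eA eB.
rewrite !horner_istar ?sqrrN ?expr1n // exprMn h2 s2 mulr1; split=> //; first by ring.
by rewrite exprD; ring.
Qed.

Lemma star_antipalindrome (P : {poly int}) : star_symmetric (pZtoQ P) -> P.[0] = -1 ->
  forall i, (i <= deg P)%N -> P`_(deg P - i) = - P`_i.
Proof.
move=> [mP P0 sP] e i le; apply: (@intr_inj rat).
have dP : deg (pZtoQ P) = deg P by rewrite /deg size_map_intr.
have := congr1 (fun q : {poly rat} => q`_i) sP.
rewrite /= coef_star_le ?dP ?monic_neq0 // horner0_map_intr e !coef_map /= => e2.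
have eN : (-1)%:~R^-1 = -1 :> rat by rewrite rmorphN1 invrN1.
by rewrite rmorphN /= -e2 eN mulN1r opprK.
Qed.

Lemma int_square_quotient (x A a : int) : A != 0 -> x * A ^+ 2 = a ^+ 2 -> exists c, x = c ^+ 2.
Proof.
move=> A0 e; have : (`|A| ^ 2 %| `|a| ^ 2)%N.
  by apply/dvdnP; exists `|x|%N; rewrite -!abszX -abszM e.
rewrite dvdn_pexp2r // => d; have /dvdzP[q qE] : (A %| a)%Z by rewrite dvdzE.
exists q; apply: (@mulIf _ (A ^+ 2)); first by rewrite expf_neq0.
by rewrite e qE exprMn.
Qed.

Lemma star_symmetricM (K : numFieldType) (f g : {poly K}) :
  star_symmetric f -> star_symmetric g -> star_symmetric (f * g).
Proof.
move=> [mf f0 sf] [mg g0 sg]; split; first by rewrite monicMl.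
  by rewrite hornerM mulf_neq0.
by rewrite starM ?sf ?sg ?monic_neq0.
Qed.

(** Such a root would be double: the cofactor [v] is its own star, of odd degree with v(0) = -eta,
    so its functional equation at [eta] reads v(eta) = -v(eta). *)
Lemma separable_star_root (E : {poly rat}) (eta : rat) : eta ^+ 2 = 1 ->
  star_symmetric E -> E.[0] = 1 -> ~~ odd (deg E) -> separable_poly E -> E.[eta] != 0.
Proof.
move=> eta2 [mE E0 sE] E01 evE sepE; apply/negP => /eqP e.
have eta0 : eta != 0 by apply: contra_eq_neq eta2 => ->; rewrite expr0n.
have ei : eta^-1 = eta by apply: (mulfI eta0); rewrite mulfV // -expr2 eta2.
have /dvdpP[v vE] : 'X - eta%:P %| E by rewrite dvdp_XsubCl /root e.
have Xn : 'X - eta%:P != 0 :> {poly rat} by rewrite polyXsubC_eq0.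
have v0 : v != 0 by apply: contraNneq (monic_neq0 mE) => v0; rewrite vE v0 mul0r.
have mv : v \is monic by move: mE; rewrite vE monicMr // monicXsubC.
have [_ _ sX] := star_symmetric_lin eta2.
have sv : star v = v by apply: (mulIf Xn); rewrite -[in LHS]sX -starM // -vE.
have dv : odd (deg v).
  move: evE; rewrite vE degM // [deg ('X - _)]/deg size_XsubC addn1 /= negbK //.
have vn0 : v.[0] = - eta.
  have := E01; rewrite vE hornerM hornerXsubC sub0r => h.
  by apply: (mulIf eta0); rewrite mulNr -expr2 eta2 -h mulrN opprK.
have etad : eta ^+ deg v = eta.
  by rewrite -[deg v]odd_double_half dv exprS -mul2n exprM eta2 expr1n mulr1.
have veta : v.[eta] = 0.
  have := congr1 (fun q : {poly rat} => q.[eta]) sv.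
  rewrite horner_star // ei vn0 etad invrN ei mulrA mulNr -expr2 eta2 mulN1r.
  by move/eqP; rewrite eq_sym -addr_eq0 -mulr2n mulrn_eq0 /= => /eqP.
have := separable_nosquare sepE (k := 2) (u := 'X - eta%:P) isT.
rewrite size_XsubC => /(_ isT); rewrite expr2 vE dvdp_mul //.
by rewrite dvdp_XsubCl /root veta.
Qed.

(** * The antipalindromic blocks attached to E *)

Section Assembly.
Variable R : realType.

Lemma toeplitz_star (P : {poly int}) m : star_symmetric (pZtoQ P) -> P.[0] = -1 ->
  deg P = (m.+1 + m.+1)%N -> separable_poly (pZtoQ P) ->
  exists G C : 'M[int]_(m.+1 + m.+1), even_isometry R G C m.+1 P /\
    forall (eta : int) v, eta ^+ 2 = 1 -> P = ('X - eta%:P) * v ->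
    exists vv : 'rV_(m.+1 + m.+1), [/\ vv != 0, vv *m C = eta *: vv &
      vv *m G *m vv^T = (eta ^+ m * v.[eta])%:M].
Proof.
move=> symP P0 dP sepP; have [mPQ _ _] := symP.
have mP : P \is monic by rewrite -(map_intr_monic rat).
have sP : size P = (m.+1 + m.+1).+1.
  have : (0 < size P)%N by rewrite size_poly_gt0 monic_neq0.
  by rewrite -dP /deg => /prednK.
have antiP : forall i, (i <= m.+1 + m.+1)%N -> P`_(m.+1 + m.+1 - i) = - P`_i.
  by rewrite -dP; apply: star_antipalindrome.
have [G [C [hei hv]]] := @toeplitz_block R P m mP sP antiP sepP.
exists G, C; split=> // eta v eta2 PE; have [vC vv] := hv eta v eta2 PE.
exists (\row_(j < m.+1 + m.+1) v`_j); split=> //.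
have mv : v \is monic by move: mP; rewrite PE monicMl // monicXsubC.
have sv : size v = (m.+1 + m.+1)%N.
  by move: sP; rewrite PE size_monicM ?monicXsubC ?monic_neq0 // size_XsubC => -[].
apply/eqP => /rowP/(_ (Ordinal (ltnSn (m.+1 + m.+1).-1))); rewrite !mxE /=.
have := monicP mv; rewrite /lead_coef sv => -> /eqP.
by rewrite oner_eq0.
Qed.

(** The index has the parity of the multiplicity, and 1 is a simple root. *)
Lemma odd_index (P : {poly int}) k i : P.[1] = 0 -> separable_poly (pZtoQ P) ->
  has_lattice R P k i -> (i = 1 %[mod 2])%Z.
Proof.
move=> P1 sepP h; have := has_lattice_mod2 h.
have P0 := separable_poly_neq0 sepP.
have s2 : (1 < size ('X - 1 : {poly rat})%R)%N by rewrite -polyC1 size_XsubC.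
suff -> : mult ('X - 1) (pZtoQ P) = 1%N by [].
apply/eqP; rewrite eqn_leq -(dvdp_exp_mult 1 s2 P0) expr1 dvdp_X1 horner1_map_intr P1 eqxx andbT.
rewrite leqNgt -(dvdp_exp_mult 2 s2 P0) separable_nosquare //.
by rewrite -polyC1 size_XsubC.
Qed.

Lemma star_symmetric_X2 : star_symmetric (pZtoQ ('X ^+ 2 - 1)).
Proof.
have -> : pZtoQ ('X ^+ 2 - 1) = ('X - 1%:P) * ('X - (-1)%:P).
  by rewrite rmorphB rmorphXn /= map_polyX rmorph1 polyCN polyC1 opprK; ring.
by apply: star_symmetricM; apply: star_symmetric_lin; rewrite ?sqrrN expr1n.
Qed.

Lemma separable_X2M (E : {poly rat}) : separable_poly E -> E.[1] != 0 -> E.[-1] != 0 ->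
  separable_poly (('X ^+ 2 - 1) * E).
Proof.
move=> sE E1 EN1.
have -> : ('X ^+ 2 - 1) * E = E * ('X - 1%:P) * ('X - (-1)%:P).
  by rewrite polyCN polyC1; ring.
by rewrite !separable_root sE rootM root_XsubC /root E1 (negbTE EN1).
Qed.

Section EvenCase.
Variables (E : {poly int}) (m : nat).
Hypotheses (symE : star_symmetric (pZtoQ E)) (E0 : E.[0] = 1) (dE : deg E = (m + m)%N).
Hypothesis sepE : separable_poly (pZtoQ E).

Lemma even_case_nonzero : E.[1] != 0 /\ E.[-1] != 0.
Proof.
have h (eta : rat) : eta ^+ 2 = 1 -> (pZtoQ E).[eta] != 0.
  move=> eta2; apply: separable_star_root => //.
    by rewrite horner0_map_intr E0.
  by rewrite /deg size_map_intr -/(deg E) dE oddD addbb.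
split; [have := h 1 | have := h (-1)]; rewrite ?sqrrN expr1n.
  by rewrite horner1_map_intr intr_eq0; apply.
by rewrite hornerN1_map_intr intr_eq0; apply.
Qed.

Let P := ('X ^+ 2 - 1) * E.

Lemma even_case_block : exists G C : 'M[int]_(m.+1 + m.+1), even_isometry R G C m.+1 P /\
    forall (eta : int) v, eta ^+ 2 = 1 -> P = ('X - eta%:P) * v ->
    exists vv : 'rV_(m.+1 + m.+1), [/\ vv != 0, vv *m C = eta *: vv &
      vv *m G *m vv^T = (eta ^+ m * v.[eta])%:M].
Proof.
have [E1 EN1] := even_case_nonzero; have [mE _ _] := symE.
have EQ0 := monic_neq0 mE.
apply: toeplitz_star.
- by rewrite rmorphM; apply: star_symmetricM => //; exact: star_symmetric_X2.
- by rewrite /P hornerM E0 mulr1 hornerD hornerN hornerXn hornerC expr0n sub0r.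
- rewrite /deg -(size_map_intr rat) rmorphM /= -/(deg _) degM //; last first.
    by case: star_symmetric_X2 => /monic_neq0.
  rewrite [deg (pZtoQ E)]/deg size_map_intr -/(deg E) dE /deg size_map_intr.
  by rewrite size_XnsubC //= !addSn addnS.
- rewrite rmorphM rmorphB rmorphXn /= map_polyX rmorph1; apply: separable_X2M => //.
    by rewrite horner1_map_intr intr_eq0.
  by rewrite hornerN1_map_intr intr_eq0.
Qed.

End EvenCase.

(** The case E = 1 of the previous block. The cofactor X + eta gives the eigenvector, and its value
    2 eta at [eta] gives the norm. *)
Lemma swap_block : exists G C : 'M[int]_(1 + 1), even_isometry R G C 1 ('X ^+ 2 - 1) /\
    forall eta : int, eta ^+ 2 = 1 ->
    exists vv : 'rV_(1 + 1), [/\ vv != 0, vv *m C = eta *: vv &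
      vv *m G *m vv^T = (2 * eta)%:M].
Proof.
have h1 : star_symmetric (pZtoQ 1).
  rewrite rmorph1; split; rewrite ?monic1 ?hornerC ?oner_eq0 //.
  apply/polyP => k; rewrite coef_star hornerC invr1 mul1r size_poly1 coefC.
  case: k => [|k] /=; last by rewrite coef1.
  by rewrite /deg size_poly1 coef1.
have [||||G [C [hei hv]]] := @even_case_block 1 0.
- exact: h1.
- by rewrite hornerC.
- by rewrite /deg size_poly1.
- by rewrite rmorph1 unlock /separable_poly coprime1p.
exists G, C; rewrite mulr1 in hei hv; split=> // eta eta2.
have [|vv [v0 vC vG]] := hv eta ('X + eta%:P) eta2.
  transitivity ('X ^+ 2 - (eta ^+ 2)%:P : {poly int}); first by rewrite eta2.
  by rewrite rmorphXn /=; ring.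
by exists vv; split=> //; rewrite vG expr0 mul1r !hornerE; congr _%:M; ring.
Qed.

End Assembly.

(** * Removing surplus factors by isotropic reduction *)

Lemma int_sqr1 (x : int) : x ^+ 2 = 1 -> x = 1 \/ x = -1.
Proof. by move/eqP; rewrite sqrf_eq1 => /orP[]/eqP; [left|right]. Qed.

Lemma X2_factor (eta : int) : eta ^+ 2 = 1 ->
  'X ^+ 2 - 1 = ('X - eta%:P) * ('X + eta%:P) :> {poly int}.
Proof.
move=> eta2; transitivity ('X ^+ 2 - (eta ^+ 2)%:P : {poly int}); first by rewrite eta2.
by rewrite rmorphXn /=; ring.
Qed.

Section EvenReduction.
Variables (R : realType) (E : {poly int}) (m : nat).
Hypotheses (symE : star_symmetric (pZtoQ E)) (E0 : E.[0] = 1) (dE : deg E = (m + m)%N).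
Hypothesis sepE : separable_poly (pZtoQ E).

Let P := ('X ^+ 2 - 1) * E.

(** The eigenvectors [w] and [u] of the two blocks have norms 2 eta * eta^m E(eta) and 2 eta * dl,
    so w + c u is isotropic under the stated equation. The sign [dl] is fixed before [eta], so that
    one lattice can serve both eigenvalues. *)
Lemma even_case_sum (dl : int) : dl ^+ 2 = 1 ->
  exists N (G C : 'M[int]_N), even_isometry R G C (m.+1 + 1) (P * ('X ^+ 2 - 1)) /\
    forall eta c : int, eta ^+ 2 = 1 -> eta ^+ m * E.[eta] = - dl * c ^+ 2 ->
    exists z : 'rV_N, [/\ z != 0, z *m C = eta *: z & z *m G *m z^T = 0].
Proof.
move=> dl2; have [G0 [C0 [h0 v0]]] := even_case_block R symE E0 dE sepE.
have [G1 [C1 [h1 v1]]] := swap_block R.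
have hd : even_isometry R (dl *: G1) C1 1 ('X ^+ 2 - 1).
  by have [->|->] := int_sqr1 dl2; [rewrite scale1r | rewrite scaleN1r; apply: ei_opp].
exists (m.+1 + m.+1 + (1 + 1))%N, (block_mx G0 0 0 (dl *: G1)), (block_mx C0 0 0 C1).
split; first exact: ei_block.
move=> eta c eta2 eE.
have [|w [w0 wC wG]] := v0 eta (('X + eta%:P) * E) eta2.
  by rewrite mulrA -X2_factor.
have [u [u0 uC uG]] := v1 eta eta2.
exists (row_mx w (c *: u)); split.
- by apply: contra_neq w0 => /(congr1 lsubmx); rewrite row_mxKl => ->; apply/matrixP => i j; rewrite !mxE.
- rewrite mul_row_block !mulmx0 addr0 add0r wC -scalemxAl uC scale_row_mx.
  by rewrite !scalerA mulrC.
rewrite mul_row_block !mulmx0 addr0 add0r tr_row_mx mul_row_col wG.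
have -> : c *: u *m (dl *: G1) *m (c *: u)^T = (c * dl * c) *: (u *m G1 *m u^T).
  rewrite -(scalemxAl c u) -(scalemxAr dl u) [(c *: u)^T]linearZ /= -scalemxAr -!scalemxAl.
  by rewrite !scalerA; congr (_ *: _); ring.
rewrite uG hornerM hornerD hornerX hornerC scale_scalar_mx -raddfD /=.
rewrite -[0](raddf0 scalar_mx); congr _%:M.
transitivity (2 * eta * (eta ^+ m * E.[eta]) + c * dl * c * (2 * eta)); first by ring.
by rewrite eE; ring.
Qed.

Lemma even_case_reduce (eta c : int) (dl : int) : eta ^+ 2 = 1 -> dl ^+ 2 = 1 ->
  eta ^+ m * E.[eta] = - dl * c ^+ 2 ->
  exists k i, has_lattice R (('X + eta%:P) ^+ 2 * E) k i.
Proof.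
move=> eta2 dl2 eE; have [N [G [C [h hz]]]] := even_case_sum dl2.
have [z [z0 zC zz]] := hz eta c eta2 eE.
have [N' [G' [C' [k' [F' [_ FE h' _]]]]]] := isotropic_reduction h eta2 z0 zC zz.
have [i hi] := ei_has_lattice h'; exists k', i; suff <- : F' = ('X + eta%:P) ^+ 2 * E by [].
have X0 : ('X - eta%:P) ^+ 2 != 0 :> {poly int} by rewrite expf_neq0 // polyXsubC_eq0.
by apply: (mulfI X0); rewrite -FE /P (X2_factor eta2); ring.
Qed.

(** Both equations share [dl], so both isotropic vectors lie in one lattice, and the one for -1
    passes to the reduction at 1. *)
Lemma even_case_reduce2 (c d : int) (dl : int) : dl ^+ 2 = 1 ->
  E.[1] = - dl * c ^+ 2 -> (-1) ^+ m * E.[-1] = - dl * d ^+ 2 ->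
  exists k i, has_lattice R E k i.
Proof.
move=> dl2 e1 eN1; have [N [G [C [h hz]]]] := even_case_sum dl2.
have [|z [z0 zC zz]] := hz 1 c (expr1n _ _); first by rewrite expr1n mul1r.
have [y [y0 yC yy]] := hz (-1) d (etrans (sqrrN _) (expr1n _ _)) eN1.
have [N' [G' [C' [k' [F' [_ FE h' hy]]]]]] := isotropic_reduction h (expr1n _ _) z0 zC zz.
(* Eigenvectors for 1 and -1 are orthogonal: invariance gives b(y, z) = -b(y, z). *)
have yz : y *m G *m z^T = 0.
  have e : y *m G *m z^T = - (y *m G *m z^T).
    transitivity (y *m C *m G *m (z *m C)^T).
      have isoY : y *m C *m G *m C^T = y *m G by rewrite -2!(mulmxA y) (ei_iso h).
      by rewrite trmx_mul !mulmxA isoY.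
    by rewrite yC zC scale1r scaleN1r !mulNmx.
  apply/matrixP => i j; have /matrixP/(_ i j) := e; rewrite !mxE.
  exact: int_self_opp.
have [y' [y'0 y'C y'y']] := hy (-1) y isT y0 yC yz yy.
have [N2 [G2 [C2 [k2 [F2 [_ FE2 h2 _]]]]]] :=
  isotropic_reduction h' (etrans (sqrrN _) (expr1n _ _)) y'0 y'C y'y'.
have [i hi] := ei_has_lattice h2; exists k2, i; suff <- : F2 = E by [].
have X0 (eta : int) : ('X - eta%:P) ^+ 2 != 0 :> {poly int}.
  by rewrite expf_neq0 // polyXsubC_eq0.
apply: (mulfI (X0 (-1))); apply: (mulfI (X0 1)).
rewrite -FE2 -FE /P [in LHS](X2_factor (expr1n _ 2)) polyCN polyC1; ring.
Qed.

End EvenReduction.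

(** A factor [h] vanishing at [eta] is X - eta, and so is its star; its block (X - eta)^2 can
    therefore be exchanged for another source of the same factor. *)
Lemma seq_split_hyp (hs : seq {poly int}) (eta : int) :
  (forall h, h \in hs -> hyp_factor h) -> eta ^+ 2 = 1 ->
  (\prod_(h <- hs) (h * istar h)).[eta] = 0 ->
  exists hs', [/\ 'X - eta%:P \in hs, (forall h, h \in hs' -> hyp_factor h),
     hs' = rem ('X - eta%:P) hs &
     \prod_(h <- hs) (h * istar h) = ('X - eta%:P) ^+ 2 * \prod_(h <- hs') (h * istar h)].
Proof.
move=> hP eta2 e0.
have X : 'X - eta%:P \in hs.
  move: e0; rewrite horner_prod => /eqP; rewrite prodf_seq_eq0 => /hasP[h hin /= /eqP].
  have hh := hP h hin; have [_ h2 _] := hh.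
  rewrite hornerM horner_istar // => e; suff : h.[eta] = 0 by move/(hyp_factor_root hh) => <-.
  have h0 : h.[0] != 0 by apply: contra_eq_neq h2 => ->; rewrite expr0n.
  have eta0 : eta != 0 by apply: contra_eq_neq eta2 => ->; rewrite expr0n.
  apply/eqP; move/eqP: e.
  by rewrite !mulf_eq0 expf_eq0 (negbTE h0) (negbTE eta0) andbF /= orbb.
exists (rem ('X - eta%:P) hs); split=> //.
  by move=> h /mem_rem; exact: hP.
by rewrite (perm_big _ (perm_to_rem X)) /= big_cons istar_lin // -expr2.
Qed.

Lemma square_up_to_sign (x A a : int) : A != 0 -> `|x| * A ^+ 2 = a ^+ 2 ->
  exists dl c : int, dl ^+ 2 = 1 /\ x = - dl * c ^+ 2.
Proof.
move=> A0 /(int_square_quotient A0)[c cE]; have [x0|x0] := lerP 0 x.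
  by exists (-1), c; rewrite sqrrN expr1n opprK mul1r -cE ger0_norm.
by exists 1, c; rewrite expr1n mulN1r -cE ltr0_norm // opprK.
Qed.

Lemma separable_X2 : separable_poly (pZtoQ ('X ^+ 2 - 1)).
Proof.
rewrite rmorphB rmorphXn /= map_polyX rmorph1 -[_ - _]mulr1.
by apply: separable_X2M; rewrite ?hornerC ?oner_eq0 // unlock /separable_poly coprime1p.
Qed.

Theorem theorem1p4 (R : realType) (n : nat) (F : {poly int}) (ip im : int) :
  let FQ : {poly rat} := map_poly intr F in
  let FR : {poly R} := map_poly intr F in
  let mp : nat := mult ('X - 1) FQ in
  let mm : nat := mult ('X + 1) FQ in
  star_symmetric FQ ->
  deg F = (2 * n)%N ->
  Square F ->
  - mp%:Z <= ip <= mp%:Z ->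
  - mm%:Z <= im <= mm%:Z ->
  (ip = im %[mod 2])%Z ->
  (im = mp %[mod 2])%Z ->
  (ip + im = 1 - esign (F12 FR) %[mod 4])%Z ->
  (mp <> 1%N /\ mm <> 1%N) \/
  (exists s : seq nat, all (leq 1) s /\ F = \prod_(k <- s) 'Phi_k) ->
  exists j : {poly R} -> int,
    [/\ Idx n n FR j,
        (j ('X - 1) = ip %[mod 4])%Z,
        (j ('X + 1) = im %[mod 4])%Z &
        exists (L : lattice) (T : 'M[int]_(rank L)),
          [/\ even L, unimodular L, has_signature R L n n,
              Fj_isometry F j T &
              semisimple (map_mx intr T : 'M[rat]_(rank L))]].
Proof.
move=> FQ FR mp mm symF dF [[a1 sq1] [a2 sq2] [a3 sq3]] bip bim par1 par2 e4 _.
suff [k [i [hi ei]]] : exists k i, has_lattice R F k i /\ (i = ip %[mod 4])%Z.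
  exact: has_lattice_main hi dF ei e4.
have parF k i : has_lattice R F k i -> (i = ip %[mod 2])%Z.
  move=> /has_lattice_mod2; rewrite -/FQ -/mp => ->.
  by move: par1 par2; clear; lia.
have FQ0 : FQ != 0 by case: symF => /monic_neq0.
have [E [hs [FE symE sepE hP]]] := star_factorization symF.
have hl := has_lattice_prod R hP.
have [s [A [B [s2 PiA PiB]]]] := prod_hyp_values hP.
have split_hs (eta : int) := @seq_split_hyp hs eta hP.
move: hl FE PiA PiB split_hs.
set kh := (\sum_(h <- hs) deg h)%N; set Pi := \prod_(h <- hs) (h * istar h).
move=> hl FE PiA PiB split_hs.
have [mP dP] := has_lattice_deg hl.
have mE : E \is monic by rewrite -(map_intr_monic rat); case: symE.
have dFE : deg F = (deg E + (kh + kh))%N.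
  rewrite -dP FE /deg size_monicM ?monic_neq0 //.
  have : (0 < size E)%N by rewrite size_poly_gt0 monic_neq0.
  have : (0 < size Pi)%N by rewrite size_poly_gt0 monic_neq0.
  by move: (size E) (size Pi) => x y; clear; lia.
have [m dE] : exists m, deg E = (m + m)%N.
  by exists (n - kh)%N; move: dFE; rewrite dF; move: (deg E) => x; clear; lia.
have nm : n = (m + kh)%N by move: dFE; rewrite dF dE; clear; lia.
have E02 : E.[0] ^+ 2 = 1.
  apply: (@intr_inj rat); rewrite rmorphXn /= -horner0_map_intr.
  exact: star_symmetric_const.
have [E0|E0] := int_sqr1 E02; last first.
  (* Degree 0 would make the monic [E] equal to 1, against E(0) = -1. *)
  have [m' mE'] : exists m', m = m'.+1.
    case: m dE {nm} => [|m'] dE; last by exists m'.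
    have := monicP mE; rewrite /lead_coef -/(deg E) dE -horner_coef0 E0 => /eqP.
    by [].
  rewrite mE' in dE.
  have [G [C [hei _]]] := toeplitz_star R symE E0 dE sepE.
  have [i0 hi0] := ei_has_lattice hei.
  have E1 : E.[1] = 0.
    have [_ _ sE] := symE; have := congr1 (fun q : {poly rat} => q.[1]) sE.
    rewrite /= horner_star ?oner_neq0 // expr1n mul1r invr1 horner0_map_intr E0 horner1_map_intr.
    rewrite rmorphN1 invrN1 mulN1r -rmorphN /= => /intr_inj /esym.
    exact: int_self_opp.
  have odd0 := odd_index E1 sepE hi0.
  have hF := has_latticeM hi0 hl; have hF' := has_latticeM (has_latticeN hi0) hl.
  rewrite -FE !addr0 in hF hF'.
  have par := parF _ _ hF.
  (* [i0] is odd, so [i0] and [- i0] represent both odd classes modulo 4. *)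
  have [e|e] : (i0 = ip %[mod 4])%Z \/ (- i0 = ip %[mod 4])%Z.
    by move: odd0 par; clear; lia.
    by exists (m'.+1 + kh)%N, i0.
  by exists (m'.+1 + kh)%N, (- i0).
have [E1 EN1] := even_case_nonzero symE E0 dE sepE.
have F1E : F.[1] = E.[1] * (s * A ^+ 2) by rewrite FE hornerM PiA.
have FN1E : F.[-1] = E.[-1] * (s * (-1) ^+ kh * B ^+ 2) by rewrite FE hornerM PiB.
have ns : `|s| = 1 by have [->|->] := int_sqr1 s2.
have sN (t : nat) : `|(-1) ^+ t| = 1 :> int by rewrite normrX normrN1 expr1n.
(* |F(1)| = |E(1)| A^2 is a square and A <> 0, so |E(1)| is a square; [dl] records the sign of
   E(1). *)
have c1 : F.[1] != 0 -> exists dl c : int, dl ^+ 2 = 1 /\ E.[1] = - dl * c ^+ 2.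
  move=> F1; apply: (@square_up_to_sign _ A a1).
    by apply: contra_neq F1 => A0; rewrite F1E A0 expr0n !mulr0.
  by rewrite -sq1 F1E (normrM E.[1]) (normrM s) ns mul1r (ger0_norm (sqr_ge0 A)).
have cN1 : F.[-1] != 0 ->
    exists dl c : int, dl ^+ 2 = 1 /\ (-1) ^+ m * E.[-1] = - dl * c ^+ 2.
  move=> F1; apply: (@square_up_to_sign _ B a2).
    by apply: contra_neq F1 => B0; rewrite FN1E B0 expr0n !mulr0.
  by rewrite -sq2 FN1E (normrM E.[-1]) (normrM (s * _)) (normrM s) (normrM _ E.[-1]) !sN ns
    !mul1r (ger0_norm (sqr_ge0 B)).
have mp0 : F.[1] != 0 -> ip = 0.
  move=> F1; have mp0 : mp = 0%N.
    by apply: mult_eq0 => //; rewrite ?dvdp_X1 ?horner1_map_intr ?intr_eq0 //; exact: irredp_X1.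
  by move: bip; rewrite mp0; clear; lia.
have mm0 : F.[-1] != 0 -> im = 0.
  move=> F1; have mm0 : mm = 0%N.
    by apply: mult_eq0 => //; rewrite ?dvdp_XN1 ?hornerN1_map_intr ?intr_eq0 //; exact: irredp_XN1.
  by move: bim; rewrite mm0; clear; lia.
have X1E : ('X + 1%:P) ^+ 2 = ('X - (-1)%:P) ^+ 2 :> {poly int}.
  by rewrite polyCN opprK.
have X2N : ('X ^+ 2 - 1) ^+ 2 = ('X - 1%:P) ^+ 2 * ('X - (-1)%:P) ^+ 2 :> {poly int}.
  by rewrite (X2_factor (expr1n _ 2)) polyCN opprK exprMn.
(* Since [E] does not vanish at 1 and -1, a zero of [F] there comes from the hyperbolic product. The
   corresponding square is then taken from (X^2 - 1)^2 E instead. *)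
have [F1|F1] := eqVneq F.[1] 0; have [FN1|FN1] := eqVneq F.[-1] 0.
- have [||hs1 [in1 hP1 hs1E PiE1]] := split_hs 1; first by rewrite expr1n.
    by move: F1; rewrite FE hornerM => /eqP; rewrite mulf_eq0 (negbTE E1) => /eqP.
  have [||hs2 [in2 hP2 hs2E PiE2]] := @seq_split_hyp hs1 (-1) hP1; first by rewrite sqrrN expr1n.
    move: FN1; rewrite FE hornerM => /eqP; rewrite mulf_eq0 (negbTE EN1) /= PiE1 hornerM.
    by rewrite mulf_eq0 horner_exp hornerXsubC => /eqP.
  have [G0 [C0 [h0 _]]] := even_case_block R symE E0 dE sepE.
  have [G1 [C1 [h1 _]]] := swap_block R.
  have [i0 hi0] := ei_has_lattice h0; have [i1 hi1] := ei_has_lattice h1.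
  have X21 : ('X ^+ 2 - 1 : {poly int}).[1] = 0 by rewrite hornerD hornerN hornerXn hornerC expr1n subrr.
  have o0 : (i0 = 1 %[mod 2])%Z.
    apply: (odd_index _ _ hi0); first by rewrite hornerM X21 mul0r.
    rewrite rmorphM rmorphB rmorphXn /= map_polyX rmorph1.
    by apply: separable_X2M; rewrite ?horner1_map_intr ?hornerN1_map_intr ?intr_eq0.
  have o1 : (i1 = 1 %[mod 2])%Z by apply: (odd_index X21 separable_X2 hi1).
  have h2 := has_lattice_prod R hP2.
  have FE' : F = ('X ^+ 2 - 1) * E * ('X ^+ 2 - 1) * \prod_(h <- hs2) (h * istar h).
    by rewrite FE PiE1 PiE2 mulrA mulrA -(mulrA E) -X2N; ring.
  have hF := has_latticeM (has_latticeM hi0 hi1) h2.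
  have hF' := has_latticeM (has_latticeM hi0 (has_latticeN hi1)) h2.
  rewrite -FE' !addr0 in hF hF'.
  have par := parF _ _ hF.
  (* [i0] and [i1] are odd, so the sum and the difference are the two even classes modulo 4. *)
  have [e|e] : (i0 + i1 = ip %[mod 4])%Z \/ (i0 - i1 = ip %[mod 4])%Z.
    by move: o0 o1 par; clear; lia.
    by do 2 eexists; split; [exact: hF|].
  by do 2 eexists; split; [exact: hF'|].
- have [||hs1 [in1 hP1 hs1E PiE1]] := split_hs 1; first by rewrite expr1n.
    by move: F1; rewrite FE hornerM => /eqP; rewrite mulf_eq0 (negbTE E1) => /eqP.
  have [dl [c [dl2 ce]]] := cN1 FN1.
  (* Reducing at -1 leaves (X - 1)^2 E, whose square replaces the factor removed from [hs]. The
     index at X - 1 is then forced by F(-1) <> 0 and im = 0. *)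
  have [|k [i hi]] := even_case_reduce R symE E0 dE sepE _ dl2 ce; first by rewrite sqrrN expr1n.
  have hF := has_latticeM hi (has_lattice_prod R hP1).
  rewrite (_ : _ * _ = F) in hF; last first.
    by rewrite FE PiE1 polyCN; ring.
  do 2 eexists; split; first exact: hF.
  by rewrite (has_lattice_mod4_rootN1 hF FN1) -e4 (mm0 FN1) addr0.
- have [||hs1 [in1 hP1 hs1E PiE1]] := split_hs (-1); first by rewrite sqrrN expr1n.
    by move: FN1; rewrite FE hornerM => /eqP; rewrite mulf_eq0 (negbTE EN1) => /eqP.
  have [dl [c [dl2 ce]]] := c1 F1.
  have [||k [i hi]] := @even_case_reduce R E m symE E0 dE sepE 1 c dl _ dl2.
  - by rewrite expr1n.
  - by rewrite expr1n mul1r.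
  have hF := has_latticeM hi (has_lattice_prod R hP1).
  rewrite (_ : _ * _ = F) in hF; last by rewrite FE PiE1 X1E; ring.
  do 2 eexists; split; first exact: hF.
  by rewrite (has_lattice_mod4_root1 hF F1) (mp0 F1).
have [dl [c [dl2 ce]]] := c1 F1; have [dl' [d [dl2' de]]] := cN1 FN1.
(* Opposite signs would make (-1)^n F(1) F(-1), which is a nonzero square, also the negative of a
   square. *)
have dlE : dl' = dl.
  apply/eqP; apply: contraTT isT => ne.
  have dlN : dl' = - dl.
    by move: ne; case: (int_sqr1 dl2) (int_sqr1 dl2') => -> [] ->.
  have : a3 ^+ 2 = - (c * d * A * B) ^+ 2.
    rewrite -sq3 F1E FN1E dF mulKn // nm exprD.
    transitivity (E.[1] * ((-1) ^+ m * E.[-1]) * s ^+ 2 * ((-1) ^+ kh) ^+ 2 * (A * B) ^+ 2); first by ring.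
    rewrite s2 sqrr_sign ce de dlN.
    transitivity (- dl ^+ 2 * (c * d * A * B) ^+ 2); first by ring.
    by rewrite dl2 mulN1r.
  have a30 : a3 != 0.
    have : a3 ^+ 2 != 0 by rewrite -sq3 !mulf_neq0 // expf_neq0.
    by rewrite expf_eq0.
  move=> e; have : 0 < a3 ^+ 2 by rewrite exprn_even_gt0.
  by rewrite e oppr_gt0 ltNge sqr_ge0.
rewrite dlE in de.
have [k [i hi]] := even_case_reduce2 R symE E0 dE sepE dl2 ce de.
have hF := has_latticeM hi hl; rewrite -FE in hF.
do 2 eexists; split; first exact: hF.
by rewrite (has_lattice_mod4_root1 hF F1) (mp0 F1).
Qed.
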